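(* Let $m\in\mathbb{N}$ and $\mu\in\mathcal{P}_m(\Delta)$ (in either the Laguerre case or the Hermite case). Then: a) If $\nu_n$ and $\sigma_n$ denote the normalized root counting measures of $\widehat{\mathfrak{Q}}_n$ and $\widehat{\mathfrak{Q}}_n'$ respectively ($n>m$), then $\nu_n\to\nu_w$ and $\sigma_n\to\nu_w$ as $n\to\infty$ in the weak star sense. b) The set of accumulation points of the zeros of $\{\widehat{\mathfrak{Q}}_n\}_{n=m+1}^{\infty}$ is $\Delta_c$.
   Context: Two cases are treated in parallel. Laguerre case: fix $\alpha>-1$; $\Delta=\mathbb{R}_+=[0,\infty)$, $dw(x)=x^{\alpha}e^{-x}dx$ on $\Delta$, $\mathcal{L}[f]=xf''+(1+\alpha-x)f'$, $L_n$ is the $n$th monic orthogonal (Laguerre) polynomial with respect to $w$, $c_n=4n$, $\Delta_c=[0,1]$, and $d\nu_w(t)=\frac{2}{\pi}\sqrt{\frac{1-t}{t}}\,dt$ on $[0,1]$. Hermite case: $\Delta=\mathbb{R}$, $dw(x)=e^{-x^2}dx$, $\mathcal{L}[f]=\frac12 f''-xf'$, $L_n$ is the $n$th monic orthogonal (Hermite) polynomial with respect to $w$, $c_n=\sqrt{2n}$, $\Delta_c=[-1,1]$, and $d\nu_w(t)=\frac{2}{\pi}\sqrt{1-t^2}\,dt$ on $[-1,1]$. In both cases put $\lambda_n=-n$, so that $\mathcal{L}[L_n]=\lambda_nL_n$. $\mathcal{P}_m(\Delta)$ is the family of finite positive Borel measures $\mu$ supported on $\Delta$ for which there is a polynomial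 $\rho$ of degree $m$ such that $d\mu=\rho^{-1}dw$. For $\mu\in\mathcal{P}_m(\Delta)$, $\{P_n\}_{n\ge0}$ is the sequence of monic orthogonal polynomials with respect to $\mu$. For $n>m$ one has $P_n=\sum_{k=0}^m b_{n,n-k}L_{n-k}$ with $b_{n,n-k}=\frac{1}{\int L_{n-k}^2dw}\int P_nL_{n-k}\,dw$, and one defines the monic polynomials $$\widehat{Q}_n(z)=\sum_{k=0}^m\frac{\lambda_n}{\lambda_{n-k}}b_{n,n-k}L_{n-k}(z),\qquad \widehat{\mathfrak{Q}}_n(z)=c_n^{-n}\widehat{Q}_n(c_nz).$$ (Thus $\mathcal{L}[\widehat Q_n]=\lambda_nP_n$.) The normalized root counting measure of a polynomial $q$ of degree $N$ is $\frac1N\sum_{q(\omega)=0}\delta_\omega$, zeros counted with multiplicity, $\delta_\omega$ being the unit point mass at $\omega$. An accumulation point of the zeros of a sequence of polynomials is a point each neighbourhood of which contains zeros of infinitely many members of the sequence. *)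

(* Defs.v *)
From HB Require Import structures.
From mathcomp Require Import all_boot all_order all_algebra.
From mathcomp Require Import complex.
From mathcomp Require Import all_classical all_reals all_analysis.
From mathcomp Require Import measurable_realfun.

Set Implicit Arguments.
Unset Strict Implicit.
Unset Printing Implicit Defensive.

Import Order.TTheory GRing.Theory Num.Theory.
Import numFieldNormedType.Exports.

Local Open Scope classical_set_scope.
Local Open Scope ring_scope.

(* The topology of R[i] given by the modulus; the library declares it only for
   abstract numeric field types. *)
HB.instance Definition _ (R : realType) :=
  PseudoPointedMetric.copy R[i] (R[i] : numClosedFieldType).

Definition borelC (R : realType) := g_sigma_algebraType (@open R[i]).

Inductive weight_case (R : Type) := Laguerre of R | Hermite.
Arguments Hermite {R}.

Section weights.
Context {R : realType}.
Implicit Type c : weight_case R.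
Local Notation leb := (@lebesgue_measure R).

Definition admissible c : Prop := if c is Laguerre alpha then -1 < alpha else True.

Definition Delta c : set R := if c is Laguerre _ then `[0, +oo[ else setT.

Definition Delta_c c : set R := if c is Laguerre _ then `[0, 1] else `[-1, 1].

Definition scale c (n : nat) : R :=
  if c is Laguerre _ then 4 * n%:R else Num.sqrt (2 * n%:R).

Definition w_density c (x : R) : R :=
  if c is Laguerre alpha then x `^ alpha * expR (- x) else expR (- x ^+ 2).

Definition nu_density c (t : R) : R :=
  2 / pi * (if c is Laguerre _ then Num.sqrt ((1 - t) / t)
            else Num.sqrt (1 - t ^+ 2)).

Definition w c : set (measurableTypeR R) -> \bar R := fun A =>
  (\int[leb]_(x in A) (w_density c x * \1_(Delta c) x)%:E)%E.

Definition nu_line c : set (measurableTypeR R) -> \bar R := fun A =>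
  (\int[leb]_(t in A) (nu_density c t * \1_(Delta_c c) t)%:E)%E.

Lemma w_density_ge0 c x : 0 <= w_density c x * \1_(Delta c) x.
Proof.
by case: c => [alpha|] /=; rewrite mulr_ge0 ?mulr_ge0 ?powR_ge0 ?expR_ge0.
Qed.

Lemma nu_density_ge0 c t : 0 <= nu_density c t * \1_(Delta_c c) t.
Proof.
rewrite mulr_ge0// /nu_density mulr_ge0 ?divr_ge0 ?pi_ge0//.
by case: c => [alpha|]; exact: sqrtr_ge0.
Qed.

Lemma measurable_w_density c :
  measurable_fun [set: R] (EFin \o (fun x => w_density c x * \1_(Delta c) x)).
Proof.
apply/measurable_EFinP; apply: measurable_funM; last first.
  by apply: measurable_indic; case: c => [alpha|] //=; exact: measurable_itv.
case: c => [alpha|] /=.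
  apply: measurable_funM; first exact: (measurable_powR alpha).
  by apply: measurableT_comp.
by apply: measurableT_comp => //; apply: measurableT_comp => //.
Qed.

Lemma measurable_sqrt : measurable_fun [set: R] (@Num.sqrt R).
Proof. by apply: continuous_measurable_fun; exact: sqrt_continuous. Qed.

Lemma measurable_inv : measurable_fun [set: R] (@GRing.inv R).
Proof.
rewrite -(setUv [set (0 : R)]); apply/measurable_funU => //.
  exact: measurableC.
split; first exact: measurable_fun_set1.
apply: open_continuous_measurable_fun.
  exact/closed_openC/closed_eq.
by move=> x; rewrite inE /= => /eqP x0; exact: inv_continuous.
Qed.

Lemma measurable_nu_density c :
  measurable_fun [set: R] (EFin \o (fun t => nu_density c t * \1_(Delta_c c) t)).
Proof.
apply/measurable_EFinP; apply: measurable_funM; last first.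
  by apply: measurable_indic; case: c => [alpha|] //=; exact: measurable_itv.
apply: measurable_funM => //.
case: c => [alpha|] /=.
  apply: (@measurableT_comp _ _ _ _ _ _ (@Num.sqrt R) _ _ measurable_sqrt).
  apply: measurable_funM; first exact: measurable_funB.
  exact: measurable_inv.
apply: (@measurableT_comp _ _ _ _ _ _ (@Num.sqrt R) _ _ measurable_sqrt).
apply: measurable_funB => //; exact: measurable_funX.
Qed.

Let w0 c : w c set0 = 0%E. Proof. exact: integral_set0. Qed.
Let w_ge0 c A : (0 <= w c A)%E.
Proof. by apply: integral_ge0 => x _; rewrite lee_fin w_density_ge0. Qed.
Let w_sigma_additive c : semi_sigma_additive (w c).
Proof.
apply: (@semi_sigma_additive_nng_induced _ _ _ leb _ (measurable_w_density c)).
by move=> x; rewrite lee_fin w_density_ge0.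
Qed.
HB.instance Definition _ c := isMeasure.Build _ _ _ (w c)
  (w0 c) (w_ge0 c) (@w_sigma_additive c).

Let nu0 c : nu_line c set0 = 0%E. Proof. exact: integral_set0. Qed.
Let nu_ge0 c A : (0 <= nu_line c A)%E.
Proof. by apply: integral_ge0 => x _; rewrite lee_fin nu_density_ge0. Qed.
Let nu_sigma_additive c : semi_sigma_additive (nu_line c).
Proof.
apply: (@semi_sigma_additive_nng_induced _ _ _ leb _ (measurable_nu_density c)).
by move=> x; rewrite lee_fin nu_density_ge0.
Qed.
HB.instance Definition _ c := isMeasure.Build _ _ _ (nu_line c)
  (nu0 c) (nu_ge0 c) (@nu_sigma_additive c).

Lemma measurable_real_complex :
  measurable_fun [set: measurableTypeR R]
    (real_complex R : measurableTypeR R -> borelC R).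
Proof.
apply: (@measurability _ _ _ (borelC R) setT _ (@open R[i])) => // _ [U oU <-].
rewrite setTI; apply: open_measurable.
rewrite openE => x /= Ux; have := open_nbhs_nbhs (conj oU Ux).
move=> /nbhs_ballP[e /= e0 eU]; apply/nbhs_ballP.
case: e e0 eU => a b /=; rewrite ltcE /= => /andP[/eqP -> a0] eU.
exists a => //= y xy; apply: eU; move: xy; rewrite /ball /= => xy.
by rewrite -rmorphB normc_def /= expr0n addr0 sqrtr_sqr ltcR.
Qed.

(* The measure nu_w, carried by a real interval, as a measure on the plane. *)
Definition nu c : set (borelC R) -> \bar R :=
  pushforward (nu_line c) (real_complex R : measurableTypeR R -> borelC R).

Let nuC0 c : nu c set0 = 0%E.
Proof. by rewrite /nu /pushforward preimage_set0 measure0. Qed.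
Let nuC_ge0 c A : (0 <= nu c A)%E. Proof. exact: nu_ge0. Qed.
Let nuC_sigma_additive c : semi_sigma_additive (nu c).
Proof.
move=> F mF tF mUF; rewrite /nu /pushforward preimage_bigcup.
apply: measure_semi_sigma_additive.
- by move=> n; rewrite -[X in measurable X]setTI; exact: measurable_real_complex.
- apply/trivIsetP => /= i j _ _ ij; rewrite -preimage_setI.
  by move/trivIsetP : tF => /(_ _ _ _ _ ij) ->//; rewrite preimage_set0.
- by rewrite -preimage_bigcup -[X in measurable X]setTI; exact: measurable_real_complex.
Qed.
HB.instance Definition _ c := isMeasure.Build _ _ _ (nu c)
  (nuC0 c) (nuC_ge0 c) (@nuC_sigma_additive c).

End weights.

Section orthogonality.
Context {R : realType}.
Implicit Types (c : weight_case R) (P L : nat -> {poly R}).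

Definition monic_OPS (mu : {measure set (measurableTypeR R) -> \bar R}) P : Prop :=
  (forall n, P n \is monic /\ size (P n) = n.+1) /\
  (forall i j, i != j -> \int[mu]_x ((P i).[x] * (P j).[x])%:E = 0)%E.

(* The value 0 of rho^-1 at a zero of rho is harmless, these being w-null. *)
Definition class_P c (m : nat)
    (mu : {finite_measure set (measurableTypeR R) -> \bar R}) : Prop :=
  mu (~` Delta c) = 0%E /\
  exists rho : {poly R}, size rho = m.+1 /\
    forall A : set (measurableTypeR R), measurable A ->
      mu A = (\int[w c]_(x in A) (rho.[x]^-1)%:E)%E.

Definition lam (n : nat) : R := - n%:R.

(* The coefficient b_{n,j} of L_j in P_n. *)
Definition coef_b c P L (n j : nat) : R :=
  (\int[w c]_x ((P n).[x] * (L j).[x])) / (\int[w c]_x (L j).[x] ^+ 2).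

Definition Qhat c P L (m n : nat) : {poly R} :=
  \sum_(k < m.+1)
    (lam n / lam (n - k) * coef_b c P L n (n - k)) *: L (n - k)%N.

Definition Qfrak c P L (m n : nat) : {poly R[i]} :=
  map_poly (real_complex R)
    ((scale c n ^+ n)^-1 *: (Qhat c P L m n \Po (scale c n *: 'X))).

End orthogonality.

Section zeros.
Context {R : realType}.

(* The zeros of a nonzero q, listed with multiplicity: q is its leading
   coefficient times the product of the 'X - z%:P. *)
Definition zeros (q : {poly R[i]}) : seq R[i] :=
  sval (closed_field_poly_normal q).

Definition root_counting_measure (q : {poly R[i]}) :
    {measure set (borelC R) -> \bar R} :=
  mscale ((size q).-1%:R^-1)%:nng
    (msum (fun i => \d_((zeros q)`_i : borelC R)) (size (zeros q))).

(* For probability measures with a probability measure as limit, testing against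
   bounded continuous functions, against continuous functions vanishing at
   infinity or against compactly supported ones gives the same notion. *)
Definition weak_star_cvg (mu_ : nat -> {measure set (borelC R) -> \bar R})
    (mu : {measure set (borelC R) -> \bar R}) : Prop :=
  forall f : R[i] -> R, continuous f -> (exists M, forall z, `|f z| <= M) ->
    (\int[mu_ n]_z (f z)%:E)%E @[n --> \oo] --> (\int[mu]_z (f z)%:E)%E.

Definition zero_accumulation_points (n0 : nat) (q : nat -> {poly R[i]}) : set R[i] :=
  [set z | forall U, nbhs z U ->
     infinite_set [set n | (n0 <= n)%N /\ exists2 x, U x & root (q n) x]].

End zeros.

(* Main.v *)
Require Import Defs.
From HB Require Import structures.
From mathcomp Require Import all_boot all_order all_algebra.
From mathcomp Require Import complex ring lra zify.
From mathcomp Require Import all_classical all_reals all_analysis.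
From mathcomp Require Import measurable_realfun.
Import Order.TTheory GRing.Theory Num.Theory.
Import numFieldNormedType.Exports.
Local Open Scope classical_set_scope.
Local Open Scope ring_scope.

Set Implicit Arguments.
Unset Strict Implicit.
Unset Printing Implicit Defensive.

(** Write E and M for integration of polynomials against w and mu, so that
    E p = M (rho p). Gauss quadrature shows that the zeros of L_n and P_n,
    divided by c_n, approach Delta_c, and that b_{n,n-k} = O(c_n^k), while
    rho L_n is a combination of P_n, ..., P_{n+m} with comparable coefficients.
    For x = c_n z with z away from Delta_c the ratios P_{k+1}/P_k and
    L_{k-1}/L_k are of exact order c_n and c_n^-1; hence |L_n(x)| = O(|P_n(x)|)
    and |Qhat_n(x) - P_n(x)| = O(|L_n(x)| / n), so that the zeros of the scaled
    Qhat_n approach Delta_c, and the logarithmic derivatives of Qhat_n and L_n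
    at x differ by O(1/c_n). Expanding the normalized logarithmic derivative
    at a large real point, Qhat_n, its derivative and L_n have the same limit
    moments of zeros, and Weierstrass approximation on Delta_c upgrades moment
    convergence to weak convergence. For L_n the differential equation yields
    quadratic recurrences for the power sums of the zeros; in the limit they
    become the Catalan convolution satisfied by the moments of nu_w. *)

(** * Orthogonal polynomials and Gauss quadrature *)

(** No differential equation and no explicit recurrence is known for [P]; what is known comes by
    comparison with [L], through E p = M (rho p) and quadrature at the zeros of [L]. The zeros of
    Qhat are not known in advance to be bounded, so estimates on compact sets of z would not
    suffice: the half plane constants [kap] and [K] are relative to |x|, which makes the bounds
    uniform over all z at distance at least eps from Delta_c. With n / (n - k) replaced by 1, Qhat
    becomes P_n; the small parameter is therefore k / (n - k), while P_n itself need not be close to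
    L_n. The zeros of Qhat may be nonreal, and averages of z^k alone do not determine a limit
    measure in the plane; they do so here because the zeros approach a real interval, on which real
    polynomials are dense. For the derivative, p' / p - p'' / p' is the sum of (x - z)^-2 over the
    sum of (x - z)^-1. Far out on the real axis the first is O(n) and the second is of exact order
    n, so the quotient is lost after division by n. *)

Section PositiveDefinite.
Context {R : realFieldType}.
Implicit Type E : {scalar {poly R}}.

Lemma functionalZ E a p : E (a *: p) = a * E p.
Proof. exact: linearZ. Qed.

Lemma functionalD E p q : E (p + q) = E p + E q.
Proof. exact: linearD. Qed.

Lemma functionalB E p q : E (p - q) = E p - E q.
Proof. exact: linearB. Qed.

Lemma functional0 E : E 0 = 0.
Proof. exact: linear0. Qed.

Definition posdef E := forall p, p != 0 -> 0 < E (p * p).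

Definition orthopoly E (P : nat -> {poly R}) :=
  [/\ forall n, P n \is monic, forall n, size (P n) = n.+1 &
      forall i j, i != j -> E (P i * P j) = 0].

Lemma posdef_ge0 E : posdef E -> forall p, 0 <= E (p * p).
Proof.
move=> posE p; have [->|/posE/ltW//] := eqVneq p 0.
by rewrite mul0r functional0.
Qed.

(** Positivity of E on the square of [E (q * q) *: p - E (p * q) *: q]; this combination avoids a
    division, and the common factor E (q q) is cancelled at the end. *)
Lemma posdef_CauchySchwarz E : posdef E -> forall p q,
  E (p * q) ^+ 2 <= E (p * p) * E (q * q).
Proof.
move=> posE p q; have [->|q0] := eqVneq q 0.
  by rewrite !mulr0 functional0 expr0n mulr0.
have Q := posE _ q0.
have := posdef_ge0 posE (E (q * q) *: p - E (p * q) *: q).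
set a := E (q * q) in Q *; set b := E (p * q).
have -> : (a *: p - b *: q) * (a *: p - b *: q) =
    (a * a) *: (p * p) - (2 * a * b) *: (p * q) + (b * b) *: (q * q).
  by rewrite -!mul_polyC !polyCM; ring.
rewrite functionalD functionalB !functionalZ -/a -/b => H.
suff : 0 <= a * (E (p * p) * a - b ^+ 2) by rewrite pmulr_rge0// subr_ge0.
by move: H; congr (0 <= _); ring.
Qed.

End PositiveDefinite.

Section OPS.
Context {R : realFieldType} (E : {scalar {poly R}}) (P : nat -> {poly R}).
Context (posE : posdef E) (opsP : orthopoly E P).
Implicit Types p q : {poly R}.

Lemma ops_monic n : P n \is monic. Proof. by case: opsP. Qed.
Lemma ops_size n : size (P n) = n.+1. Proof. by case: opsP. Qed.
Lemma ops_neq0 n : P n != 0. Proof. by rewrite monic_neq0 ?ops_monic. Qed.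

Lemma ops_coefn n : (P n)`_n = 1.
Proof. by have := ops_monic n; rewrite monicE lead_coefE ops_size => /eqP. Qed.

Lemma ops_norm_gt0 n : 0 < E (P n * P n).
Proof. exact/posE/ops_neq0. Qed.

Lemma size_sub_ops n p : (size p <= n.+1)%N ->
  (size (p - p`_n *: P n)%R <= n)%N.
Proof.
move=> pn; apply/leq_sizeP => j; rewrite leq_eqVlt => /orP[/eqP <-|nj].
  by rewrite coefB coefZ ops_coefn mulr1 subrr.
rewrite coefB coefZ [p`_j]nth_default ?(leq_trans pn)//.
by rewrite [(P n)`_j]nth_default ?ops_size// mulr0 subr0.
Qed.

Lemma ops_expand n p : (size p <= n)%N ->
  exists a : nat -> R, p = \sum_(i < n) a i *: P i.
Proof.
elim: n p => [|n IH] p pn.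
  exists (fun=> 0); rewrite big_ord0; apply/eqP.
  by rewrite -size_poly_eq0 -leqn0.
have [a Ha] := IH _ (size_sub_ops pn).
exists (fun i => if i == n then p`_n else a i); rewrite big_ord_recr /= eqxx.
rewrite -[LHS](subrK (p`_n *: P n)) {1}Ha; congr (_ + _).
by apply: eq_bigr => i _; rewrite ltn_eqF.
Qed.

Lemma ops_orth n p : (size p <= n)%N -> E (P n * p) = 0.
Proof.
move=> /ops_expand[a ->]; rewrite mulr_sumr linear_sum /= big1// => i _.
case: opsP => _ _ o; rewrite -scalerAr functionalZ o ?mulr0//.
by rewrite neq_ltn ltn_ord orbT.
Qed.

Lemma ops_lead n p : (size p <= n.+1)%N ->
  E (P n * p) = p`_n * E (P n * P n).
Proof.
move=> pn; rewrite -{1}(subrK (p`_n *: P n) p) mulrDr functionalD.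
by rewrite ops_orth ?size_sub_ops// add0r -scalerAr linearZ.
Qed.

(** A monic p of the same degree is P n plus a polynomial orthogonal to P n, so the norms add. This
    bounds the norms of the P n by those of explicit competitors. *)
Lemma ops_norm_min n p : p \is monic -> size p = n.+1 ->
  E (P n * P n) <= E (p * p).
Proof.
move=> pm sp; have pn : p`_n = 1.
  by have := pm; rewrite monicE lead_coefE sp => /eqP.
have sr : (size (p - P n)%R <= n)%N.
  by have := @size_sub_ops n p; rewrite pn scale1r => -> //; rewrite sp.
have -> : p * p = P n * P n + 2 *: (P n * (p - P n)) + (p - P n) * (p - P n).
  by rewrite -mul_polyC; ring.
by rewrite !functionalD functionalZ (ops_orth sr) mulr0 addr0 lerDl posdef_ge0.
Qed.

End OPS.

Section OPSzeros.
Context {R : rcfType} (E : {scalar {poly R}}) (P : nat -> {poly R}).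
Context (posE : posdef E) (opsP : orthopoly E P).
Implicit Types p q : {poly R}.

(** A nonreal root a + ib would give P n = q D with D = (X - a)^2 + b^2. Then E (P n q) = E (((X -
    a) q)^2) + b^2 E (q^2) is positive, against the orthogonality of P n to q. *)
Lemma ops_splits n : exists s, P n = \prod_(y <- s) ('X - y%:P).
Proof.
pose pC := map_poly (real_complex R) (P n).
have [r Hr] := closed_field_poly_normal pC.
have pm : pC \is monic by rewrite map_monic (ops_monic opsP).
have rr z : z \in r -> complex.Im z = 0.
  move=> zr; have rz : root pC z.
    by rewrite Hr rootZ ?root_prod_XsubC// lead_coef_eq0 monic_neq0.
  case: z rz {zr} => a b rz /=; apply/eqP; apply: contraT => b0.
  pose D : {poly R} := ('X - a%:P) ^+ 2 + (b ^+ 2)%:P.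
  have sD : size D = 3%N.
    rewrite /D size_polyDl size_exp_XsubC// size_polyC.
    by case: (_ == _).
  have D0 : D != 0 by rewrite -size_poly_eq0 sD.
  pose q := P n %/ D; pose t := P n %% D.
  have st : (size t <= 2)%N by rewrite -ltnS -sD ltn_modp.
  have Dz : root (map_poly (real_complex R) D) (a +i* b)%C.
    rewrite /root /D rmorphD rmorphXn /= rmorphB /= map_polyX !map_polyC /=.
    rewrite !hornerE /=; apply/eqP.
    rewrite expr2; apply/eqP; rewrite eq_complex /=; apply/andP.
    by split; apply/eqP => /=; ring.
  (* The remainder is at most linear with real coefficients; its value at a + ib has imaginary part
     b times the slope, so both coefficients vanish. *)
  have t0 : t = 0.
    have : root (map_poly (real_complex R) t) (a +i* b)%C.
      move: rz; rewrite /pC (divp_eq (P n) D) rmorphD rmorphM /=.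
      by rewrite /root !hornerE (eqP Dz) mulr0 add0r.
    have -> : t = (t`_1) *: 'X + (t`_0)%:P.
      apply/polyP => i; rewrite coefD coefZ coefX coefC.
      case: i => [|[|i]] /=; rewrite ?mulr0 ?mulr1 ?add0r ?addr0//.
      by rewrite nth_default// (leq_trans st).
    rewrite rmorphD /= map_polyZ map_polyX map_polyC /root !hornerE /=.
    rewrite eq_complex /= !(mul0r, addr0, subr0, mulr0) => /andP[/eqP t0 /eqP].
    move=> /eqP; rewrite mulf_eq0 (negbTE b0) orbF => /eqP t1.
    by move: t0; rewrite t1 mul0r add0r => ->; rewrite scale0r addr0.
  have Pq : P n = q * D by rewrite {1}(divp_eq (P n) D) -/q -/t t0 addr0.
  have q0 : q != 0 by apply/eqP => q0; have := ops_neq0 opsP n; rewrite Pq q0 mul0r eqxx.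
  have sq : (size q <= n)%N.
    have := ops_size opsP n; rewrite Pq size_mul// sD !addnS addn0 /= => -[<-].
    exact: leqnSn.
  have := ops_orth opsP sq.
  have -> : P n * q = (q * ('X - a%:P)) * (q * ('X - a%:P)) + b ^+ 2 *: (q * q).
    by rewrite Pq /D -mul_polyC; ring.
  rewrite linearD functionalZ => /eqP; rewrite gt_eqF// ltr_wpDl//.
    exact: posdef_ge0.
  by rewrite mulr_gt0 ?posE// exprn_even_gt0.
exists (map (@complex.Re R) r).
apply: (map_poly_inj (real_complex R)); rewrite -/pC Hr (eqP pm) scale1r.
rewrite rmorph_prod big_map /=; apply: eq_big_seq => z zr.
rewrite rmorphB /= map_polyX map_polyC /=; congr ('X - _%:P).
by case: z zr => x y /rr /= ->.
Qed.

Section Cofactors.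
Context (n : nat) (s : seq R).
Context (Ps : P n = \prod_(y <- s) ('X - y%:P)).

(** At a zero y this is, up to its value at y, the Lagrange interpolation polynomial of the node
    y. *)
Definition cofactor_root y := P n %/ ('X - y%:P).
Local Notation cof := cofactor_root.

Lemma size_zeros : size s = n.
Proof.
by have := ops_size opsP n; rewrite Ps size_prod_XsubC => -[].
Qed.

Lemma root_ops y : root (P n) y = (y \in s).
Proof. by rewrite Ps root_prod_XsubC. Qed.

Lemma cofactorK y : y \in s -> cof y * ('X - y%:P) = P n.
Proof. by rewrite -root_ops -dvdp_XsubCl => /divpK. Qed.

Lemma size_cofactor y : size (cof y) = n.
Proof.
rewrite /cof size_divp ?polyXsubC_eq0// size_XsubC (ops_size opsP).
by rewrite subn1.
Qed.

Lemma cofactor_monic y : y \in s -> cof y \is monic.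
Proof.
move=> /cofactorK H; have := ops_monic opsP n; rewrite -H.
by rewrite monicMr// monicXsubC.
Qed.

(** Write f as q (X - y) plus the constant f(y): the cofactor times X - y restores P n, which is
    orthogonal to q because f has degree at most n. Against such f the cofactor acts as a multiple
    of evaluation at y. *)
Lemma cofactor_orth y (f : {poly R}) : y \in s -> (size f <= n.+1)%N ->
  E (cof y * f) = f.[y] * E (cof y).
Proof.
move=> ys sf; pose q := (f - f.[y]%:P) %/ ('X - y%:P).
have fE : f = q * ('X - y%:P) + f.[y]%:P.
  apply/eqP; rewrite -subr_eq divpK// dvdp_XsubCl /root !hornerE subrr//.
have sq : (size q <= n)%N.
  rewrite size_divp ?polyXsubC_eq0// size_XsubC subn1 -ltnS.
  rewrite (leq_ltn_trans (_ : _ <= (n.+1).-1)%N)// -!subn1 leq_sub2r//.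
  rewrite (leq_trans (size_polyD _ _))// geq_max sf size_polyN size_polyC.
  by case: eqP.
rewrite {1}fE mulrDr functionalD mulrA [cof y * q]mulrC -mulrA cofactorK//.
rewrite mulrC (ops_orth opsP)// add0r mulrC mul_polyC functionalZ.
by rewrite mulrC.
Qed.

Lemma cofactor_neq0 y : y \in s -> cof y != 0.
Proof. by move=> /cofactor_monic/monic_neq0. Qed.

Lemma cofactor_sqr y : y \in s -> E (cof y * cof y) = (cof y).[y] * E (cof y).
Proof. by move=> ys; rewrite cofactor_orth// size_cofactor. Qed.

Lemma cofactor_root_neq0 y : y \in s -> (cof y).[y] != 0.
Proof.
move=> ys; apply/eqP => c0; have := posE (cofactor_neq0 ys).
by rewrite cofactor_sqr// c0 mul0r ltxx.
Qed.

Lemma cofactor_norm y : y \in s ->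
  E (cof y) / (cof y).[y] = E (cof y * cof y) / (cof y).[y] ^+ 2.
Proof.
by move=> ys; rewrite cofactor_sqr//; field; exact: cofactor_root_neq0.
Qed.

(** At a repeated zero y the cofactor would still vanish at y, but E of its square equals cof(y) E
    (cof) and is positive. *)
Lemma zeros_uniq : uniq s.
Proof.
have cofE y : y \in s -> cof y = \prod_(z <- rem y s) ('X - z%:P).
  move=> ys; rewrite /cof Ps (perm_big _ (perm_to_rem ys)) /= big_cons mulrC.
  by rewrite mulpK// polyXsubC_eq0.
have : forall y, y \in s -> y \notin rem y s.
  move=> y ys; have := cofactor_root_neq0 ys.
  by rewrite cofE// -root_prod_XsubC.
elim: (s) => //= x t IH H; apply/andP.
have xt : x \notin t by have := H x; rewrite mem_head eqxx; exact.
split => //; apply: IH => y yt; have := H y; rewrite inE yt orbT => /(_ isT).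
case: eqVneq => [xy|xy]; first by rewrite xy yt in xt.
by rewrite inE negb_or => /andP[].
Qed.

Lemma cofactor_root0 y z : y \in s -> z \in s -> z != y -> (cof y).[z] = 0.
Proof.
move=> ys zs zy; have := root_ops z; rewrite zs -(cofactorK ys) rootM.
by rewrite root_XsubC (negbTE zy) orbF => /rootP.
Qed.

Lemma lagrange p : (size p <= n)%N ->
  p = \sum_(y <- s) (p.[y] / (cof y).[y]) *: cof y.
Proof.
move=> pn; set q := \sum_(_ <- s) _; apply/eqP; rewrite -subr_eq0.
apply: contraT => d0.
have sq : (size q <= n)%N.
  rewrite /q; elim/big_ind: _ => [|u v su sv|y _]; first by rewrite size_poly0.
    by rewrite (leq_trans (size_polyD _ _))// geq_max su sv.
  by rewrite (leq_trans (size_scale_leq _ _))// size_cofactor.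
have : (size s < size (p - q)%R)%N.
  apply: max_poly_roots => //; last exact: zeros_uniq.
  apply/allP => z zs; rewrite /root hornerD hornerN subr_eq0 horner_sum.
  rewrite (bigD1_seq z) ?zeros_uniq//= hornerZ divfK ?cofactor_root_neq0//.
  rewrite big_seq_cond big1 ?addr0// => y /andP[ys yz].
  have zy : z != y by rewrite eq_sym.
  by rewrite hornerZ (cofactor_root0 ys zs zy) mulr0.
rewrite size_zeros ltnNge (leq_trans (size_polyD _ _))//.
by rewrite geq_max pn size_polyN sq.
Qed.

(** The Christoffel number of y. Interpolation produces E (cof) / cof(y); this equal form, justified
    by [cofactor_norm], shows the sign. *)
Definition gauss_weight y := E (cof y * cof y) / (cof y).[y] ^+ 2.

Lemma gauss_weight_gt0 y : y \in s -> 0 < gauss_weight y.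
Proof.
move=> ys; rewrite divr_gt0 ?posE ?cofactor_neq0//.
by rewrite exprn_even_gt0// cofactor_root_neq0.
Qed.

(** Division by P n leaves a quotient of degree below n, whose product with P n is annihilated by E,
    and a remainder that is interpolated exactly at the zeros. *)
Lemma gauss_quadrature p : (size p <= n.*2)%N ->
  E p = \sum_(y <- s) p.[y] * gauss_weight y.
Proof.
move=> pn; have P0 := ops_neq0 opsP n.
have sr : (size (p %% P n)%R <= n)%N by rewrite -ltnS -(ops_size opsP n) ltn_modp.
have sq : (size (p %/ P n)%R <= n)%N.
  by rewrite size_divp// (ops_size opsP) /= leq_subLR addnn.
rewrite {1}(divp_eq p (P n)) functionalD mulrC (ops_orth opsP)// add0r.
rewrite {1}(lagrange sr) linear_sum /=; apply: eq_big_seq => y ys.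
rewrite functionalZ -mulrA [_^-1 * _]mulrC cofactor_norm//; congr (_ * _).
rewrite {2}(divp_eq p (P n)) hornerD hornerM.
have : root (P n) y by rewrite root_ops.
by move=> /rootP ->; rewrite mulr0 add0r.
Qed.

(** The polynomial f may be unbounded on the support; exactness of the quadrature means that only
    its values at the nodes count. The later bounds on integrals involving rho and x^2 come from
    here. *)
Lemma gauss_le (f p : {poly R}) F : (size (f * p)%R <= n.*2)%N ->
  (size p <= n.*2)%N -> (forall y, y \in s -> f.[y] <= F) ->
  (forall y, y \in s -> 0 <= p.[y]) -> E (f * p) <= F * E p.
Proof.
move=> sfp sp fF p0; rewrite !gauss_quadrature// mulr_sumr big_seq.
rewrite [leRHS]big_seq; apply: ler_sum => y ys.
rewrite hornerM [leRHS]mulrA ler_wpM2r ?(ltW (gauss_weight_gt0 ys))//.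
by rewrite ler_wpM2r ?p0 ?fF.
Qed.

End Cofactors.

(** Partial fractions: P k / P k.+1 is the Stieltjes transform of a probability measure on the
    zeros. The weight P k (y) / cof(y) is positive because multiplying numerator and denominator by
    E (cof) gives E (P k P k) / E (cof cof); comparing leading coefficients gives total mass 1. *)
Lemma ops_ratio k s : P k.+1 = \prod_(y <- s) ('X - y%:P) ->
  exists w : R -> R, [/\ forall y, y \in s -> 0 < w y, \sum_(y <- s) w y = 1 &
    P k = \sum_(y <- s) w y *: cofactor_root k.+1 y].
Proof.
move=> Ps; pose cof := cofactor_root k.+1.
exists (fun y => (P k).[y] / (cof y).[y]).
have Pk : P k = \sum_(y <- s) ((P k).[y] / (cof y).[y]) *: cof y.
  by apply: lagrange => //; rewrite (ops_size opsP).
have ck y : y \in s -> (cof y)`_k = 1.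
  move=> ys; have := cofactor_monic Ps ys.
  by rewrite monicE lead_coefE size_cofactor /= => /eqP.
split => //.
- move=> y ys.
  have H : 0 < (P k).[y] * E (cof y).
    rewrite -(cofactor_orth Ps)// ?(ops_size opsP)//.
    rewrite mulrC (ops_lead opsP) ?size_cofactor//.
    by rewrite ck// mul1r (ops_norm_gt0 posE opsP).
  have G : 0 < (cof y).[y] * E (cof y).
    by rewrite -(cofactor_sqr Ps)// posE// (cofactor_neq0 Ps).
  have e0 : E (cof y) != 0 by apply/eqP => e0; rewrite e0 mulr0 ltxx in G.
  have c0 := cofactor_root_neq0 Ps ys.
  have -> : (P k).[y] / (cof y).[y] =
      ((P k).[y] * E (cof y)) / ((cof y).[y] * E (cof y)).
    by field; rewrite e0 c0.
  exact: divr_gt0.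
- have := ops_coefn opsP k; rewrite {1}Pk coef_sum => <-.
  by apply: eq_big_seq => y ys; rewrite coefZ ck// mulr1.
Qed.

End OPSzeros.

(** * Orthogonal polynomials off a half plane *)

Section Modulus.
Context {R : rcfType}.
Implicit Types (u z : R[i]) (a : R).
Import ComplexField.Normc.

Lemma normc_sqr z : normc z ^+ 2 = complex.Re z ^+ 2 + complex.Im z ^+ 2.
Proof. by case: z => a b /=; rewrite sqr_sqrtr ?addr_ge0 ?sqr_ge0. Qed.

Lemma normc_ge0 z : 0 <= normc z.
Proof. by case: z => a b; exact: sqrtr_ge0. Qed.

Lemma normcD z u : normc (z + u) <= normc z + normc u.
Proof. exact: le_normcD. Qed.

Lemma normcN z : normc (- z) = normc z.
Proof. by case: z => a b /=; rewrite !sqrrN. Qed.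

Lemma normcB z u : normc (z - u) <= normc z + normc u.
Proof. by rewrite (le_trans (normcD _ _))// normcN. Qed.

Lemma normc_distC z u : normc (z - u) = normc (u - z).
Proof. by rewrite -normcN opprB. Qed.

Lemma normc_real a : normc a%:C%C = `|a|.
Proof. by rewrite /= expr0n addr0 sqrtr_sqr. Qed.

Lemma normc_eq0 z : (normc z == 0) = (z == 0).
Proof. by apply/eqP/eqP => [/eq0_normc//|->]; exact: normc0. Qed.

Lemma normc_gt0 z : (0 < normc z) = (z != 0).
Proof. by rewrite lt_def normc_ge0 andbT normc_eq0. Qed.

Lemma normcX z n : normc (z ^+ n) = normc z ^+ n.
Proof. by elim: n => [|n IH]; rewrite ?normc1// !exprS normcM IH. Qed.

Lemma normc_sum I (s : seq I) (F : I -> R[i]) :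
  normc (\sum_(i <- s) F i) <= \sum_(i <- s) normc (F i).
Proof.
elim: s => [|i s IH]; first by rewrite !big_nil normc0.
by rewrite !big_cons (le_trans (normcD _ _))// lerD2l.
Qed.

Lemma normc_sum_ord n (F : 'I_n -> R[i]) :
  normc (\sum_(i < n) F i) <= \sum_(i < n) normc (F i).
Proof. exact: normc_sum. Qed.

Lemma normc_ge_subl z u : normc z - normc u <= normc (z - u).
Proof. by rewrite lerBlDr -{1}(subrK u z) normcD. Qed.

(** The real inner product of the plane. Lower bounds for sums are obtained by projecting on one
    direction in which no terms cancel. *)
Definition dotc u z := complex.Re u * complex.Re z + complex.Im u * complex.Im z.

Lemma dotcD u z1 z2 : dotc u (z1 + z2) = dotc u z1 + dotc u z2.
Proof. by case: z1 => ? ?; case: z2 => ? ?; rewrite /dotc /=; ring. Qed.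

Lemma dotcZ u a z : dotc u (a%:C%C * z) = a * dotc u z.
Proof. by case: z => ? ?; rewrite /dotc /=; ring. Qed.

Lemma dotc_sum I (s : seq I) u (F : I -> R[i]) :
  dotc u (\sum_(i <- s) F i) = \sum_(i <- s) dotc u (F i).
Proof.
elim: s => [|i s IH]; first by rewrite !big_nil /dotc /= !mulr0 addr0.
by rewrite !big_cons dotcD IH.
Qed.

Lemma dotc_le u z : normc u = 1 -> dotc u z <= normc z.
Proof.
move=> u1; have H := normc_sqr u; rewrite u1 in H.
rewrite (le_trans (ler_norm _))// -ler_sqr ?nnegrE ?normc_ge0//.
rewrite real_normK ?num_real// normc_sqr /dotc.
have := sqr_ge0 (complex.Re u * complex.Im z - complex.Im u * complex.Re z).
set a := complex.Re u in H *; set b := complex.Im u in H *.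
set c := complex.Re z; set d := complex.Im z => G.
have -> : c ^+ 2 + d ^+ 2 = 1 ^+ 2 * (c ^+ 2 + d ^+ 2) by ring.
by rewrite H; nra.
Qed.

Lemma normc_conj u : normc u^*%C = normc u.
Proof. by case: u => a b /=; rewrite sqrrN. Qed.

(** The inverse of z points along the conjugate of z, so inversion carries a half plane in direction
    u to the one in the conjugate direction. *)
Lemma dotcV u z : dotc u^*%C z^-1 = dotc u z / normc z ^+ 2.
Proof.
rewrite normc_sqr; case: u => a b; case: z => c d.
have -> : (c +i* d)%C^-1 = ((c / (c ^+ 2 + d ^+ 2)) -i* (d / (c ^+ 2 + d ^+ 2)))%C by [].
by rewrite /dotc /=; ring.
Qed.

End Modulus.

Section Separation.
Context {R : rcfType}.
Implicit Types (x : R[i]) (S : R -> Prop) (kap K : R).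
Import ComplexField.Normc.

(* [S] lies, as seen from [x], in a half plane whose distance to [x] is
   comparable with the modulus of [x]. *)
Definition separated kap K x S := exists u, normc u = 1 /\
  forall t, S t -> kap * normc x <= dotc u (x - t%:C%C) /\
                   normc (x - t%:C%C) <= K * normc x.

Context (kap K : R) (x : R[i]) (S : R -> Prop).
Context (kap0 : 0 < kap) (x0 : x != 0).
Context (sepx : separated kap K x S).

Let nx : 0 < normc x. Proof. by rewrite normc_gt0. Qed.

Lemma separated_dist t : S t -> kap * normc x <= normc (x - t%:C%C).
Proof.
by case: sepx => u [u1 H] /H[+ _] => /le_trans; apply; exact: dotc_le.
Qed.

Lemma separated_neq t : S t -> x - t%:C%C != 0.
Proof.
move=> /separated_dist H; rewrite -normc_gt0 (lt_le_trans _ H)//.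
exact: mulr_gt0.
Qed.

Context (s : seq R) (w : R -> R).
Context (sS : forall y, y \in s -> S y).
Context (w0 : forall y, y \in s -> 0 < w y) (w1 : \sum_(y <- s) w y = 1).

Lemma separated_sum_inv_le n :
  normc (\sum_(y <- s) (w y)%:C%C / (x - y%:C%C) ^+ n) <=
  ((kap * normc x) ^+ n)^-1.
Proof.
rewrite (le_trans (normc_sum _ _))// -[leRHS]mul1r -w1 mulr_suml.
rewrite big_seq [leRHS]big_seq; apply: ler_sum => y ys.
rewrite normcM normcV normcX normc_real gtr0_norm ?w0//.
rewrite ler_wpM2l ?(ltW (w0 ys))// lef_pV2 ?posrE ?exprn_gt0 ?mulr_gt0//.
  apply: lerXn2r; rewrite ?nnegrE ?normc_ge0 ?mulr_ge0 ?normc_ge0 ?(ltW kap0)//.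
  exact/separated_dist/sS.
by rewrite normc_gt0; exact/separated_neq/sS.
Qed.

(** Each x - y has component at least kap |x| along u and modulus at most K |x|, so its inverse has
    component at least kap / (K^2 |x|) along the conjugate of u; a convex combination keeps this
    bound. *)
Lemma separated_sum_inv_ge : 0 < K ->
  kap / (K ^+ 2 * normc x) <= normc (\sum_(y <- s) (w y)%:C%C / (x - y%:C%C)).
Proof.
move=> K0; case: (sepx) => u [u1 H].
apply: (le_trans _ (@dotc_le _ u^*%C _ _)); last by rewrite normc_conj.
rewrite dotc_sum -[leLHS]mul1r -w1 mulr_suml.
rewrite big_seq [leRHS]big_seq; apply: ler_sum => y ys.
have [H1 H2] := H _ (sS ys).
rewrite dotcZ dotcV ler_wpM2l ?(ltW (w0 ys))//.
have y0 : 0 < normc (x - y%:C%C) by rewrite normc_gt0; exact/separated_neq/sS.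
rewrite ler_pdivlMr ?exprn_gt0//.
apply: le_trans H1; rewrite mulrAC ler_pdivrMr ?mulr_gt0 ?exprn_gt0//.
rewrite -[leRHS]mulrA ler_wpM2l ?(ltW kap0)//.
apply: le_trans (_ : (K * normc x) ^+ 2 <= _); last by rewrite le_eqVlt; apply/orP; left; apply/eqP; ring.
by apply: lerXn2r => //; rewrite nnegrE ?normc_ge0// mulr_ge0 ?normc_ge0 ?(ltW K0).
Qed.

End Separation.

Section OPSratio.
Context {R : rcfType} (E : {scalar {poly R}}) (P : nat -> {poly R}).
Context (posE : posdef E) (opsP : orthopoly E P).
Import ComplexField.Normc.
Local Notation toC := (map_poly (real_complex R)).

Context (kap K : R) (x : R[i]) (k : nat).
Context (kap0 : 0 < kap) (K0 : 0 < K) (x0 : x != 0).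
Context (sepx : separated kap K x (root (P k.+1))).

Lemma separated_neq0 : (toC (P k.+1)).[x] != 0.
Proof.
have [s Ps] := ops_splits posE opsP k.+1.
rewrite Ps map_prod_XsubC horner_prod prodf_seq_neq0.
apply/allP => y ys; rewrite hornerXsubC /=.
by apply: (separated_neq kap0 x0 sepx); rewrite Ps root_prod_XsubC.
Qed.

(** The partial fractions of [ops_ratio] at a complex point. The last equation is the derivative of
    P k / P k.+1 times the square of P k.+1: it writes the Wronskian as a sum with the same positive
    weights. *)
Lemma ops_ratioC : exists s w,
  [/\ forall y, y \in s -> root (P k.+1) y, forall y, y \in s -> 0 < w y,
     \sum_(y <- s) w y = 1,
     (toC (P k)).[x] =
       (toC (P k.+1)).[x] * \sum_(y <- s) (w y)%:C%C / (x - y%:C%C) &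
     (toC (P k)^`()).[x] * (toC (P k.+1)).[x] -
     (toC (P k)).[x] * (toC (P k.+1)^`()).[x] =
     - (toC (P k.+1)).[x] ^+ 2 * \sum_(y <- s) (w y)%:C%C / (x - y%:C%C) ^+ 2].
Proof.
have [s Ps] := ops_splits posE opsP k.+1.
have [w [w0 w1 Pk]] := ops_ratio posE opsP Ps.
have sr y : y \in s -> root (P k.+1) y by rewrite Ps root_prod_XsubC.
have cK y : y \in s -> (toC (cofactor_root P k.+1 y)).[x] =
    (toC (P k.+1)).[x] / (x - y%:C%C).
  move=> ys; rewrite -(cofactorK Ps ys) rmorphM /= map_polyXsubC.
  by rewrite hornerM hornerXsubC mulfK// (separated_neq kap0 x0 sepx)// sr.
(* Differentiate cof (X - y) = P k.+1 and solve for the derivative of the cofactor at x. *)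
have dcK y : y \in s -> (toC (cofactor_root P k.+1 y)^`()).[x] =
    ((toC (P k.+1)^`()).[x] - (toC (cofactor_root P k.+1 y)).[x]) / (x - y%:C%C).
  move=> ys; rewrite -{1}(cofactorK Ps ys) derivM derivXsubC mulr1.
  rewrite rmorphD rmorphM /= map_polyXsubC.
  rewrite hornerD hornerM hornerXsubC addrK mulfK//.
  by rewrite (separated_neq kap0 x0 sepx)// sr.
exists s, w; split => //.
  rewrite Pk rmorph_sum /= horner_sum mulr_sumr; apply: eq_big_seq => y ys.
  by rewrite map_polyZ hornerZ cK//= mulrCA.
rewrite {1 2}Pk raddf_sum !rmorph_sum /= !horner_sum !mulr_suml mulr_sumr -sumrB.
apply: eq_big_seq => y ys.
rewrite derivZ !map_polyZ !hornerZ dcK//= cK//.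
by field; rewrite (separated_neq kap0 x0 sepx)// sr.
Qed.

Lemma ops_ratio_le :
  normc (toC (P k)).[x] <= normc (toC (P k.+1)).[x] / (kap * normc x).
Proof.
have [s [w [sr w0 w1 -> _]]] := ops_ratioC.
rewrite normcM ler_wpM2l ?normc_ge0//.
exact: (@separated_sum_inv_le _ kap K x _ kap0 x0 sepx s w sr w0 w1 1).
Qed.

Lemma ops_ratio_ge :
  normc (toC (P k.+1)).[x] <= K ^+ 2 / kap * normc x * normc (toC (P k)).[x].
Proof.
have [s [w [sr w0 w1 -> _]]] := ops_ratioC.
rewrite normcM [_ * (_ * _)]mulrCA ler_peMr ?normc_ge0//.
rewrite -ler_pdivrMl; last by rewrite mulr_gt0 ?normc_gt0// divr_gt0 ?exprn_gt0.
rewrite mulr1; apply: le_trans (separated_sum_inv_ge kap0 x0 sepx sr w0 w1 K0).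
rewrite le_eqVlt; apply/orP; left; apply/eqP; field.
by rewrite normc_eq0 x0 !gt_eqF.
Qed.

Lemma ops_wronskian_le :
  normc ((toC (P k)^`()).[x] * (toC (P k.+1)).[x] -
         (toC (P k)).[x] * (toC (P k.+1)^`()).[x]) <=
  normc (toC (P k.+1)).[x] ^+ 2 / (kap * normc x) ^+ 2.
Proof.
have [s [w [sr w0 w1 _ ->]]] := ops_ratioC.
rewrite mulNr normcN normcM normcX ler_wpM2l ?exprn_ge0 ?normc_ge0//.
exact: (@separated_sum_inv_le _ kap K x _ kap0 x0 sepx s w sr w0 w1 2).
Qed.

End OPSratio.

(** * Connection coefficients *)

Section Fourier.
Context {R : realFieldType} (E : {scalar {poly R}}) (P : nat -> {poly R}).
Context (posE : posdef E) (opsP : orthopoly E P).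
Implicit Types p q : {poly R}.

Lemma ops_fourier n p : (size p <= n)%N ->
  p = \sum_(i < n) (E (P i * p) / E (P i * P i)) *: P i.
Proof.
move=> /(ops_expand opsP)[a Hp]; rewrite {1}Hp; apply: eq_bigr => i _.
congr (_ *: _); rewrite Hp mulr_sumr linear_sum /= (bigD1 i)//= big1 ?addr0.
  by rewrite -scalerAr functionalZ mulfK// gt_eqF// (ops_norm_gt0 posE opsP).
move=> j ji; rewrite -scalerAr functionalZ.
by case: opsP => _ _ -> //; rewrite ?mulr0// eq_sym.
Qed.

End Fourier.

Lemma big_ord_tail (V : nmodType) (F : nat -> V) n m : (m <= n)%N ->
  \sum_(j < n.+1) F j = \sum_(j < n - m) F j + \sum_(k < m.+1) F (n - k)%N.
Proof.
elim: m => [|m IH] mn; first by rewrite subn0 big_ord_recr big_ord1 subn0.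
rewrite IH ?(ltnW mn)// [in RHS]big_ord_recr /=.
have -> : (n - m = (n - m.+1).+1)%N by rewrite subnS prednK// subn_gt0.
by rewrite big_ord_recr /= -!addrA; congr (_ + _); rewrite addrC.
Qed.

Section Connection.
Context {R : rcfType} (E M : {scalar {poly R}}) (L P : nat -> {poly R}).
Context (posE : posdef E) (opsL : orthopoly E L).
Context (posM : posdef M) (opsP : orthopoly M P).
Context (rho : {poly R}) (m : nat) (srho : size rho = m.+1).
Context (EM : forall p, E p = M (rho * p)).

Definition conn i j := E (P i * L j) / E (L j * L j).
(** The coefficient of P (n + j) in rho L n: its numerator M (P (n + j) rho L n) is rewritten as an
    E-product. *)
Definition dconn n j := E (P (n + j) * L n) / M (P (n + j) * P (n + j)).

Let rho0 : rho != 0. Proof. by rewrite -size_poly_eq0 srho. Qed.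
Let l0 : lead_coef rho != 0. Proof. by rewrite lead_coef_eq0. Qed.

(** For j < n - m the product rho L j has degree below n, so E (L j P n) = M (rho L j P n) vanishes
    and only the last m + 1 Fourier coefficients remain. *)
Lemma conn_expand n : (m <= n)%N ->
  P n = \sum_(k < m.+1) conn n (n - k) *: L (n - k).
Proof.
move=> mn.
have H := ops_fourier posE opsL (eq_leq (ops_size opsP n)).
rewrite {1}H (big_ord_tail (fun j => (E (L j * P n) / E (L j * L j)) *: L j) mn).
rewrite big1 ?add0r => [|j _]; last first.
  rewrite EM mulrA [_ * P n]mulrC (ops_orth opsP) ?mul0r ?scale0r//.
  rewrite (leq_trans (size_polyMleq _ _))// srho (ops_size opsL) addSn /= addnS.
  by have := ltn_ord j; rewrite ltn_subRL.
by apply: eq_bigr => k _; rewrite /conn [P n * _]mulrC.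
Qed.

(** Dually, for j < n the numerator M (P j rho L n) = E (L n P j) vanishes by the orthogonality of L
    n. *)
Lemma dconn_expand n : rho * L n = \sum_(j < m.+1) dconn n j *: P (n + j).
Proof.
have sz : (size (rho * L n)%R <= n + m.+1)%N.
  by rewrite (leq_trans (size_polyMleq _ _))// srho (ops_size opsL) addnS addnC.
rewrite {1}(ops_fourier posM opsP sz) big_split_ord /= big1 ?add0r => [|j _].
  by apply: eq_bigr => j _; rewrite /dconn EM; congr (_ / _ *: _); congr (M _); ring.
rewrite (_ : P j * (rho * L n) = rho * (L n * P j)); last by ring.
by rewrite -EM (ops_orth opsL) ?mul0r ?scale0r// (ops_size opsP).
Qed.

Definition horner_bound (p : {poly R}) B := \sum_(i < size p) `|p`_i| * B ^+ i.

Lemma horner_bound_ge0 p B : 0 <= B -> 0 <= horner_bound p B.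
Proof. by move=> B0; apply: sumr_ge0 => i _; rewrite mulr_ge0 ?exprn_ge0. Qed.

Lemma horner_boundP (p : {poly R}) B c y : 1 <= c -> 0 <= B -> `|y| <= B * c ->
  `|p.[y]| <= horner_bound p B * c ^+ (size p).-1.
Proof.
move=> c1 B0 yB; have c0 : 0 <= c by rewrite (le_trans _ c1).
rewrite horner_coef (le_trans (ler_norm_sum _ _ _))// mulr_suml.
apply: ler_sum => i _; rewrite normrM normrX -mulrA ler_wpM2l//.
apply: (@le_trans _ _ ((B * c) ^+ i)).
  by apply: lerXn2r => //; rewrite nnegrE ?mulr_ge0.
rewrite exprMn ler_wpM2l ?exprn_ge0//.
by apply: ler_weXn2l => //; have := ltn_ord i; case: (size p) i.
Qed.

Context (B c kap : R) (n N0 : nat).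
Context (B0 : 0 <= B) (c1 : 1 <= c) (kap0 : 0 < kap) (kap1 : kap <= 1).
Context (mn : (m <= n)%N) (nN0 : (n + m + m < N0)%N).
Context (rootL : forall N y, (N <= N0)%N -> root (L N) y -> `|y| <= B * c).
Context (normL : forall j, (n - m <= j < n + m)%N ->
  kap * c ^+ 2 * E (L j * L j) <= E (L j.+1 * L j.+1)).

Let Cr := horner_bound rho B.
Let c0 : 0 < c. Proof. by rewrite (lt_le_trans _ c1). Qed.
Let nL j : 0 < E (L j * L j). Proof. exact: ops_norm_gt0 posE opsL j. Qed.
Let nP j : 0 < M (P j * P j). Proof. exact: ops_norm_gt0 posM opsP j. Qed.
Let Cr0 : 0 <= Cr. Proof. exact: horner_bound_ge0. Qed.

(** The integrand has degree 2 j + m, so the rule with j + m + 1 nodes is exact, and at these nodes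
    rho is at most Cr c^m. This number of nodes is why zero bounds are required up to an index N0
    above n + 2 m. *)
Lemma rho_norm_le j : (j <= n + m)%N ->
  E (rho * (L j * L j)) <= Cr * c ^+ m * E (L j * L j).
Proof.
move=> jn; have [s Ls] := ops_splits posE opsL (j + m).+1.
have sL2 : (size (L j * L j)%R <= j + j.+1)%N.
  by rewrite (leq_trans (size_polyMleq _ _))// (ops_size opsL).
apply: (gauss_le posE opsL Ls).
- rewrite (leq_trans (size_polyMleq _ _))// srho addSn /=.
  rewrite (leq_trans (leq_add (leqnn _) sL2))//.
  lia.
- by rewrite (leq_trans sL2)//; lia.
- move=> y ys; rewrite (le_trans (ler_norm _))//.
  have := @horner_boundP rho B c y c1 B0; rewrite srho /=; apply.
  apply: (rootL (N := (j + m).+1)); last by rewrite Ls root_prod_XsubC.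
  by rewrite (leq_ltn_trans _ nN0)// leq_add2r.
- by move=> y _; rewrite hornerM -expr2 sqr_ge0.
Qed.

(** rho L (i - m) divided by the leading coefficient of rho is a monic competitor of degree i, and M
    of its square is E (rho L^2) up to that constant. *)
Lemma normP_le i : (m <= i)%N -> (i <= n + m)%N ->
  M (P i * P i) <= Cr * c ^+ m * E (L (i - m)%N * L (i - m)%N) / lead_coef rho ^+ 2.
Proof.
move=> mi iN; pose p := ((lead_coef rho)^-1 *: rho) * L (i - m)%N.
have mp : p \is monic.
  rewrite monicE lead_coefM lead_coefZ mulVf// mul1r.
  exact: ops_monic opsL _.
have sp : size p = i.+1.
  rewrite /p -scalerAl size_scale ?invr_neq0// size_Mmonic ?(ops_monic opsL)//.
  by rewrite srho (ops_size opsL) addSn /= addnS subnKC.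
apply: (le_trans (ops_norm_min posM opsP mp sp)).
rewrite (_ : p * p = (lead_coef rho)^-1 ^+ 2 *:
   (rho * (rho * (L (i - m)%N * L (i - m)%N)))); last first.
  by rewrite /p -!mul_polyC; rewrite rmorphXn /=; ring.
rewrite functionalZ -EM exprVn mulrC ler_wpM2r ?invr_ge0 ?sqr_ge0//.
by apply: rho_norm_le; rewrite (leq_trans (leq_subr _ _)).
Qed.

Lemma normL_iter i k : (n - m <= i)%N -> (i + k <= n + m)%N ->
  (kap * c ^+ 2) ^+ k * E (L i * L i) <= E (L (i + k)%N * L (i + k)%N).
Proof.
move=> ni; elim: k => [|k IH] ik; first by rewrite expr0 mul1r addn0.
rewrite addnS; apply: (le_trans _ (normL _)); last first.
  by rewrite -addnS ik (leq_trans ni)// leq_addr.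
rewrite exprS -mulrA ler_wpM2l ?mulr_ge0 ?exprn_ge0 ?(ltW kap0) ?(ltW c0)//.
by apply: IH; rewrite (leq_trans _ ik)// leq_add2l.
Qed.

Let powk k : (k <= m)%N -> kap ^+ m <= kap ^+ k.
Proof. by move=> km; apply: ler_wiXn2l => //; exact: ltW. Qed.

Definition conn_bound := Cr / `|lead_coef rho| / kap ^+ m.

Lemma conn_bound_ge0 : 0 <= conn_bound.
Proof. by rewrite !mulr_ge0 ?invr_ge0 ?exprn_ge0// ltW. Qed.

(** Cauchy-Schwarz for M applied to P i and rho L (i - k) bounds the square of E (P i L (i - k)) by
    M (P i P i) E (rho L^2), hence by a multiple of c^(2 m) times the norms of L (i - m) and L (i -
    k). The growth of the norms turns the first norm into c^(-2 (m - k)) times the second, which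
    leaves c^(2 k). The range of i up to n + m serves [dconn_le]. *)
Lemma conn_le i k : (n <= i <= n + m)%N -> (k <= m)%N ->
  `|conn i (i - k)| <= conn_bound * c ^+ k.
Proof.
move=> /andP[ni iN] km; have mi := leq_trans mn ni.
have CS := posdef_CauchySchwarz posM (P i) (rho * L (i - k)%N).
have := normP_le mi iN; have := @rho_norm_le (i - k)%N.
rewrite (leq_trans (leq_subr _ _))// => /(_ isT) H1 H2.
have nk : (i - k = (i - m) + (m - k))%N by rewrite addnBA// subnK.
have H3 : (kap * c ^+ 2) ^+ (m - k) * E (L (i - m)%N * L (i - m)%N) <=
          E (L (i - k)%N * L (i - k)%N).
  by rewrite nk; apply: normL_iter; rewrite ?leq_sub2r// -nk (leq_trans (leq_subr _ _)).
rewrite (_ : P i * (rho * _) = rho * (P i * L (i - k)%N)) in CS; last by ring.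
rewrite (_ : rho * L (i - k)%N * (rho * L (i - k)%N) =
   rho * (rho * (L (i - k)%N * L (i - k)%N))) in CS; last by ring.
rewrite -!EM in CS.
set X := E (P i * L (i - k)%N) in CS; set Nk := E (L (i - k)%N * _) in H1 H3.
set Nm := E (L (i - m)%N * _) in H2 H3.
have Nk0 : 0 < Nk by exact: nL. have Nm0 : 0 < Nm by exact: nL.
set l := lead_coef rho in H2 *.
have l20 : 0 < l ^+ 2 by rewrite exprn_even_gt0.
have X2 : X ^+ 2 <= (Cr * c ^+ m) ^+ 2 / l ^+ 2 * (Nm * Nk).
  apply: (le_trans CS); apply: (le_trans (ler_pM _ _ H2 H1)).
  - exact/ltW/nP.
  - rewrite EM (_ : rho * (rho * _) = (rho * L (i - k)%N) * (rho * L (i - k)%N)).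
      exact: posdef_ge0.
    by ring.
  - by rewrite le_eqVlt; apply/orP; left; apply/eqP; field.
have T : Nm <= Nk / (kap ^+ m * c ^+ (m - k) ^+ 2).
  rewrite ler_pdivlMr ?mulr_gt0 ?exprn_gt0// mulrC (le_trans _ H3)//.
  rewrite ler_wpM2r ?(ltW Nm0)// exprMn -exprM mulnC exprM -exprM mulnC exprM.
  by rewrite ler_wpM2r ?exprn_ge0 ?(ltW c0)// powk// leq_subr.
have cmk : c ^+ m = c ^+ (m - k) * c ^+ k by rewrite -exprD subnK.
have km0 : 0 < kap ^+ m by rewrite exprn_gt0.
have km1 : kap ^+ m <= 1 by rewrite exprn_ile1// ltW.
have F : X ^+ 2 <= (conn_bound * c ^+ k * Nk) ^+ 2.
  apply: (le_trans X2).
  apply: (@le_trans _ _ ((Cr * c ^+ m) ^+ 2 / l ^+ 2 *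
     (Nk / (kap ^+ m * c ^+ (m - k) ^+ 2) * Nk))).
    by rewrite ler_wpM2l ?divr_ge0 ?sqr_ge0// ler_wpM2r// ltW.
  apply: (@le_trans _ _ ((Cr * c ^+ k) ^+ 2 / l ^+ 2 * Nk ^+ 2 / kap ^+ m)).
    rewrite le_eqVlt; apply/orP; left; apply/eqP; rewrite cmk; field.
    by rewrite l0 !expf_neq0 ?gt_eqF.
  (* The estimate carries a single factor kap^-m; weakening it to kap^(-2 m) makes the bound a
     perfect square. *)
  have -> : (conn_bound * c ^+ k * Nk) ^+ 2 =
      (Cr * c ^+ k) ^+ 2 / l ^+ 2 * Nk ^+ 2 / kap ^+ m / kap ^+ m.
    rewrite /conn_bound -[l ^+ 2](real_normK (num_real l)) -/l; field.
    by rewrite normr_eq0 l0 expf_neq0// gt_eqF.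
  rewrite [leRHS]mulrC ler_peMl ?invf_ge1//.
  by rewrite divr_ge0 ?(ltW km0)// mulr_ge0 ?sqr_ge0// divr_ge0 ?sqr_ge0.
rewrite /conn -/X -/Nk normrM normfV (gtr0_norm Nk0) ler_pdivrMr//.
rewrite -ler_sqr ?nnegrE ?mulr_ge0 ?conn_bound_ge0 ?exprn_ge0 ?(ltW c0) ?(ltW Nk0)//.
  by rewrite real_normK ?num_real.
by rewrite invr_ge0 exprn_ge0// ltW.
Qed.

(** The Cauchy-Schwarz inequality of [conn_le] with k = 0: as P i is monic, E (L i P i) is the norm
    of L i, which then cancels once. *)
Lemma normP_ge i : (i <= n + m)%N ->
  E (L i * L i) <= M (P i * P i) * (Cr * c ^+ m).
Proof.
move=> iN; have CS := posdef_CauchySchwarz posM (P i) (rho * L i).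
rewrite (_ : P i * (rho * _) = rho * (L i * P i)) in CS; last by ring.
rewrite (_ : rho * L i * (rho * L i) = rho * (rho * (L i * L i))) in CS; last by ring.
rewrite -!EM (ops_lead opsL) ?(ops_size opsP)// (ops_coefn opsP) mul1r in CS.
rewrite -(ler_pM2r (nL i)) -expr2 (le_trans CS)// -mulrA ler_wpM2l ?(ltW (nP i))//.
exact: rho_norm_le.
Qed.

Definition dconn_bound := conn_bound * Cr / kap ^+ m.

Lemma dconn_bound_ge0 : 0 <= dconn_bound.
Proof. by rewrite !mulr_ge0 ?conn_bound_ge0 ?invr_ge0 ?exprn_ge0// ltW. Qed.

(** The coefficient is [conn (n + j) n] times the norm of L n over that of P (n + j). By [normP_ge]
    and the growth of the norms from n to n + j this ratio is O(c^(m - 2 j)), against c^j from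
    [conn_le]. *)
Lemma dconn_le j : (j <= m)%N -> `|dconn n j| <= dconn_bound * c ^+ (m - j).
Proof.
move=> jm; have nj : (n + j <= n + m)%N by rewrite leq_add2l.
have := @conn_le (n + j) j; rewrite nj leq_addr addnK => /(_ isT jm) Hb.
have HP := normP_ge nj.
have HN := @normL_iter n j (leq_subr _ _) nj.
rewrite /conn normrM normfV (gtr0_norm (nL n)) ler_pdivrMr// in Hb.
rewrite /dconn normrM normfV (gtr0_norm (nP _)) ler_pdivrMr//.
apply: (le_trans Hb); rewrite /dconn_bound.
set Mj := M _ in HP *; set Nj := E _ in HP HN; set N := E _ in HN *.
have kj := powk jm; have kj0 : 0 < kap ^+ m by rewrite exprn_gt0.
have H : kap ^+ m * c ^+ j ^+ 2 * N <= Mj * (Cr * c ^+ m).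
  apply: le_trans HP; apply: le_trans HN; rewrite ler_wpM2r ?(ltW (nL n))//.
  rewrite exprMn -[in leRHS]exprM mulnC exprM ler_wpM2r ?exprn_ge0 ?(ltW c0)//.
have cmj : c ^+ m = c ^+ (m - j) * c ^+ j by rewrite -exprD subnK.
have cj0 : 0 < c ^+ j by rewrite exprn_gt0.
rewrite -(ler_pM2l (mulr_gt0 kj0 cj0)).
have -> : kap ^+ m * c ^+ j * (conn_bound * c ^+ j * N) =
  conn_bound * (kap ^+ m * c ^+ j ^+ 2 * N) by ring.
have -> : kap ^+ m * c ^+ j * (conn_bound * Cr / kap ^+ m * c ^+ (m - j) * Mj) =
  conn_bound * (Mj * (Cr * c ^+ m)).
  by rewrite cmj; field; rewrite gt_eqF.
by rewrite ler_wpM2l ?conn_bound_ge0.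
Qed.

End Connection.

(** * The perturbed polynomials *)

Section Perturbation.
Context {R : rcfType} (E M : {scalar {poly R}}) (L P : nat -> {poly R}).
Context (posE : posdef E) (opsL : orthopoly E L).
Context (posM : posdef M) (opsP : orthopoly M P).
Context (rho : {poly R}) (m : nat) (srho : size rho = m.+1).
Context (EM : forall p, E p = M (rho * p)).
Import ComplexField.Normc.
Local Notation toC := (map_poly (real_complex R)).

Let b := conn E L P.
Let d := dconn E M L P.

(** Qhat with the integrals replaced by E and with lambda_n / lambda_(n - k) simplified to n / (n -
    k). *)
Definition Qpert n : {poly R} :=
  \sum_(k < m.+1) (n%:R / (n - k)%:R * b n (n - k)) *: L (n - k).

Context (n N0 : nat) (mn : (m < n)%N) (nN0 : (n + m + m < N0)%N).
Let le_N0 k : (k <= n + m)%N -> (k <= N0)%N.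
Proof. by move=> kn; rewrite (leq_trans kn)// (leq_trans (leq_addr m _))// ltnW. Qed.
Let le_N0' k : (k <= n)%N -> (k <= N0)%N.
Proof. by move=> kn; rewrite le_N0// (leq_trans kn)// leq_addr. Qed.
Context (c Cb Cd : R) (c0 : 0 < c) (Cb0 : 0 <= Cb) (Cd0 : 0 <= Cd).
Context (bC : forall k, (k <= m)%N -> `|b n (n - k)| <= Cb * c ^+ k).
Context (dC : forall j, (j <= m)%N -> `|d n j| <= Cd * c ^+ (m - j)).

Context (kap K eta : R) (x : R[i]).
Context (kap0 : 0 < kap) (K0 : 0 < K) (eta0 : 0 < eta).
Context (sepx : separated kap K x
  (fun y => exists2 N, (N <= N0)%N & root (L N) y || root (P N) y)).
Context (xc : eta * c <= normc x).
Context (xrho : `|lead_coef rho| / 2 * normc x ^+ m <= normc (toC rho).[x]).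

Let nx0 : 0 < normc x. Proof. by rewrite (lt_le_trans _ xc)// mulr_gt0. Qed.
Let x0 : x != 0. Proof. by rewrite -normc_gt0. Qed.
Let rho0 : rho != 0. Proof. by rewrite -size_poly_eq0 srho. Qed.
Let l0 : 0 < `|lead_coef rho|. Proof. by rewrite normr_gt0 lead_coef_eq0. Qed.

Let separated_sub (S S' : R -> Prop) :
  (forall y, S' y -> S y) -> separated kap K x S -> separated kap K x S'.
Proof. by move=> H [u [u1 Hu]]; exists u; split => // t /H /Hu. Qed.

Let sepL N : (N <= N0)%N -> separated kap K x (root (L N)).
Proof. by move=> NN; apply: separated_sub sepx => y yr; exists N; rewrite ?yr. Qed.
Let sepP N : (N <= N0)%N -> separated kap K x (root (P N)).
Proof. by move=> NN; apply: separated_sub sepx => y yr; exists N; rewrite ?yr ?orbT. Qed.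

Let nL k := normc (toC (L k)).[x].
Let nP k := normc (toC (P k)).[x].

Lemma pert_neq0 : (toC (L n)).[x] != 0.
Proof.
have nE : n = n.-1.+1 by rewrite prednK// (leq_ltn_trans (leq0n m) mn).
rewrite nE; apply: (separated_neq0 posE opsL kap0 x0); apply: sepL.
by rewrite -nE le_N0'.
Qed.

Lemma ops_ratio_iter k : (k <= n)%N -> nL (n - k) <= nL n / (kap * normc x) ^+ k.
Proof.
elim: k => [|k IH] kn; first by rewrite subn0 expr0 divr1.
have nk : (n - k = (n - k.+1).+1)%N by rewrite subnS prednK ?subn_gt0.
have H := ops_ratio_le posE opsL kap0 x0 (sepL (N := (n - k.+1).+1) _).
rewrite -nk in H; apply: (le_trans (H _)); first by rewrite le_N0' ?leq_subr.
change (nL (n - k) / (kap * normc x) <= nL n / (kap * normc x) ^+ k.+1).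
have -> : nL n / (kap * normc x) ^+ k.+1 = nL n / (kap * normc x) ^+ k / (kap * normc x).
  by rewrite exprSr (invfM _ (kap * normc x)) mulrA.
rewrite ler_wpM2r ?IH ?(ltnW kn)//.
by rewrite invr_ge0 mulr_ge0 ?(ltW kap0) ?normc_ge0.
Qed.

Let cx : c <= eta^-1 * normc x.
Proof. by rewrite ler_pdivlMl. Qed.

Let A := K ^+ 2 / kap.
Let A0 : 0 < A. Proof. by rewrite divr_gt0 ?exprn_gt0. Qed.

Lemma ops_ratio_iter_up j : (j <= m)%N ->
  nP (n + j) <= (K ^+ 2 / kap * normc x) ^+ j * nP n.
Proof.
elim: j => [|j IH] jm; first by rewrite addn0 expr0 mul1r.
have H := ops_ratio_ge posM opsP kap0 K0 x0 (sepP (N := (n + j).+1) _).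
rewrite addnS; apply: (le_trans (H _)); first by rewrite le_N0// -addnS leq_add2l.
change (A * normc x * nP (n + j) <= (A * normc x) ^+ j.+1 * nP n).
have -> : (A * normc x) ^+ j.+1 * nP n = A * normc x * ((A * normc x) ^+ j * nP n).
  by rewrite exprS mulrA.
apply: ler_wpM2l; last exact/IH/ltnW.
by rewrite mulr_ge0 ?normc_ge0// ltW.
Qed.

(** The constant obtained from rho L n = sum of d_j P (n + j) at a point where |rho(x)| is at least
    half its leading term. Adding 1 keeps it positive even if [Cd] is 0. *)
Definition low_const :=
  2 / `|lead_coef rho| * \sum_(j < m.+1) Cd * eta^-1 ^+ (m - j) * A ^+ j + 1.

Lemma low_const_gt0 : 0 < low_const.
Proof.
rewrite ltr_wpDl// mulr_ge0 ?divr_ge0//; apply: sumr_ge0 => j _.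
by rewrite mulr_ge0 ?exprn_ge0 ?(ltW A0)// mulr_ge0// exprn_ge0// invr_ge0 ltW.
Qed.

(** In rho(x) L n (x) the term of index j is at most a constant times c^(m - j) |x|^j |P n (x)|, and
    c = O(|x|). All terms are therefore O(|x|^m |P n (x)|), and |x|^m cancels against rho(x). *)
Lemma ops_comparison : nL n <= low_const * nP n.
Proof.
have H : normc (toC rho).[x] * nL n <=
    normc x ^+ m * ((\sum_(j < m.+1) Cd * eta^-1 ^+ (m - j) * A ^+ j) * nP n).
  rewrite -normcM -hornerM -rmorphM /= (dconn_expand opsL posM opsP srho EM).
  rewrite rmorph_sum /= horner_sum (le_trans (normc_sum _ _))// mulrCA !mulr_suml.
  apply: ler_sum => j _.
  have jm : (j <= m)%N by rewrite -ltnS.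
  rewrite map_polyZ hornerZ normcM normc_real.
  apply: (le_trans (ler_pM _ _ (dC jm) (ops_ratio_iter_up jm))) => //.
    exact: normc_ge0.
  have -> : normc x ^+ m = normc x ^+ (m - j) * normc x ^+ j.
    by rewrite -exprD subnK.
  have : c ^+ (m - j) <= (eta^-1 * normc x) ^+ (m - j).
    apply: lerXn2r => //; rewrite nnegrE ?(ltW c0)//.
    by rewrite mulr_ge0 ?invr_ge0 ?normc_ge0// ltW.
  rewrite -/A => Hc.
  have -> : Cd * eta^-1 ^+ (m - j) * A ^+ j *
    (normc x ^+ (m - j) * normc x ^+ j * nP n) =
    Cd * ((eta^-1 * normc x) ^+ (m - j)) * ((A * normc x) ^+ j * nP n).
    by rewrite !exprMn; ring.
  rewrite ler_wpM2r ?ler_wpM2l// mulr_ge0 ?normc_ge0// exprn_ge0//.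
  by rewrite mulr_ge0 ?normc_ge0// ltW.
have : `|lead_coef rho| / 2 * normc x ^+ m * nL n <= _ :=
  le_trans (ler_wpM2r (normc_ge0 _) xrho) H.
set S := \sum_(_ < _) _ in H *; rewrite -mulrA [normc x ^+ m * nL n]mulrC mulrA.
rewrite [leRHS]mulrC ler_pM2r ?exprn_gt0// => G.
rewrite /low_const -/S mulrDl mul1r.
apply: (@le_trans _ _ (2 / `|lead_coef rho| * S * nP n)).
  rewrite -[2 / _]invf_div -mulrA ler_pdivlMl ?divr_gt0//.
by rewrite lerDl normc_ge0.
Qed.

Let ck k : c ^+ k / (kap * normc x) ^+ k <= (kap * eta)^-1 ^+ k.
Proof.
rewrite -expr_div_n; apply: lerXn2r; rewrite ?nnegrE.
- by rewrite divr_ge0 ?mulr_ge0 ?normc_ge0// ltW.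
- by rewrite invr_ge0 mulr_ge0// ltW.
rewrite ler_pdivrMr ?mulr_gt0// invfM mulrA -[leLHS]mul1r.
by rewrite (_ : _ * normc x = eta^-1 * normc x) ?mul1r//; field; rewrite !gt_eqF.
Qed.

Definition pert_sum := \sum_(k < m.+1) Cb * (kap * eta)^-1 ^+ k.

Lemma pert_sum_ge0 : 0 <= pert_sum.
Proof.
by apply: sumr_ge0 => k _; rewrite mulr_ge0 ?exprn_ge0 ?invr_ge0 ?mulr_ge0 ?(ltW kap0) ?(ltW eta0).
Qed.

Let kn (k : 'I_m.+1) : (k < n)%N.
Proof. by rewrite (leq_ltn_trans _ mn)// -ltnS. Qed.

(** The coefficients of L (n - k) in Qhat and in P n differ by k / (n - k) times b_(n, n - k), and k
    / (n - k) is at most m / (n - m). The growth c^k of b_(n, n - k) is offset by the decay |x|^-k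
    of L (n - k) / L n. *)
Lemma Qpert_close :
  normc ((toC (Qpert n)).[x] - (toC (P n)).[x]) <=
  m%:R / (n - m)%:R * pert_sum * nL n.
Proof.
rewrite (conn_expand posE opsL opsP srho EM (ltnW mn)) /Qpert -hornerN -hornerD.
rewrite -rmorphB /= -sumrB rmorph_sum horner_sum (le_trans (normc_sum _ _))//.
rewrite /pert_sum mulr_sumr mulr_suml; apply: ler_sum => k _.
rewrite -/b -scalerBl /= map_polyZ hornerZ normcM normc_real.
have km : (k <= m)%N by rewrite -ltnS.
have nk : 0 < (n - k)%:R :> R by rewrite ltr0n subn_gt0 kn.
have -> : n%:R / (n - k)%:R * b n (n - k) - b n (n - k) =
   k%:R / (n - k)%:R * b n (n - k).
  have -> : n%:R = (n - k)%:R + k%:R :> R by rewrite -natrD subnK// ltnW ?kn.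
  by field; rewrite gt_eqF.
rewrite normrM ger0_norm ?divr_ge0 ?ler0n// -!mulrA.
apply: ler_pM; rewrite ?ler0n//.
  - by rewrite mulr_ge0 ?invr_ge0 ?ler0n// mulr_ge0// normc_ge0.
  - by rewrite ler_nat.
apply: ler_pM; rewrite ?invr_ge0 ?ler0n//.
  - by rewrite mulr_ge0// normc_ge0.
  - by rewrite lef_pV2 ?posrE ?ltr0n ?subn_gt0// ?ler_nat ?leq_sub2l// kn.
apply: (le_trans (ler_pM _ _ (bC km) (ops_ratio_iter (ltnW (kn k))))) => //.
  exact: normc_ge0.
rewrite -mulrA ler_wpM2l// mulrCA [leRHS]mulrC ler_wpM2l ?normc_ge0//.
Qed.

Hypothesis nlarge : m%:R / (n - m)%:R * pert_sum <= (2 * low_const)^-1.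

(** [nlarge] makes the distance from Qhat to P n at most half of the lower bound |L n| / low_const
    for |P n|. *)
Lemma Qpert_ge : nL n <= 2 * low_const * normc (toC (Qpert n)).[x].
Proof.
have lc := low_const_gt0; have H := ops_comparison.
have G := le_trans Qpert_close (ler_wpM2r (normc_ge0 _) nlarge).
have := normc_ge_subl (toC (P n)).[x] ((toC (P n)).[x] - (toC (Qpert n)).[x]).
rewrite subKr normc_distC => F.
rewrite -ler_pdivrMl in H => //.
have : low_const^-1 * nL n - (2 * low_const)^-1 * nL n <=
  normc (toC (Qpert n)).[x] by apply: le_trans F; rewrite lerB.
rewrite -mulrBl (_ : _ - _ = (2 * low_const)^-1); last by field; rewrite gt_eqF.
by rewrite ler_pdivrMl// mulr_gt0.
Qed.

Lemma Qpert_neq0 : (toC (Qpert n)).[x] != 0.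
Proof.
have lc : 0 < 2 * low_const by rewrite mulr_gt0 ?low_const_gt0.
rewrite -normc_gt0 -(pmulr_rgt0 _ lc).
by rewrite (lt_le_trans _ Qpert_ge)// normc_gt0 pert_neq0.
Qed.

Let wr (f g : {poly R}) := (toC f^`()).[x] * (toC g).[x] - (toC f).[x] * (toC g^`()).[x].

(** With f = L (n - k - 1) and g = L (n - k), the identity W(f, L n) g = W(f, g) L n + f W(g, L n)
    reduces the Wronskian to neighbouring indices; each step adds one term of the same size. *)
Lemma ops_wronskian_iter k : (k <= n)%N ->
  normc (wr (L (n - k)) (L n)) <= k%:R * nL n ^+ 2 / (kap * normc x) ^+ k.+1.
Proof.
elim: k => [|k IH] kn'; first by rewrite /wr subn0 mulrC subrr normc0 !mul0r.
have nk : (n - k = (n - k.+1).+1)%N by rewrite subnS prednK ?subn_gt0.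
have S : separated kap K x (root (L (n - k.+1).+1)) by apply: sepL; rewrite -nk le_N0' ?leq_subr.
have g0 := separated_neq0 posE opsL kap0 x0 S.
have H1 := ops_wronskian_le posE opsL kap0 x0 S.
have H2 := ops_ratio_le posE opsL kap0 x0 S.
have H3 := ops_ratio_iter (ltnW kn').
rewrite -nk in g0 H1 H2.
set f := L (n - k.+1) in H1 H2 *; set g := L (n - k) in g0 H1 H2 IH *.
have g1 : 0 < normc (toC g).[x] by rewrite normc_gt0.
rewrite -(ler_pM2r g1) -normcM.
have -> : wr f (L n) * (toC g).[x] =
  wr f g * (toC (L n)).[x] + (toC f).[x] * wr g (L n) by rewrite /wr; ring.
rewrite (le_trans (normcD _ _))// !normcM.
set y := kap * normc x in H1 H2 H3 IH *.
have y0 : 0 < y by rewrite mulr_gt0.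
apply: (@le_trans _ _ (normc (toC g).[x] ^+ 2 / y ^+ 2 * nL n +
   normc (toC g).[x] / y * (k%:R * nL n ^+ 2 / y ^+ k.+1))).
  rewrite lerD ?ler_wpM2r ?normc_ge0//; apply: ler_pM; rewrite ?normc_ge0//.
  by apply: IH; exact: ltnW.
have -> : normc (toC g).[x] ^+ 2 / y ^+ 2 * nL n +
   normc (toC g).[x] / y * (k%:R * nL n ^+ 2 / y ^+ k.+1) =
   normc (toC g).[x] * (normc (toC g).[x] / y ^+ 2 * nL n
      + k%:R * nL n ^+ 2 / y ^+ k.+2).
  by rewrite !exprS; field; rewrite expf_neq0 ?gt_eqF.
rewrite mulrC ler_wpM2r ?normc_ge0// -[k.+1%:R]natr1 mulrDl mul1r mulrDl.
rewrite addrC lerD2l.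
apply: (@le_trans _ _ ((nL n / y ^+ k) / y ^+ 2 * nL n)).
  by rewrite !ler_wpM2r ?normc_ge0// invr_ge0 exprn_ge0// ltW.
rewrite le_eqVlt; apply/orP; left; apply/eqP.
by rewrite !exprS; field; rewrite expf_neq0 ?gt_eqF.
Qed.

(** Here m + 1 bounds n / (n - k), m bounds the number k of Wronskian steps, and 1 / kap comes from
    the extra power in [ops_wronskian_iter]. *)
Definition dlog_const := (m%:R + 1) * m%:R * pert_sum / kap.

Lemma Qpert_wronskian_le :
  normc (wr (Qpert n) (L n)) <= dlog_const / normc x * nL n ^+ 2.
Proof.
have -> : wr (Qpert n) (L n) =
  \sum_(k < m.+1) (n%:R / (n - k)%:R * b n (n - k))%:C%C * wr (L (n - k)) (L n).
  rewrite /wr /Qpert raddf_sum !rmorph_sum /= !horner_sum !mulr_suml -sumrB.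
  by apply: eq_bigr => k _; rewrite derivZ !map_polyZ !hornerZ /=; ring.
rewrite (le_trans (normc_sum _ _))//.
have -> : dlog_const / normc x * nL n ^+ 2 = \sum_(k < m.+1)
   (m%:R + 1) * m%:R * (Cb * (kap * eta)^-1 ^+ k) / (kap * normc x) * nL n ^+ 2.
  rewrite /dlog_const /pert_sum mulr_sumr !mulr_suml; apply: eq_bigr => k _.
  by congr (_ * _); rewrite -(mulrA _ kap^-1) -(invfM kap).
apply: ler_sum => k _; rewrite normcM normc_real normrM.
have km : (k <= m)%N by rewrite -ltnS.
have nk : 0 < (n - k)%:R :> R by rewrite ltr0n subn_gt0 kn.
rewrite ger0_norm ?divr_ge0 ?ler0n//.
have H : n%:R / (n - k)%:R <= m%:R + 1 :> R.
  rewrite natr1 ler_pdivrMr// -natrM ler_nat.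
  have := kn k; move: km; set k' := nat_of_ord k => km kn'.
  rewrite mulSn; apply: (@leq_trans (n - k' + k')%N); first by rewrite subnK// ltnW.
  by rewrite leq_add2l (leq_trans km)// leq_pmulr// subn_gt0.
apply: (le_trans (ler_pM _ _ (ler_pM _ _ H (bC km)) (ops_wronskian_iter (ltnW (kn k))))) => //.
  exact: normc_ge0.
have y0 : 0 < kap * normc x by rewrite mulr_gt0.
have -> : (m%:R + 1) * (Cb * c ^+ k) * (k%:R * nL n ^+ 2 / (kap * normc x) ^+ k.+1) =
  ((m%:R + 1) * k%:R * Cb / (kap * normc x) * nL n ^+ 2) * (c ^+ k / (kap * normc x) ^+ k).
  by rewrite (exprS (kap * normc x)) (invfM (kap * normc x)); ring.
have -> : (m%:R + 1) * m%:R * (Cb * (kap * eta)^-1 ^+ k) / (kap * normc x) * nL n ^+ 2 =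
  ((m%:R + 1) * m%:R * Cb / (kap * normc x) * nL n ^+ 2) * (kap * eta)^-1 ^+ k.
  by ring.
have m1 : 0 <= m%:R + 1 :> R by rewrite addr_ge0.
apply: ler_pM (ck k).
- by rewrite mulr_ge0 ?sqr_ge0// divr_ge0 ?(ltW y0)// !mulr_ge0.
- by rewrite divr_ge0 ?exprn_ge0// ltW.
rewrite !ler_wpM2r ?sqr_ge0 ?invr_ge0 ?(ltW y0)//.
by rewrite ler_wpM2l// ler_nat.
Qed.

(** The difference of the logarithmic derivatives is the Wronskian over the product. The bound does
    not grow with n, although each logarithmic derivative is a sum over n zeros, so the difference
    disappears after division by n. *)
Lemma Qpert_dlog_le :
  normc ((toC (Qpert n)^`()).[x] / (toC (Qpert n)).[x] -
         (toC (L n)^`()).[x] / (toC (L n)).[x]) <=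
  2 * low_const * dlog_const / normc x.
Proof.
have q0 := Qpert_neq0; have L0 := pert_neq0.
have -> : (toC (Qpert n)^`()).[x] / (toC (Qpert n)).[x] -
         (toC (L n)^`()).[x] / (toC (L n)).[x] =
  wr (Qpert n) (L n) / ((toC (Qpert n)).[x] * (toC (L n)).[x]).
  by rewrite /wr; field; rewrite q0 L0.
rewrite normcM normcV normcM ler_pdivrMr ?mulr_gt0 ?normc_gt0//.
apply: (le_trans Qpert_wronskian_le).
rewrite expr2 mulrA [leRHS]mulrA ler_wpM2r ?normc_ge0//.
rewrite [leRHS](_ : _ = dlog_const / normc x *
  (2 * low_const * normc (toC (Qpert n)).[x])); last by ring.
rewrite ler_wpM2l ?Qpert_ge// divr_ge0 ?normc_ge0// divr_ge0 ?(ltW kap0)//.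
by rewrite mulr_ge0 ?pert_sum_ge0// mulr_ge0 ?addr_ge0.
Qed.

End Perturbation.

(** * Pearson weights *)

Section Pearson.
Context {R : rcfType} (E : {scalar {poly R}}) (L : nat -> {poly R}).
Context (posE : posdef E) (opsL : orthopoly E L) (u v t : R).

(** Weak form of the Pearson equation ((u + v x) w)' = (t - x) w with vanishing boundary terms.
    Laguerre is u = 0, v = 1, t = 1 + alpha and Hermite is u = 1/2, v = t = 0, so that one treatment
    serves both. *)
Definition pearson := forall p : {poly R},
  E ((u%:P + v *: 'X) * p^`() + (t%:P - 'X) * p) = 0.

Context (pearsonE : pearson).
Implicit Types p q : {poly R}.

Definition dop p := (u%:P + v *: 'X) * p^`()^`() + (t%:P - 'X) * p^`().

(** Integration by parts: adding E ((u + v X) p' q') to either side gives the Pearson expression of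
    p' q or of p q', which is zero. *)
Lemma dop_sym p q : E (dop p * q) = E (p * dop q).
Proof.
have H a b : E (dop a * b) = - E ((u%:P + v *: 'X) * (a^`() * b^`())).
  apply/eqP; rewrite -subr_eq0 opprK -functionalD -(pearsonE (a^`() * b)).
  by rewrite derivM /dop; apply/eqP; congr (E _); ring.
by rewrite [in RHS]mulrC !H [q^`() * _]mulrC.
Qed.

Lemma coef_dop p j : (dop p)`_j =
  u * p`_j.+2 * (j.+2 * j.+1)%:R + v * p`_j.+1 * (j.+1 * j)%:R +
  t * p`_j.+1 * j.+1%:R - p`_j * j%:R.
Proof.
rewrite /dop mulrDl mulrBl -scalerAl !coefD coefN coefZ !coefCM !coefXM !coef_deriv.
case: j => [|j] /=.
  by rewrite !mulr1n -mulr_natr !natrM; ring.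
by rewrite !natrM; ring.
Qed.

Lemma size_dop p n : (size p <= n)%N -> (size (dop p) <= n)%N.
Proof.
move=> pn; apply/leq_sizeP => j nj.
have H i : (n <= i)%N -> p`_i = 0 by move=> ni; rewrite nth_default ?(leq_trans pn).
by rewrite coef_dop !H ?(leq_trans nj)// 1?ltnW// !(mulr0, mul0r, addr0, subr0).
Qed.

(** [dop] sends X^n to - n X^n plus lower terms, so r has degree below n. By symmetry E (r r)
    reduces to E (L n dop r) and E (L n r), both zero, whence r = 0. *)
Lemma ops_ode n : dop (L n) = - n%:R *: L n.
Proof.
pose r := dop (L n) + n%:R *: L n.
have sL := ops_size opsL n.
have sr : (size r <= n)%N.
  apply/leq_sizeP => j nj; rewrite coefD coefZ coef_dop.
  have H i : (n < i)%N -> (L n)`_i = 0 by move=> ni; rewrite nth_default ?sL.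
  rewrite (H j.+2) ?(H j.+1) ?ltnS// 1?ltnW// !(mulr0, mul0r, addr0, add0r).
  move: nj; rewrite leq_eqVlt => /orP[/eqP <-|nj]; first by rewrite mulrC addNr.
  by rewrite H// mul0r mulr0 oppr0 addr0.
have r0 : r = 0.
  apply/eqP; apply: contraT => /posE; rewrite {1}/r mulrDl functionalD dop_sym.
  rewrite -scalerAl functionalZ !(ops_orth opsL) ?size_dop//.
  by rewrite mulr0 addr0 ltxx.
by apply/eqP; rewrite scaleNr -addr_eq0 -/r r0.
Qed.

Lemma ops_subleading n : (L n.+1)`_n = - (n.+1%:R * (t + v * n%:R)).
Proof.
have := congr1 (fun p : {poly R} => p`_n) (ops_ode n.+1).
rewrite coef_dop coefZ [(L n.+1)`_n.+2]nth_default ?(ops_size opsL)//.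
rewrite (ops_coefn opsL) !natrM mulr0 mul0r add0r !mulr1.
set s := _`_n => H; have {}H : s * n%:R - n.+1%:R * s = v * (n.+1%:R * n%:R) + t * n.+1%:R.
  have -> : v * (n.+1%:R * n%:R) + t * n.+1%:R =
    (v * (n.+1%:R * n%:R) + t * n.+1%:R - s * n%:R) + s * n%:R by ring.
  by rewrite H; ring.
have : - s = v * (n.+1%:R * n%:R) + t * n.+1%:R by rewrite -H -natr1; ring.
by move=> /(congr1 -%R); rewrite opprK => ->; ring.
Qed.

(** Coefficients of the monic three-term recurrence: 2 n + 1 + alpha and n (n + alpha) for Laguerre,
    0 and n / 2 for Hermite. *)
Definition rec_a n := t + 2 * v * n%:R.
Definition rec_b n := n%:R * (u + v * (t + v * n.-1%:R)).

(** The Pearson identity for L n.+1 L n. Orthogonality leaves E (X L n L n.+1), which is the norm of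
    L n.+1, and E (L n sg L n.+1'), which is read off a coefficient after [r] has removed the part
    of degree n + 1. *)
Lemma ops_norm_rec n : E (L n.+1 * L n.+1) = rec_b n.+1 * E (L n * L n).
Proof.
have := pearsonE (L n.+1 * L n).
pose sg : {poly R} := u%:P + v *: 'X.
have coefsg p j : (sg * p)`_j = u * p`_j + v * (if j is i.+1 then p`_i else 0).
  by rewrite /sg mulrDl -scalerAl coefD coefZ coefCM coefXM; case: j.
rewrite derivM -/sg.
rewrite (_ : _ + _ = L n * (sg * (L n.+1)^`()) + L n.+1 * (sg * (L n)^`())
   + t *: (L n.+1 * L n) - L n.+1 * ('X * L n)); last by rewrite -mul_polyC; ring.
rewrite functionalB !functionalD functionalZ.
have sL := ops_size opsL.
rewrite [E (L n.+1 * (sg * _))](ops_orth opsL); last first.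
  apply/leq_sizeP => j nj; rewrite coefsg; case: j nj => // j nj.
  by rewrite !coef_deriv !nth_default ?sL ?ltnS// ?mul0rn ?mulr0 ?addr0// 1?ltnW.
have orth i j : i != j -> E (L i * L j) = 0 by case: (opsL) => _ _; exact.
rewrite (orth n.+1 n) ?mulr0 ?addr0; last by rewrite neq_ltn ltnSn orbT.
rewrite (ops_lead opsL (p := 'X * L n)); last first.
  by rewrite (leq_trans (size_polyMleq _ _))// size_polyX sL.
rewrite coefXM /= (ops_coefn opsL) mul1r => /eqP; rewrite subr_eq0 => /eqP <-.
pose r := sg * (L n.+1)^`() - (v * n.+1%:R) *: L n.+1.
rewrite (_ : sg * _ = r + (v * n.+1%:R) *: L n.+1); last by rewrite /r subrK.
rewrite mulrDr functionalD -scalerAr functionalZ.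
case: (opsL) => _ _ -> ; last by rewrite neq_ltn ltnSn.
have coefr j : r`_j = u * ((L n.+1)`_j.+1 *+ j.+1) +
   v * (if j is i.+1 then (L n.+1)`_j *+ j else 0) - v * n.+1%:R * (L n.+1)`_j.
  rewrite /r coefB coefsg coefZ coef_deriv; case: j => // j.
  by rewrite coef_deriv.
rewrite mulr0 addr0 (ops_lead opsL); last first.
  apply/leq_sizeP => j nj; rewrite coefr; case: j nj => // j nj.
  rewrite [(L n.+1)`_j.+2]nth_default ?sL ?ltnS// mul0rn mulr0 add0r.
  move: nj; rewrite ltnS leq_eqVlt => /orP[/eqP <-|nj].
    by rewrite -mulr_natr; ring.
  by rewrite nth_default ?sL ?ltnS// mul0rn !mulr0 subr0.
congr (_ * _); rewrite coefr /rec_b /= (ops_coefn opsL).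
have -> : (if n is i.+1 then (L n.+1)`_n *+ n else 0) = (L n.+1)`_n * n%:R.
  by case: (n) => [|n']; rewrite ?mulr0// mulr_natr.
by rewrite ops_subleading -[n.+1%:R]natr1; ring.
Qed.

Lemma rec_b_gt0 n : 0 < rec_b n.+1.
Proof.
have N0 := ops_norm_gt0 posE opsL n; have := ops_norm_gt0 posE opsL n.+1.
by rewrite ops_norm_rec pmulr_lgt0.
Qed.

Lemma ops_rec0 : 'X * L 0 = L 1 + rec_a 0 *: L 0.
Proof.
have L0 : L 0 = 1.
  have /size1_polyC := eq_leq (ops_size opsL 0); have := ops_coefn opsL 0.
  by move=> -> ->.
have := ops_subleading 0; rewrite mulr0 addr0 mul1r => s1.
apply/polyP => j; rewrite coefXM coefD coefZ L0 !coef1 /rec_a mulr0 addr0.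
case: j => [|[|j]] /=; rewrite ?s1 ?mulr1 ?mulr0 ?addr0 ?addNr//.
  by rewrite (ops_coefn opsL).
by rewrite nth_default ?(ops_size opsL).
Qed.

Lemma ops_rec n : 'X * L n.+1 = L n.+2 + rec_a n.+1 *: L n.+1 + rec_b n.+1 *: L n.
Proof.
have sL := ops_size opsL.
have N0 k := ops_norm_gt0 posE opsL k.
have sXL : (size ('X * L n.+1)%R <= n.+3)%N.
  by rewrite (leq_trans (size_polyMleq _ _))// size_polyX sL.
have orth i j : i != j -> E (L i * L j) = 0 by case: (opsL) => _ _; exact.
pose r := 'X * L n.+1 - L n.+2 - rec_a n.+1 *: L n.+1.
have sr : (size r <= n.+1)%N.
  apply/leq_sizeP => j nj; rewrite /r !coefB coefZ coefXM.
  case: j nj => // j; rewrite ltnS leq_eqVlt => /orP[/eqP <-|].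
    rewrite (ops_coefn opsL) mulr1 /= !ops_subleading /rec_a -!natr1; ring.
  rewrite leq_eqVlt => /orP[/eqP <-|nj] /=.
    by rewrite !(ops_coefn opsL) [(L n.+1)`_n.+2]nth_default ?sL// subrr mulr0 subr0.
  by rewrite !nth_default ?sL// 1?ltnW// mulr0 !subr0.
have rE : r = (E (L n * r) / E (L n * L n)) *: L n.
  rewrite {1}(ops_fourier posE opsL sr) big_ord_recr /= big1 ?add0r// => i _.
  rewrite /r !mulrBr !functionalB -scalerAr functionalZ.
  have i1 : nat_of_ord i != n.+1 by have := ltn_ord i; lia.
  have i2 : nat_of_ord i != n.+2 by have := ltn_ord i; lia.
  rewrite (orth _ _ i1) (orth _ _ i2) mulr0 !subr0.
  have -> : L i * ('X * L n.+1) = L n.+1 * ('X * L i) by ring.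
  have -> : E (L n.+1 * ('X * L i)) = 0; last by rewrite mul0r scale0r.
  apply: (ops_orth opsL); rewrite (leq_trans (size_polyMleq _ _))// size_polyX sL.
  by have := ltn_ord i.
have -> : 'X * L n.+1 = L n.+2 + rec_a n.+1 *: L n.+1 + r by rewrite /r; ring.
congr (_ + _); rewrite {1}rE; congr (_ *: _).
rewrite /r !mulrBr !functionalB -scalerAr functionalZ.
rewrite (orth n n.+2) ?(orth n n.+1) ?mulr0 ?subr0 ?neq_ltn ?ltnS ?leqnSn ?leqnn//.
rewrite mulrA [_ * 'X]mulrC [_ * L n.+1]mulrC (ops_lead opsL); last first.
  by rewrite (leq_trans (size_polyMleq _ _))// size_polyX sL.
rewrite coefXM /= (ops_coefn opsL) mul1r ops_norm_rec mulfK//.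
by rewrite gt_eqF.
Qed.

(** The recurrence summed against f k / N k: the quadratic form of the Jacobi matrix on the vector f
    k / sqrt (N k). At a zero of L n.+1 the last term vanishes and y becomes a Rayleigh quotient. *)
Lemma ops_rec_sum n y :
  let f k := (L k).[y] in let N k := E (L k * L k) in
  y * \sum_(0 <= k < n.+1) f k ^+ 2 / N k =
  \sum_(0 <= k < n.+1) rec_a k * (f k ^+ 2 / N k) +
  2 * \sum_(0 <= k < n) f k * f k.+1 / N k + f n * f n.+1 / N n.
Proof.
move=> f N; have N0 k : N k != 0 by rewrite gt_eqF// (ops_norm_gt0 posE opsL).
elim: n => [|n IH].
  have := congr1 (fun p : {poly R} => p.[y]) ops_rec0; rewrite !hornerE -!/(f _) => H.
  rewrite !big_nat1 big_nil mulr0 addr0 expr2.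
  have -> : y * (f 0%N * f 0%N / N 0%N) = (y * f 0%N) * f 0%N / N 0%N by ring.
  by rewrite H; ring.
have S (F : nat -> R) k : \sum_(0 <= i < k.+1) F i = \sum_(0 <= i < k) F i + F k.
  exact: big_nat_recr.
rewrite [\sum_(0 <= k < n.+2) f k ^+ 2 / N k]S mulrDr IH.
rewrite [\sum_(0 <= k < n.+2) _]S [\sum_(0 <= k < n.+1) f k * f k.+1 / N k]S.
have H : f n.+2 = y * f n.+1 - rec_a n.+1 * f n.+1 - rec_b n.+1 * f n.
  have := congr1 (fun p : {poly R} => p.[y]) (ops_rec n).
  by rewrite !hornerE -!/(f _) => ->; ring.
have Nn : N n.+1 = rec_b n.+1 * N n := ops_norm_rec n.
rewrite H Nn.
by field; rewrite N0 gt_eqF// rec_b_gt0.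
Qed.

(** Rayleigh quotient bound for the Jacobi matrix: diagonal entries at most A and off-diagonal
    entries sqrt (rec_b k) at most s confine its eigenvalues to radius A + 2 s. *)
Lemma ops_root_le A s n y : 0 < s -> root (L n.+1) y ->
  (forall k, (k <= n)%N -> `|rec_a k| <= A) ->
  (forall k, (0 < k <= n)%N -> rec_b k <= s ^+ 2) -> `|y| <= A + 2 * s.
Proof.
move=> s0 /rootP ry aA bs.
have N0 k : 0 < E (L k * L k) := ops_norm_gt0 posE opsL k.
have /= := ops_rec_sum n y; rewrite ry mulr0 mul0r addr0 !big_mkord.
set Z := \sum_(k < n.+1) _ ^+ 2 / _.
have Z0 : 0 < Z.
  rewrite /Z big_ord_recl /= ltr_wpDr//.
    by apply: sumr_ge0 => k _; rewrite divr_ge0 ?sqr_ge0// ltW.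
  rewrite divr_gt0// exprn_even_gt0//=.
  have /size1_polyC := eq_leq (ops_size opsL 0); have := ops_coefn opsL 0.
  by move=> -> ->; rewrite hornerC oner_neq0.
move=> H; rewrite -(ler_pM2r Z0) -{1}(gtr0_norm Z0) -normrM H [leRHS]mulrDl.
rewrite (le_trans (ler_normD _ _))// lerD//.
  rewrite (le_trans (ler_norm_sum _ _ _))// /Z mulr_sumr; apply: ler_sum => k _.
  have f0 : 0 <= (L k).[y] ^+ 2 / E (L k * L k) by rewrite divr_ge0 ?sqr_ge0// ltW.
  by rewrite normrM (ger0_norm f0) ler_wpM2r// aA// -ltnS.
(* Weighted arithmetic-geometric mean with ratio s: since N k.+1 = rec_b k.+1 N k is at most s^2 N
   k, the mixed term is at most s / 2 times two consecutive terms of Z. *)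
have F k : (k < n)%N -> `|(L k).[y] * (L k.+1).[y] / E (L k * L k)| <=
    s / 2 * ((L k).[y] ^+ 2 / E (L k * L k) + (L k.+1).[y] ^+ 2 / E (L k.+1 * L k.+1)).
  move=> kn; rewrite normrM normfV (gtr0_norm (N0 k)) ler_pdivrMr//.
  have b0 := rec_b_gt0 k; have bk := bs k.+1 kn.
  rewrite ops_norm_rec.
  set f := (L k).[y]; set g := (L k.+1).[y]; set b := rec_b k.+1 in b0 bk *.
  rewrite (_ : _ * E _ = s / 2 * (f ^+ 2 + g ^+ 2 / b)); last first.
    by have Nk := N0 k; field; rewrite !gt_eqF.
  rewrite normrM.
  apply: (@le_trans _ _ (s / 2 * (f ^+ 2 + g ^+ 2 / s ^+ 2))).
    have -> : s / 2 * (f ^+ 2 + g ^+ 2 / s ^+ 2) =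
        (s * `|f| - `|g|) ^+ 2 / (2 * s) + `|f| * `|g|.
      rewrite -[f ^+ 2](real_normK (num_real f)) -[g ^+ 2](real_normK (num_real g)).
      by field; rewrite gt_eqF.
    by rewrite lerDr divr_ge0 ?sqr_ge0// mulr_ge0// ltW.
  rewrite ler_wpM2l ?divr_ge0 ?(ltW s0)// lerD2l ler_wpM2l ?sqr_ge0//.
  by rewrite lef_pV2 ?posrE ?exprn_gt0.
rewrite normrM ger0_norm// -mulrA ler_wpM2l//.
rewrite (le_trans (ler_norm_sum _ _ _))//.
apply: le_trans (ler_sum _ (fun (k : 'I_n) _ => F k (ltn_ord k))) _.
rewrite -mulr_sumr big_split /= (_ : s * Z = s / 2 * (Z + Z)); last by field.
rewrite ler_wpM2l ?divr_ge0 ?(ltW s0)// lerD//.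
  rewrite /Z big_ord_recr /= lerDl divr_ge0 ?sqr_ge0// ltW//.
rewrite /Z big_ord_recl /= lerDr divr_ge0 ?sqr_ge0// ltW//.
Qed.

End Pearson.

(** * Power sums of the zeros and the Stieltjes relations *)

Section PowerSums.
Context {R : fieldType}.
Implicit Types s r : seq R.

Lemma deriv_prod_XsubC r y : y \notin r ->
  (\prod_(z <- r) ('X - z%:P))^`().[y] =
  (\prod_(z <- r) ('X - z%:P)).[y] * \sum_(z <- r) (y - z)^-1.
Proof.
elim: r => [|z r IH]; first by rewrite !big_nil mulr0 -polyC1 derivC horner0.
rewrite inE negb_or => /andP[yz yr]; rewrite !big_cons derivM derivXsubC mul1r.
rewrite hornerD !hornerM IH// hornerXsubC.
by field; rewrite subr_eq0.
Qed.

Definition psum s k := \sum_(y <- s) y ^+ k.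

(** Exchanging y and z and adding replaces y^k / (y - z) by (y^k - z^k) / (y - z), a sum of
    monomials. Extending that sum to the diagonal adds k y^(k - 1) for each y, hence the
    correction. *)
Lemma pair_sum s k : uniq s ->
  2 * \sum_(y <- s) \sum_(z <- s | z != y) y ^+ k / (y - z) =
  \sum_(i < k) psum s (k - i.+1) * psum s i - k%:R * psum s k.-1.
Proof.
move=> us; set A := \sum_(y <- s) _.
have A1 : A = \sum_(y <- s) \sum_(z <- s | z != y) - (z ^+ k) / (y - z).
  rewrite /A (exchange_big_dep xpredT)//=; apply: eq_bigr => y _.
  apply: eq_big => [z|z _]; first by rewrite eq_sym.
  by rewrite -[z - y]opprB invrN mulrN mulNr.
rewrite mulrDl !mul1r {2}A1 /A -big_split /=.
have H y : y \in s -> \sum_(z <- s | z != y) y ^+ k / (y - z) +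
   \sum_(z <- s | z != y) - (z ^+ k) / (y - z) =
   \sum_(z <- s) \sum_(i < k) y ^+ (k - i.+1) * z ^+ i - k%:R * y ^+ k.-1.
  move=> ys; rewrite (bigD1_seq y)//= addrAC.
  have -> : \sum_(i < k) y ^+ (k - i.+1) * y ^+ i = k%:R * y ^+ k.-1.
    rewrite (eq_bigr (fun=> y ^+ k.-1)) => [|i _].
      by rewrite sumr_const card_ord mulr_natl.
    by rewrite -exprD; congr (_ ^+ _); have := ltn_ord i; lia.
  rewrite subrr add0r -big_split /=; apply: eq_bigr => z zy.
  have yz : y - z != 0 by rewrite subr_eq0 eq_sym.
  rewrite -mulrDl subrXX [_ * \sum_(_ < _) _]mulrC mulfK//.
  by apply: eq_bigr => i _; congr (_ ^+ _ * _); have := ltn_ord i; lia.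
rewrite (eq_big_seq _ H) big_split /= sumrN -mulr_sumr; congr (_ - _).
rewrite (eq_bigr _ (fun y _ => exchange_big _ _ _ _ _ _)) /=.
rewrite exchange_big /=; apply: eq_bigr => i _.
rewrite /psum mulr_suml; apply: eq_bigr => y _.
by rewrite mulr_sumr.
Qed.

End PowerSums.

Section StieltjesRelations.
Context {R : rcfType} (E : {scalar {poly R}}) (L : nat -> {poly R}).
Context (posE : posdef E) (opsL : orthopoly E L) (u v t : R).
Context (pearsonE : pearson E u v t).

(** The differential equation at a zero y, where L'' / L' is twice the sum of 1 / (y - z): the
    electrostatic equilibrium of Stieltjes. *)
Lemma ops_zero_equilibrium n s y : L n = \prod_(z <- s) ('X - z%:P) -> y \in s ->
  y - t = 2 * (u + v * y) * \sum_(z <- s | z != y) (y - z)^-1.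
Proof.
move=> Ls ys; have us := zeros_uniq posE opsL Ls.
pose r := rem y s; have yr : y \notin r by rewrite mem_rem_uniq// inE eqxx.
pose p : {poly R} := \prod_(z <- r) ('X - z%:P).
have Lp : L n = p * ('X - y%:P).
  by rewrite Ls (perm_big _ (perm_to_rem ys)) big_cons mulrC.
have py : p.[y] != 0 by rewrite -/(root p y) root_prod_XsubC.
have := congr1 (fun q : {poly R} => q.[y]) (ops_ode posE opsL pearsonE n).
have L1 : (L n)^`() = p^`() * ('X - y%:P) + p by rewrite Lp derivM derivXsubC mulr1.
have L2 : (L n)^`()^`() = p^`()^`() * ('X - y%:P) + p^`() + p^`().
  by rewrite L1 derivD derivM derivXsubC mulr1.
rewrite /dop L2 L1 Lp !hornerE /= subrr !(mulr0, mul0r, addr0, add0r).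
rewrite deriv_prod_XsubC// -/p => H.
have -> : \sum_(z <- s | z != y) (y - z)^-1 = \sum_(z <- r) (y - z)^-1.
  by rewrite /r rem_filter// big_filter; apply: eq_bigl => z.
move: H; set S := \sum_(z <- r) _ => H.
apply: (mulfI py).
have -> : p.[y] * (2 * (u + v * y) * S) = p.[y] * (y - t) +
  ((u + v * y) * (p.[y] * S + p.[y] * S) + (t - y) * p.[y]) by ring.
by rewrite H addr0.
Qed.

(** The equilibrium equation times y^k, summed over the zeros; [pair_sum] then closes the recurrence
    in the power sums. *)
Lemma ops_psum n s k : L n = \prod_(z <- s) ('X - z%:P) ->
  let A j := \sum_(i < j) psum s (j - i.+1) * psum s i - j%:R * psum s j.-1 in
  psum s k.+1 = t * psum s k + u * A k + v * A k.+1.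
Proof.
move=> Ls A; have us := zeros_uniq posE opsL Ls.
rewrite /A -!pair_sum// /psum !mulr_sumr -!big_split /=.
apply: eq_big_seq => y ys.
have H := ops_zero_equilibrium Ls ys.
have -> : \sum_(z <- s | z != y) y ^+ k.+1 / (y - z) = y ^+ k.+1 * \sum_(z <- s | z != y) (y - z)^-1.
  by rewrite mulr_sumr.
have -> : \sum_(z <- s | z != y) y ^+ k / (y - z) = y ^+ k * \sum_(z <- s | z != y) (y - z)^-1.
  by rewrite mulr_sumr.
rewrite exprS -{1}(subrK t y) H.
by ring.
Qed.

End StieltjesRelations.

(** * Transfer of zero bounds *)

Section PolynomialGrowth.
Context {R : rcfType}.
Implicit Types p : {poly R}.
Import ComplexField.Normc.
Local Notation toC := (map_poly (real_complex R)).

Lemma horner_toC p (x : R) : (toC p).[x%:C%C] = (p.[x])%:C%C.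
Proof. by rewrite horner_map. Qed.

Lemma poly_tail_le p m (x : R[i]) : size p = m.+1 -> 1 <= normc x ->
  normc ((toC p).[x] - (lead_coef p)%:C%C * x ^+ m) * normc x <=
  (\sum_(k < m) `|p`_k|) * normc x ^+ m.
Proof.
move=> sp x1; rewrite horner_coef size_map_poly sp big_ord_recr /= coef_map /=.
rewrite lead_coefE sp addrK.
have x0 : 0 <= normc x by exact: normc_ge0.
apply: (le_trans (ler_wpM2r x0 (normc_sum _ _))).
rewrite !mulr_suml; apply: ler_sum => k _.
rewrite coef_map normcM normc_real normcX -mulrA ler_wpM2l// -exprSr.
exact: ler_weXn2l.
Qed.

Lemma poly_large_ge p m : size p = m.+1 -> exists X0, 1 <= X0 /\
  forall x : R[i], X0 <= normc x ->
    `|lead_coef p| / 2 * normc x ^+ m <= normc (toC p).[x].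
Proof.
move=> sp; set S := \sum_(k < m) `|p`_k|.
have S0 : 0 <= S by apply: sumr_ge0.
have l0 : 0 < `|lead_coef p| by rewrite normr_gt0 lead_coef_eq0 -size_poly_eq0 sp.
exists (1 + 2 * S / `|lead_coef p|); split.
  by rewrite lerDl divr_ge0 ?mulr_ge0// ltW.
move=> x xX; have x1 : 1 <= normc x.
  by apply: le_trans xX; rewrite lerDl divr_ge0 ?mulr_ge0// ltW.
have x0 : 0 < normc x by exact: lt_le_trans x1.
have H := poly_tail_le sp x1; rewrite -/S in H.
have G := normc_ge_subl ((lead_coef p)%:C%C * x ^+ m) ((lead_coef p)%:C%C * x ^+ m - (toC p).[x]).
rewrite subKr normc_distC normcM normc_real normcX in G.
apply: le_trans G; rewrite lerBrDr -lerBrDl.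
rewrite -(ler_pM2r x0) (le_trans H)//.
have -> : (`|lead_coef p| * normc x ^+ m - `|lead_coef p| / 2 * normc x ^+ m) * normc x =
  (`|lead_coef p| / 2 * normc x) * normc x ^+ m by field.
rewrite ler_wpM2r ?exprn_ge0 ?(ltW x0)//.
rewrite -ler_pdivrMl ?divr_gt0//; apply: le_trans xX.
rewrite [leLHS](_ : _ = 2 * S / `|lead_coef p|) ?lerDr//.
by field; rewrite gt_eqF.
Qed.

Lemma lead_coef_gt0 p : p != 0 -> (forall x, 0 <= x -> 0 <= p.[x]) ->
  0 < lead_coef p.
Proof.
move=> p0 H; rewrite lt_def lead_coef_eq0 p0 /= leNgt; apply/negP => l0.
have sp : size p = (size p).-1.+1 by rewrite prednK// size_poly_gt0.
set m := (size p).-1 in sp; set S := \sum_(k < m) `|p`_k|.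
have S0 : 0 <= S by apply: sumr_ge0.
(* Beyond this point the lower terms, at most S x^(m - 1), cannot outweigh a negative leading
   term. *)
pose x := 1 + S / - lead_coef p.
have nl0 : 0 < - lead_coef p by rewrite oppr_gt0.
have x1 : 1 <= x by rewrite lerDl divr_ge0// ltW.
have x0 : 0 < x by exact: lt_le_trans x1.
have := @poly_tail_le p m x%:C%C sp; rewrite normc_real gtr0_norm// => /(_ x1).
rewrite horner_toC -rmorphXn -rmorphM -rmorphB normc_real /= -/S => T.
have px := H _ (ltW x0); have xm : 0 < x ^+ m by rewrite exprn_gt0.
have : - lead_coef p * x ^+ m * x <= S * x ^+ m.
  apply: le_trans T; rewrite ler_pM2r// (le_trans _ (ler_norm _))// mulNr.
  by rewrite lerDr.
rewrite mulrAC ler_pM2r// /x mulrDr mulr1 [_ * (S / _)]mulrC divfK ?gt_eqF//.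
by rewrite gerDr leNgt nl0.
Qed.

(* p(y) - p(x) = (y - x) * \sum_k p_k (y^(k-1) + ... + x^(k-1)), and the term of
   degree [size p - 1] dominates the others. *)
Lemma poly_increasing_large p : 0 < lead_coef p ->
  exists B, forall x y, 0 <= x -> x <= y -> B <= y -> p.[x] <= p.[y].
Proof.
move=> l0; have p0 : p != 0 by rewrite -lead_coef_eq0 gt_eqF.
have sp : size p = (size p).-1.+1 by rewrite prednK// size_poly_gt0.
set m := (size p).-1 in sp; set S := \sum_(k < m) `|p`_k|.
have S0 : 0 <= S by apply: sumr_ge0.
exists (1 + m%:R * S / lead_coef p) => x y x0 xy By.
have y1 : 1 <= y by apply: le_trans By; rewrite lerDl divr_ge0 ?mulr_ge0// ltW.
have y0 : 0 < y by exact: lt_le_trans y1.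
pose h k := \sum_(i < k) y ^+ (k.-1 - i) * x ^+ i.
have h0 k : 0 <= h k.
  by apply: sumr_ge0 => i _; rewrite mulr_ge0 ?exprn_ge0// ltW.
have hle k : h k <= k%:R * y ^+ k.-1.
  rewrite /h mulr_natl -[k in leRHS]card_ord -sumr_const card_ord.
  apply: ler_sum => i _.
  have -> : y ^+ k.-1 = y ^+ (k.-1 - i) * y ^+ i.
    by rewrite -exprD; congr (_ ^+ _); have := ltn_ord i; lia.
  rewrite ler_wpM2l ?exprn_ge0 ?(ltW y0)//; apply: lerXn2r => //.
  by rewrite nnegrE ltW.
rewrite -subr_ge0 !horner_coef sp -sumrB big_ord_recr /=.
rewrite (eq_bigr (fun k : 'I_m => (y - x) * (p`_k * h k))) => [|k _]; last first.
  by rewrite -mulrBr subrXX mulrCA.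
rewrite -mulrBr subrXX -/(h m) mulrCA -mulr_sumr -mulrDr mulr_ge0 ?subr_ge0//.
case: m sp @S S0 By h0 hle => [|m] sp S S0 By h0 hle.
  by rewrite big_ord0 add0r /h big_ord0 mulr0.
have pm : p`_m.+1 = lead_coef p by rewrite lead_coefE sp.
have hm : y ^+ m <= h m.+1.
  rewrite /h big_ord_recl expr0 mulr1 subn0 /= lerDl; apply: sumr_ge0 => i _.
  by rewrite mulr_ge0 ?exprn_ge0// ltW.
rewrite pm addrC -[X in _ + X]opprK subr_ge0.
apply: (@le_trans _ _ (lead_coef p * y ^+ m)); last by rewrite ler_wpM2l// ltW.
rewrite -sumrN.
apply: (@le_trans _ _ (\sum_(k < m.+1) `|p`_k| * (m.+1%:R * y ^+ m / y))).
  apply: ler_sum => -[k km] _ /=.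
  rewrite (le_trans (ler_norm _))// normrN normrM ler_wpM2l// ger0_norm//.
  case: k km => [|k] km.
    by rewrite /h big_ord0 divr_ge0 ?mulr_ge0 ?exprn_ge0// ltW.
  rewrite (le_trans (hle _))// -mulrA ler_pM ?exprn_ge0 ?(ltW y0)//.
    by rewrite ler_nat ltnW.
  by rewrite ler_pdivlMr// -exprSr; apply: ler_weXn2l.
rewrite -mulr_suml -/S (_ : S * _ = (m.+1%:R * S / y) * y ^+ m); last by ring.
rewrite ler_wpM2r ?exprn_ge0 ?(ltW y0)// ler_pdivrMr//.
apply: (@le_trans _ _ (lead_coef p * (1 + m.+1%:R * S / lead_coef p))).
  by rewrite mulrDr mulr1 [_ * (_ / _)]mulrC divfK ?gt_eqF// lerDr ltW.
by rewrite ler_pM2l.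
Qed.

End PolynomialGrowth.

Section ZeroLocation.
Context {R : rcfType} (E M : {scalar {poly R}}) (L P : nat -> {poly R}).
Context (D : R -> Prop).
Context (posE : posdef E) (opsL : orthopoly E L).
Context (posM : posdef M) (opsP : orthopoly M P).
Context (posED : forall p : {poly R}, p != 0 -> (forall x, D x -> 0 <= p.[x]) -> 0 < E p).
Context (posMD : forall p : {poly R}, p != 0 -> (forall x, D x -> 0 <= p.[x]) -> 0 < M p).
Context (rho : {poly R}) (EM : forall p, E p = M (rho * p)).

(** If x1 were to the left of D, then (X - x1) Q^2 would be nonnegative on D, while it equals P n Q
    and is annihilated by M. *)
Lemma ops_root_hull n x1 : root (P n) x1 -> ~ (forall x, D x -> x1 <= x).
Proof.
move=> rx H; have [s Ps] := ops_splits posM opsP n.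
have xs : x1 \in s by rewrite -(root_ops Ps).
pose Q := cofactor_root P n x1.
have Q0 : Q != 0 := cofactor_neq0 opsP Ps xs.
have : 0 < M (('X - x1%:P) * (Q * Q)).
  apply: posMD => [|x Dx]; first by rewrite !mulf_neq0 ?polyXsubC_eq0.
  by rewrite !hornerM hornerXsubC mulr_ge0 ?subr_ge0 ?H// -expr2 sqr_ge0.
have PQ : P n = Q * ('X - x1%:P) by rewrite (cofactorK Ps xs).
rewrite (_ : _ * (Q * Q) = P n * Q); last by rewrite PQ; ring.
rewrite (ops_orth opsP) ?ltxx//.
by rewrite (size_cofactor opsP).
Qed.

Context (q : {poly R}) (q0 : q != 0) (qge0 : forall x, 0 <= q.[x]).

(* With R = P_n / (X - x1) one has M ((X^2 - x1^2) R^2) = M (P_n^2), so that the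
   sign condition makes E ((X^2 - x1^2) q R^2) nonnegative. *)
Lemma ops_root_transfer n N x1 T : root (P n) x1 ->
  0 <= (rho * q).[x1] ->
  (forall x, D x -> 0 <= (x ^+ 2 - x1 ^+ 2) * ((rho * q).[x] - (rho * q).[x1])) ->
  0 <= T -> (n.*2 + size q <= N.*2)%N -> (forall y, root (L N) y -> `|y| <= T) -> `|x1| <= T.
Proof.
move=> rx g1 sgn T0 nN rootT; have [s Ps] := ops_splits posM opsP n.
have xs : x1 \in s by rewrite -(root_ops Ps).
pose Q := cofactor_root P n x1.
have sQ : size Q = n by rewrite (size_cofactor opsP).
have Q0 : Q != 0 := cofactor_neq0 opsP Ps xs.
pose f : {poly R} := 'X^2 - (x1 ^+ 2)%:P.
have PQ : P n = Q * ('X - x1%:P) by rewrite (cofactorK Ps xs).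
have fQ : f * (Q * Q) = P n * P n + (2 * x1) *: (P n * Q).
  by rewrite /f PQ -mul_polyC rmorphXn /= polyCM; ring.
have MfQ : M (f * (Q * Q)) = M (P n * P n).
  by rewrite fQ functionalD functionalZ (ops_orth opsP (eq_leq sQ)) mulr0 addr0.
have nonneg (p : {poly R}) : (forall x, D x -> 0 <= p.[x]) -> 0 <= M p.
  by have [->|p0 H] := eqVneq p 0; rewrite ?functional0// ltW// posMD.
have H1 : 0 <= M (f * (rho * q - (rho * q).[x1]%:P) * (Q * Q)).
  apply: nonneg => x Dx; rewrite hornerM mulr_ge0//; last first.
    by rewrite hornerM -expr2 sqr_ge0.
  rewrite hornerM [f.[x]](_ : _ = x ^+ 2 - x1 ^+ 2); last by rewrite /f !hornerE.
  by rewrite hornerD hornerN hornerC sgn.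
have H2 : 0 <= E (f * (q * (Q * Q))).
  rewrite EM (_ : rho * _ = f * (rho * q - (rho * q).[x1]%:P) * (Q * Q) +
      (rho * q).[x1] *: (f * (Q * Q))); last by rewrite -mul_polyC; ring.
  rewrite functionalD functionalZ MfQ addr_ge0// mulr_ge0//.
  by rewrite ltW// (ops_norm_gt0 posM opsP).
have EQ : 0 < E (q * (Q * Q)).
  apply: posED => [|x Dx]; first by rewrite !mulf_neq0.
  by rewrite hornerM mulr_ge0// hornerM -expr2 sqr_ge0.
have [r Lr] := ops_splits posE opsL N.
have n0 : (0 < n)%N.
  by rewrite lt0n; apply/eqP => n0; move: Q0; rewrite -size_poly_eq0 sQ n0.
have sq : (0 < size q)%N by rewrite size_poly_gt0.
have sQQ : (size (q * (Q * Q))%R <= (size q + n.*2).-2)%N.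
  rewrite (leq_trans (size_polyMleq _ _))// (leq_trans (_ : _ <= (size q + (n + n).-1).-1)%N)//.
    have := size_polyMleq Q Q; rewrite sQ => QQ.
    by rewrite -subn1 -[X in (_ <= X)%N]subn1 leq_sub2r// leq_add2l.
  by lia.
(* Quadrature at the zeros of L N bounds x^2 by T^2. Together with the nonnegativity of E ((X^2 -
   x1^2) q Q^2) this yields x1^2 <= T^2. *)
have H3 : E ('X^2 * (q * (Q * Q))) <= T ^+ 2 * E (q * (Q * Q)).
  apply: (gauss_le posE opsL Lr).
  - rewrite (leq_trans (size_polyMleq _ _))// size_polyXn; lia.
  - lia.
  - move=> y yr; rewrite hornerXn -[y ^+ 2]real_normK ?num_real//.
    apply: lerXn2r => //; rewrite ?nnegrE// rootT// Lr root_prod_XsubC//.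
  - by move=> y _; rewrite hornerM mulr_ge0// hornerM -expr2 sqr_ge0.
have : x1 ^+ 2 * E (q * (Q * Q)) <= T ^+ 2 * E (q * (Q * Q)).
  apply: le_trans H3; move: H2; rewrite /f mulrBl functionalB mul_polyC functionalZ.
  by rewrite subr_ge0.
rewrite ler_pM2r// -[x1 ^+ 2]real_normK ?num_real// => H.
by rewrite -ler_sqr ?nnegrE.
Qed.

End ZeroLocation.

(** * Uniform estimates away from the limit interval *)

Section SeparationInterval.
Context {R : rcfType}.
Import ComplexField.Normc.

(** The direction u is that of d = z - t0, with t0 the point closest to z in the interval enlarged
    by eps / 2. The obtuse angle at a projection makes the component of z - t along u at least |d|
    for all t in the enlarged interval. Here |d| is at least eps / 2, and with |z| <= |d| + B this
    gives kap; K comes from |t| <= B and eps <= |z|. Both are independent of z and c. *)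
Lemma separated_interval (lo hi eps c : R) (z : R[i]) :
  lo <= 0 -> 0 <= hi -> 0 < eps -> 0 < c ->
  (forall t, lo <= t <= hi -> eps <= normc (z - t%:C%C)) ->
  let B := hi - lo + eps in
  separated (1 + 2 * B / eps)^-1 (1 + B / eps) (c%:C%C * z)
    (fun y => lo - eps / 2 <= y / c <= hi + eps / 2) /\
  eps * c <= normc (c%:C%C * z).
Proof.
move=> lo0 hi0 eps0 c0 zfar B.
have nz : eps <= normc z by have := zfar 0; rewrite lo0 hi0 subr0; exact.
have B0 : 0 < B by rewrite /B; lra.
have c1 : normc c%:C%C = c by rewrite normc_real gtr0_norm.
split; last by rewrite normcM c1 mulrC ler_pM2l.
set p := complex.Re z; set q := complex.Im z.
(* t0 clamps Re z to the enlarged interval; t1 clamps t0 to [lo, hi], whose points are at distance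
   at least eps from z. *)
pose t0 := if p < lo - eps / 2 then lo - eps / 2
           else if hi + eps / 2 < p then hi + eps / 2 else p.
pose t1 := if t0 < lo then lo else if hi < t0 then hi else t0.
have t0I : lo - eps / 2 <= t0 <= hi + eps / 2.
  by rewrite /t0; case: ltP => ?; [|case: ltP => ?]; lra.
have t0t : forall t, lo - eps / 2 <= t <= hi + eps / 2 -> 0 <= (p - t0) * (t0 - t).
  by move=> t; rewrite /t0; case: ltP => ?; [|case: ltP => ?] => ?; nra.
have t1I : lo <= t1 <= hi by rewrite /t1; case: ltP => ?; [|case: ltP => ?]; lra.
have t01 : `|t0 - t1| <= eps / 2.
  rewrite ler_norml /t1; case: ltP => ?; [|case: ltP => ?]; lra.
set d := z - t0%:C%C.
have d1 : eps / 2 <= normc d.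
  have := zfar _ t1I; have := normcD d (t0 - t1)%:C%C.
  rewrite normc_real /d rmorphB /= addrA subrK => H1 H2; lra.
have tB t : lo - eps / 2 <= t <= hi + eps / 2 -> normc t%:C%C <= B.
  by rewrite normc_real ler_norml /B => ?; lra.
have d2 : normc z <= normc d + B.
  by have := normcD d t0%:C%C; rewrite /d subrK => H; have := tB _ t0I; lra.
have d0 : 0 < normc d by lra.
have dk : (1 + 2 * B / eps)^-1 * normc z <= normc d.
  have k0 : 0 < 1 + 2 * B / eps by rewrite ltr_pwDl// divr_ge0 ?mulr_ge0// ltW.
  rewrite ler_pdivrMl// mulrDl mul1r (le_trans d2)// lerD2l.
  rewrite -{1}[B]mulr1 -!mulrA [2 * _]mulrC -!mulrA ler_pM2l//.
  by rewrite ler_pdivlMl// mulr1; lra.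
exists ((normc d)^-1%:C%C * d); split.
  by rewrite normcM normc_real ger0_norm ?invr_ge0 ?(ltW d0)// mulVf// gt_eqF.
move=> y yI; set t := y / c in yI.
have -> : c%:C%C * z - y%:C%C = c%:C%C * (z - t%:C%C).
  by rewrite mulrBr; congr (_ - _); rewrite -rmorphM /t /= mulrC divfK ?gt_eqF.
split; last first.
  rewrite !normcM c1 mulrCA ler_pM2l// (le_trans (normcB _ _))//.
  rewrite mulrDl mul1r lerD2l (le_trans (tB _ yI))// mulrAC ler_pdivlMr//.
  by rewrite ler_pM2l.
rewrite dotcZ normcM c1 mulrCA ler_pM2l//.
have -> : dotc ((normc d)^-1%:C%C * d) (z - t%:C%C) =
    (normc d)^-1 * (normc d ^+ 2 + (p - t0) * (t0 - t)).
  by rewrite normc_sqr /d /p; case: (z) => a b; rewrite /dotc /=; ring.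
apply: (le_trans dk).
rewrite mulrDr expr2 mulKf ?gt_eqF// lerDl mulr_ge0 ?invr_ge0 ?(ltW d0)//.
exact: t0t.
Qed.

End SeparationInterval.

Section Asymptotics.
Context {R : realType} (E M : {scalar {poly R}}) (L P : nat -> {poly R}).
Context (posE : posdef E) (opsL : orthopoly E L).
Context (posM : posdef M) (opsP : orthopoly M P).
Context (rho : {poly R}) (m : nat) (srho : size rho = m.+1).
Context (EM : forall p, E p = M (rho * p)).
Context (c : nat -> R) (lo hi : R) (lo0 : lo <= 0) (hi0 : 0 <= hi).
Context (c_large : forall A : R, exists n0, forall n, (n0 <= n)%N -> A <= c n).
Context (zeros_near : forall (eps : R) r, 0 < eps -> exists n0, forall n, (n0 <= n)%N ->
  forall N y, (N <= n + r)%N -> root (L N) y || root (P N) y ->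
  lo - eps <= y / c n <= hi + eps).
Context (norm_growth : exists kap : R, [/\ 0 < kap, kap <= 1 & exists n0,
  forall n, (n0 <= n)%N -> forall j, (n - m <= j < n + m)%N ->
  kap * c n ^+ 2 * E (L j * L j) <= E (L j.+1 * L j.+1)]).
Import ComplexField.Normc.
Local Notation toC := (map_poly (real_complex R)).

(** Collects the bounds at x = c_n z. All constants are fixed from eps before n and z are chosen, so
    that z may range over an unbounded set. *)
Lemma Qpert_asymptotics (eps : R) : 0 < eps -> exists C n0, 0 <= C /\
  forall n, (n0 <= n)%N -> 0 < c n /\ forall z : R[i],
  (forall t, lo <= t <= hi -> eps <= normc (z - t%:C%C)) ->
  let x := (c n)%:C%C * z in
  [/\ (toC (Qpert E L P m n)).[x] != 0, (toC (L n)).[x] != 0 &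
    normc ((toC (Qpert E L P m n)^`()).[x] / (toC (Qpert E L P m n)).[x] -
           (toC (L n)^`()).[x] / (toC (L n)).[x]) <= C / normc x].
Proof.
move=> eps0; pose B := hi - lo + eps.
have loN : lo <= 0 := lo0; have hiP : 0 <= hi := hi0.
have B0 : 0 <= B by rewrite /B; lra.
have [kap0 [k0 k1 [n1 Hn1]]] := norm_growth.
have e20 : 0 < eps / 2 by rewrite divr_gt0.
(* The quadrature behind the connection coefficients uses zeros of L up to index n + 2 m + 1. *)
have [n2 Hn2] := zeros_near (m + m).+1 e20.
have [X0 [X1 HX]] := poly_large_ge srho.
(* Ensures c n >= 1 and |x| >= eps c n >= X0, where |rho(x)| is at least half its leading term. *)
have [n3 Hn3] := c_large (1 + X0 / eps).
pose kap := (1 + 2 * B / eps)^-1; pose K := 1 + B / eps.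
have kp : 0 < kap by rewrite invr_gt0 ltr_pwDl// divr_ge0 ?mulr_ge0// ltW.
have Kp : 0 < K by rewrite ltr_pwDl// divr_ge0// ltW.
pose Cb := conn_bound rho m B kap0; pose Cd := dconn_bound rho m B kap0.
have Cb0 : 0 <= Cb by exact: conn_bound_ge0.
have Cd0 : 0 <= Cd by exact: dconn_bound_ge0.
pose lc := low_const rho m Cd kap K eps; pose S := pert_sum m Cb kap eps.
have lc0 : 0 < lc by exact: low_const_gt0.
have S0 : 0 <= S by exact: pert_sum_ge0.
(* From here on m S / (n - m) is at most 1 / (2 lc), the smallness required by [Qpert_ge]. *)
pose n4 := (m + (Num.bound (m%:R * S * (2 * lc))).+1)%N.
exists (2 * lc * dlog_const m Cb kap eps), (maxn (maxn n1 n2) (maxn n3 n4)).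
split.
  have dl0 : 0 <= dlog_const m Cb kap eps.
    by rewrite divr_ge0 ?(ltW kp)// mulr_ge0// mulr_ge0// addr_ge0.
  by rewrite mulr_ge0// mulr_ge0// ltW.
move=> n; rewrite !geq_max => /andP[/andP[n1n n2n] /andP[n3n n4n]].
have mn : (m < n)%N.
  by apply: leq_trans n4n; rewrite /n4 addnS ltnS leq_addr.
have cX := Hn3 _ n3n.
have X0e : 0 <= X0 / eps by rewrite divr_ge0 ?(ltW eps0)// (le_trans _ X1).
have c1 : 1 <= c n by lra.
have c0 : 0 < c n by lra.
split=> // z zfar x.
have [sep xc] := separated_interval lo0 hi0 eps0 c0 zfar.
rewrite -/B -/kap -/K -/x in sep xc.
pose N0 := (n + (m + m).+1)%N.
have nN0 : (n + m + m < N0)%N by rewrite /N0 addnS addnA.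
have sepx : separated kap K x
  (fun y => exists2 N, (N <= N0)%N & root (L N) y || root (P N) y).
  have [u [u1 Hu]] := sep; exists u; split=> // t [N NN rt]; apply: Hu.
  exact: Hn2 rt.
have rootL N y : (N <= N0)%N -> root (L N) y -> `|y| <= B * c n.
  move=> NN ry; have := Hn2 _ n2n N y NN; rewrite ry => /(_ isT).
  rewrite ler_pdivlMr// ler_pdivrMr// => /andP[H1 H2].
  rewrite ler_norml /B; apply/andP; split; nra.
have xrho : `|lead_coef rho| / 2 * normc x ^+ m <= normc (toC rho).[x].
  apply: HX; apply: le_trans xc; rewrite mulrC -ler_pdivrMr//; lra.
have bC := conn_le posE opsL posM opsP srho EM B0 c1 k0 k1 (ltnW mn) nN0 rootL (Hn1 _ n1n).
have dC := dconn_le posE opsL posM opsP srho EM B0 c1 k0 k1 (ltnW mn) nN0 rootL (Hn1 _ n1n).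
have bC' k : (k <= m)%N -> `|conn E L P n (n - k)| <= Cb * c n ^+ k.
  by apply: bC; rewrite leqnn leq_addr.
have large : m%:R / (n - m)%:R * S <= (2 * lc)^-1.
  have nm : 0 < (n - m)%:R :> R by rewrite ltr0n subn_gt0.
  rewrite mulrAC ler_pdivrMr// ler_pdivlMl ?mulr_gt0// mulrC.
  have H := archi_boundP (mulr_ge0 (mulr_ge0 (ler0n R m) S0) (mulr_ge0 (ler0n R 2) (ltW lc0))).
  apply: (le_trans (ltW H)); rewrite ler_nat.
  by rewrite leq_subRL ?(ltnW mn)// (leq_trans _ n4n)// /n4 leq_add2l.
split.
- exact: (Qpert_neq0 posE opsL posM opsP srho EM mn nN0 c0 Cb0 Cd0 bC' dC kp Kp eps0 sepx xc xrho large).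
- exact: (pert_neq0 posE opsL mn nN0 c0 kp eps0 sepx xc).
- exact: (Qpert_dlog_le posE opsL posM opsP srho EM mn nN0 c0 Cb0 Cd0 bC' dC kp Kp eps0 sepx xc xrho large).
Qed.

End Asymptotics.

(** * Weak convergence from moments *)

Section Bernstein.
Context {R : realType}.
Implicit Types (h : nat -> R) (x : R).

(** The Bernstein polynomial of the values h 0, ..., h n: the expectation of h at the number of
    successes in n trials of probability x, conditioned on one trial. The recursion replaces
    binomial sums by inductions. *)
Fixpoint bernstein n h : {poly R} :=
  if n is n'.+1 then 'X * bernstein n' (fun k => h k.+1) + (1 - 'X) * bernstein n' h
  else (h 0%N)%:P.

Lemma bernsteinS n h x : (bernstein n.+1 h).[x] =
  x * (bernstein n (fun k => h k.+1)).[x] + (1 - x) * (bernstein n h).[x].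
Proof. by rewrite /= !hornerE. Qed.

Lemma bernstein_lin n h g (c d : R) x :
  (bernstein n (fun k => c * h k + d * g k)).[x] =
  c * (bernstein n h).[x] + d * (bernstein n g).[x].
Proof.
elim: n h g => [|n IH] h g; first by rewrite /= !hornerC.
by rewrite !bernsteinS !IH; ring.
Qed.

Lemma bernstein_cst n (c : R) x : (bernstein n (fun=> c)).[x] = c.
Proof. by elim: n => [|n IH]; rewrite ?bernsteinS ?IH /= ?hornerC//; ring. Qed.

Lemma bernstein_le n h g x : 0 <= x <= 1 -> (forall k, (k <= n)%N -> h k <= g k) ->
  (bernstein n h).[x] <= (bernstein n g).[x].
Proof.
move=> /andP[x0 x1]; elim: n h g => [|n IH] h g hg; first by rewrite /= !hornerC hg.
rewrite !bernsteinS lerD ?ler_wpM2l ?subr_ge0// IH// => k kn; apply: hg.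
  by rewrite ltnS.
exact: leqW.
Qed.

(** The shift y stays free because the induction step changes it; at y = n x this is the variance n
    x (1 - x). *)
Lemma bernstein_var n y x : (bernstein n (fun k => (k%:R - y) ^+ 2)).[x] =
  n%:R * x * (1 - x) + (n%:R * x - y) ^+ 2.
Proof.
elim: n y => [|n IH] y; first by rewrite /= hornerC; ring.
rewrite bernsteinS IH.
have -> : (fun k => (k.+1%:R - y) ^+ 2) = (fun k => (k%:R - (y - 1)) ^+ 2) :> (nat -> R).
  by apply/funext => k; rewrite -natr1; congr (_ ^+ 2); ring.
by rewrite IH -[n.+1%:R]natr1; ring.
Qed.

(** Bernstein's proof: where |x - k / n| < delta the oscillation is at most eps, and elsewhere 2 A
    is dominated by a multiple of (k - n x)^2, whose mean is the variance. The choice of n makes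
    this second contribution at most eps. *)
Lemma weierstrass01 (f : R -> R) (A eps : R) : 0 < eps ->
  (forall x, 0 <= x <= 1 -> `|f x| <= A) ->
  (exists2 delta, 0 < delta & forall x y, 0 <= x <= 1 -> 0 <= y <= 1 ->
     `|x - y| < delta -> `|f x - f y| <= eps) ->
  exists p : {poly R}, forall x, 0 <= x <= 1 -> `|f x - p.[x]| <= 2 * eps.
Proof.
move=> eps0 fA [delta d0 fd].
have A0 : 0 <= A by apply: le_trans (fA 0 _); rewrite ?normr_ge0// lexx ler01.
pose n := (Num.bound (2 * A / (delta ^+ 2 * eps))).+1.
have n0 : 0 < n%:R :> R by rewrite ltr0n.
exists (bernstein n (fun k => f (k%:R / n%:R))) => x xI.
have /andP[x0 x1] := xI.
have C0 : 0 <= 2 * A / (delta ^+ 2 * n%:R ^+ 2).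
  by apply: divr_ge0; apply: mulr_ge0 => //; exact: sqr_ge0.
have K k : (k <= n)%N -> `|f x - f (k%:R / n%:R)| <=
    eps * 1 + (2 * A / (delta ^+ 2 * n%:R ^+ 2)) * (k%:R - n%:R * x) ^+ 2.
  move=> kn; have kI : 0 <= (k%:R / n%:R : R) <= 1.
    by rewrite divr_ge0//= ler_pdivrMr// mul1r ler_nat.
  have [xk|xk] := ltP `|x - k%:R / n%:R| delta.
    by rewrite mulr1 (le_trans (fd _ _ xI kI xk))// lerDl mulr_ge0 ?sqr_ge0.
  apply: (@le_trans _ _ (2 * A)).
    rewrite (le_trans (ler_normB _ _))// mulrDl mul1r lerD// fA//.
  rewrite -[leLHS]add0r lerD ?mulr1 ?(ltW eps0)//.
  have -> : (k%:R - n%:R * x) ^+ 2 = n%:R ^+ 2 * `|x - k%:R / n%:R| ^+ 2.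
    by rewrite real_normK ?num_real//; field; rewrite gt_eqF.
  have -> : 2 * A / (delta ^+ 2 * n%:R ^+ 2) * (n%:R ^+ 2 * `|x - k%:R / n%:R| ^+ 2)
     = 2 * A * (`|x - k%:R / n%:R| ^+ 2 / delta ^+ 2) by field; rewrite !gt_eqF.
  rewrite ler_peMr ?mulr_ge0// ler_pdivlMr ?exprn_gt0// mul1r.
  by apply: lerXn2r => //; rewrite nnegrE ltW.
have V : eps * 1 + 2 * A / (delta ^+ 2 * n%:R ^+ 2) * (n%:R * x * (1 - x) + (n%:R * x - n%:R * x) ^+ 2) <= 2 * eps.
  rewrite subrr expr0n addr0 mulr1 (_ : 2 * eps = eps + eps); last by ring.
  rewrite lerD2l.
  have -> : 2 * A / (delta ^+ 2 * n%:R ^+ 2) * (n%:R * x * (1 - x)) =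
     (2 * A / (delta ^+ 2 * eps)) * (x * (1 - x)) * (eps / n%:R).
    by field; rewrite !gt_eqF.
  rewrite mulrA ler_pdivrMr// mulrC ler_pM2l//.
  have Hb : 2 * A / (delta ^+ 2 * eps) <= n%:R.
    rewrite (le_trans (ltW (archi_boundP _)))// ?ler_nat//.
    by rewrite divr_ge0 ?mulr_ge0 ?sqr_ge0// ltW.
  apply: le_trans Hb; rewrite ler_piMr//.
    by rewrite divr_ge0 ?mulr_ge0 ?sqr_ge0// ltW.
  by rewrite -[leRHS](mulr1 1) ler_pM ?subr_ge0// gerBl.
rewrite ler_norml; apply/andP; split.
  rewrite lerBrDr addrC lerBlDr.
  apply: (@le_trans _ _ (bernstein n (fun k => 1 * f x + 1 * (eps * 1 +
      2 * A / (delta ^+ 2 * n%:R ^+ 2) * (k%:R - n%:R * x) ^+ 2))).[x]).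
    apply: bernstein_le => // k kn; rewrite !mul1r.
    by have := K k kn; rewrite ler_norml => /andP[H _]; lra.
  by rewrite !bernstein_lin !bernstein_cst bernstein_var !mul1r lerD2l.
rewrite lerBlDr; apply: (@le_trans _ _ (bernstein n (fun=> f x)).[x]).
  by rewrite bernstein_cst.
apply: (@le_trans _ _ (bernstein n (fun k => 1 * f (k%:R / n%:R) + 1 * (eps * 1 +
    2 * A / (delta ^+ 2 * n%:R ^+ 2) * (k%:R - n%:R * x) ^+ 2))).[x]).
  apply: bernstein_le => // k kn; rewrite !mul1r.
  by have := K k kn; rewrite ler_norml => /andP[_ H]; lra.
by rewrite !bernstein_lin !bernstein_cst bernstein_var !mul1r addrC lerD2r.
Qed.

Lemma weierstrass (f : R -> R) (lo hi A eps : R) : lo < hi -> 0 < eps ->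
  (forall x, lo <= x <= hi -> `|f x| <= A) ->
  (exists2 delta, 0 < delta & forall x y, lo <= x <= hi -> lo <= y <= hi ->
     `|x - y| < delta -> `|f x - f y| <= eps) ->
  exists p : {poly R}, forall x, lo <= x <= hi -> `|f x - p.[x]| <= 2 * eps.
Proof.
move=> lh eps0 fA [delta d0 fd].
have l0 : 0 < hi - lo by rewrite subr_gt0.
pose phi s := lo + s * (hi - lo).
have phiI s : 0 <= s <= 1 -> lo <= phi s <= hi by rewrite /phi => ?; nra.
have [||p Hp] := @weierstrass01 (f \o phi) A eps eps0.
- by move=> s /phiI; exact: fA.
- exists (delta / (hi - lo)) => [|s r /phiI sI /phiI rI]; first exact: divr_gt0.
  rewrite ltr_pdivlMr// => sr; apply: fd => //.
  rewrite (_ : phi s - phi r = (s - r) * (hi - lo)); last by rewrite /phi; ring.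
  by rewrite normrM (gtr0_norm l0).
exists (p \Po ((hi - lo)^-1 *: ('X - lo%:P))) => x xI.
rewrite horner_comp hornerZ hornerXsubC.
have := Hp ((hi - lo)^-1 * (x - lo)); rewrite /= /phi mulrAC mulVf ?gt_eqF// mul1r.
rewrite subrKC; apply; rewrite mulr_ge0 ?invr_ge0 ?(ltW l0)//=; last by rewrite subr_ge0; lra.
by rewrite ler_pdivrMl// mulr1; lra.
Qed.

End Bernstein.

Section NearInterval.
Context {R : realType}.
Import ComplexField.Normc.

Lemma Re_le_normc (z : R[i]) : `|complex.Re z| <= normc z.
Proof.
case: z => a b /=; rewrite -sqrtr_sqr ler_sqrt ?addr_ge0 ?sqr_ge0//.
by rewrite lerDl sqr_ge0.
Qed.

Lemma ReB (z y : R[i]) : complex.Re (z - y) = complex.Re z - complex.Re y.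
Proof. by case: z => a b; case: y => c d. Qed.

Lemma poly_near_itv (p : {poly R}) (lo hi eps : R) : 0 < eps ->
  exists2 d, 0 < d & forall t z, lo <= t <= hi -> normc (z - t%:C%C) < d ->
    normc ((map_poly (real_complex R) p).[z] - (p.[t])%:C%C) < eps.
Proof.
move=> eps0; pose B := `|lo| + `|hi| + 1.
have B1 : 1 <= B by rewrite /B lerDr addr_ge0.
have B0 : 0 <= B by rewrite (le_trans _ B1).
pose S := \sum_(k < size p) `|p`_k| * (k%:R * B ^+ k).
have S0 : 0 <= S by apply: sumr_ge0 => k _; rewrite !mulr_ge0// exprn_ge0.
exists (Num.min 1 (eps / (S + 1))).
  by rewrite lt_min ltr01 divr_gt0// ltr_wpDl.
move=> t z tI; rewrite lt_min => /andP[z1 zd].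
have tB : normc t%:C%C <= `|lo| + `|hi|.
  rewrite normc_real; have := ler_norm lo; have := ler_norm hi.
  have := ler_norm (- lo); have := ler_norm (- hi); rewrite !normrN => *.
  by rewrite ler_norml; lra.
have zB : normc z <= B.
  by have := normcD (z - t%:C%C) t%:C%C; rewrite subrK /B; lra.
have tB' : normc t%:C%C <= B by rewrite /B; lra.
apply: (@le_lt_trans _ _ (normc (z - t%:C%C) * S)).
  rewrite horner_coef size_map_poly horner_coef rmorph_sum -sumrB.
  rewrite (le_trans (normc_sum_ord _))// /S mulr_sumr; apply: ler_sum => k _.
  rewrite coef_map /= rmorphM rmorphXn -mulrBr normcM normc_real mulrCA ler_wpM2l//.
  rewrite subrXX normcM ler_wpM2l ?normc_ge0// (le_trans (normc_sum_ord _))//.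
  rewrite mulr_natl -[X in _ *+ X]card_ord -sumr_const; apply: ler_sum => i _.
  rewrite normcM !normcX; apply: (@le_trans _ _ (B ^+ (k.-1 - i) * B ^+ i)).
    by apply: ler_pM; rewrite ?exprn_ge0 ?normc_ge0//; apply: lerXn2r; rewrite ?nnegrE ?normc_ge0.
  rewrite -exprD; apply: ler_weXn2l => //.
  by have ik := ltn_ord i; rewrite subnK ?leq_pred// -ltnS prednK// (leq_ltn_trans _ ik).
rewrite ltr_pdivlMr ?ltr_wpDl// in zd; apply: le_lt_trans zd.
by rewrite ler_wpM2l ?normc_ge0// lerDl.
Qed.

(** Balls of [R[i]] have complex radii, and a positive complex number is real; this passes to real
    radii. *)
Lemma nbhs_normcP (z : R[i]) U :
  nbhs z U <-> exists2 d, 0 < d & forall y, normc (y - z) < d -> U y.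
Proof.
have nE y : `|z - y| = (normc (y - z))%:C%C.
  by rewrite -normc_distC normc_def; case: (z - y).
split=> [/nbhs_ballP[[d d'] /=]|[d d0 dU]].
  rewrite ltcE /= => /andP[/eqP -> d0] dU; exists d => // y yz; apply: dU.
  by rewrite /ball /= nE ltcR.
apply/nbhs_ballP; exists d%:C%C; first by rewrite /= ltcR.
by move=> y; rewrite /ball /= nE ltcR; exact: dU.
Qed.

Lemma continuous_normcP (f : R[i] -> R) z : {for z, continuous f} ->
  forall eps, 0 < eps -> exists2 d, 0 < d &
    forall y, normc (y - z) < d -> `|f y - f z| < eps.
Proof.
move=> /cvgrPdist_lt H eps /H /nbhs_normcP[d d0 Hd].
by exists d => // y yz; rewrite distrC; exact: Hd.
Qed.

(** Compactness of the segment makes the radius uniform in t, while z may leave the real line. *)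
Lemma continuous_near_itv (f : R[i] -> R) (lo hi eps : R) : continuous f -> 0 < eps ->
  exists2 d, 0 < d & forall t z, lo <= t <= hi -> normc (z - t%:C%C) < d ->
    `|f z - f t%:C%C| < eps.
Proof.
move=> cf eps0; have e20 : 0 < eps / 2 by rewrite divr_gt0.
have /compact_near_coveringP := @segment_compact R lo hi.
move=> /(_ R 0^'+ (fun d t => forall z, normc (z - t%:C%C) < d -> `|f z - f t%:C%C| < eps)).
case=> [t _|d /= d0 Hd].
  have [d d0 Hd] := continuous_normcP (cf t%:C%C) e20.
  have d20 : 0 < d / 2 by rewrite divr_gt0.
  exists (ball t (d / 2), [set e | e < d / 2]) => /=.
    by split; [exact: nbhsx_ballx | exact: nbhs_right_lt].
  move=> [t' e] /= [tt' ed] z zt.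
  have tt : normc (t'%:C%C - t%:C%C) < d / 2.
    by rewrite -rmorphB normc_real distrC.
  have H1 := Hd t'%:C%C; have H2 := Hd z.
  have : normc (z - t%:C%C) < d.
    have := normcD (z - t'%:C%C) (t'%:C%C - t%:C%C); rewrite addrA subrK => ?; lra.
  move=> /H2 {}H2; have {}H1 : `|f t'%:C%C - f t%:C%C| < eps / 2 by apply: H1; lra.
  rewrite (_ : _ - _ = (f z - f t%:C%C) - (f t'%:C%C - f t%:C%C)); last by ring.
  by rewrite (le_lt_trans (ler_normB _ _))//; lra.
exists (d / 2); first by rewrite divr_gt0.
move=> t z tI zt; apply: (Hd (d / 2)) => //=.
- by rewrite sub0r normrN gtr0_norm ?divr_gt0// ltr_pdivrMr// ltr_pMr// ltr1n.
- by rewrite divr_gt0.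
Qed.

End NearInterval.

Lemma cvg_sumr (R : realType) (I : Type) (s : seq I) (u : I -> nat -> R) (l : I -> R) :
  (forall i, u i n @[n --> \oo] --> l i) ->
  \sum_(i <- s) u i n @[n --> \oo] --> \sum_(i <- s) l i.
Proof.
move=> ul; elim: s => [|i s IH].
  rewrite big_nil (_ : (fun _ => _) = (fun=> 0)); first exact: cvg_cst.
  by apply/funext => n; rewrite big_nil.
rewrite big_cons (_ : (fun _ => _) = (fun n => u i n + \sum_(i <- s) u i n)).
  exact: cvgD.
by apply/funext => n; rewrite big_cons.
Qed.

Section WeakLimit.
Context {R : realType}.
Import ComplexField.Normc.
Implicit Types s : seq R[i].

Definition avg (f : R[i] -> R) s := (size s)%:R^-1 * \sum_(z <- s) f z.
Definition cavg (f : R[i] -> R[i]) s := (size s)%:R^-1%:C%C * \sum_(z <- s) f z.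

Lemma avg_dist (f g : R[i] -> R) s e : 0 <= e -> (forall z, z \in s -> `|f z - g z| <= e) ->
  `|avg f s - avg g s| <= e.
Proof.
move=> e0 H; rewrite /avg -mulrBr -sumrB normrM ger0_norm ?invr_ge0//.
have [->|s0] := eqVneq (size s) 0%N; first by rewrite invr0 mul0r.
have s1 : 0 < (size s)%:R :> R by rewrite ltr0n lt0n.
rewrite ler_pdivrMl// (le_trans (ler_norm_sum _ _ _))//.
rewrite big_seq (le_trans (ler_sum _ H))// -big_seq big_const_seq count_predT.
by rewrite iter_addr addr0 mulr_natl.
Qed.

Lemma Re_cavg (f : R[i] -> R[i]) s :
  complex.Re (cavg f s) = avg (fun z => complex.Re (f z)) s.
Proof.
rewrite /cavg /avg.
have -> : \sum_(z <- s) complex.Re (f z) = complex.Re (\sum_(z <- s) f z).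
  elim: s => [|z s IH]; first by rewrite !big_nil.
  by rewrite !big_cons IH; case: (f z) => a b; case: (\sum_(_ <- _) _).
by case: (\sum_(_ <- _) _) => a b /=; rewrite mul0r subr0.
Qed.

(** The zeros lie within d of points t of the interval, so f(z) is close to f(t), which is close to
    p(t) by Weierstrass and then to Re p(z). Averages of Re p are combinations of moments. J stays
    abstract and enters through its approximation property on polynomials. *)
Lemma near_real_avg_cvg (Z : nat -> seq R[i]) (lo hi : R) (J : (R -> R) -> R)
    (mom : nat -> R) (f : R[i] -> R) (A : R) :
  lo < hi ->
  (forall d, 0 < d -> exists n0, forall n, (n0 <= n)%N -> forall z, z \in Z n ->
     exists2 t, lo <= t <= hi & normc (z - t%:C%C) < d) ->
  (forall k, normc (cavg (fun z => z ^+ k) (Z n) - (mom k)%:C%C) @[n --> \oo] --> (0 : R)) ->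
  (forall (g : R -> R) (p : {poly R}) e, 0 < e -> {within `[lo, hi], continuous g} ->
     (forall t, lo <= t <= hi -> `|g t - p.[t]| <= e) ->
     `|J g - \sum_(k < size p) p`_k * mom k| <= e) ->
  continuous f -> (forall z, `|f z| <= A) ->
  avg f (Z n) @[n --> \oo] --> J (fun t => f t%:C%C).
Proof.
move=> lh near_lh moms JP cf fA.
apply/cvgrPdist_le => eps eps0.
(* The errors are 4 e for f against Re q at the zeros, e for the moments and 2 e for J against p. *)
pose e := eps / 7; have e0 : 0 < e by rewrite divr_gt0.
have [d d0 Hd] := continuous_near_itv lo hi cf e0.
pose g t := f t%:C%C.
have cg : {within `[lo, hi], continuous g}.
  apply: continuous_subspaceT => t; apply/cvgrPdist_lt => e' e'0.
  have [d' d'0 Hd'] := continuous_normcP (cf t%:C%C) e'0.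
  apply/nbhs_ballP; exists d' => //= t'; rewrite /ball /= => tt'.
  by rewrite distrC; apply: Hd'; rewrite -rmorphB normc_real distrC.
have [||p Hp] := @weierstrass R g lo hi A e lh e0.
- by move=> x _; exact: fA.
- exists d => // x y xI yI xy; apply/ltW/Hd => //.
  by rewrite -rmorphB normc_real.
pose q := map_poly (real_complex R) p.
have [d1 d10 Hd1] := poly_near_itv p lo hi e0.
have d20 : 0 < Num.min d d1 by rewrite lt_min d0 d10.
have [n1 Hn1] := near_lh _ d20.
have Sp : \sum_(k < size p) `|p`_k| * normc (cavg (fun z => z ^+ k) (Z n) - (mom k)%:C%C)
   @[n --> \oo] --> (0 : R).
  rewrite [X in _ --> X](_ : _ = \sum_(k < size p) `|p`_k| * 0); last first.
    by rewrite big1// => k _; rewrite mulr0.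
  by apply: cvg_sumr => k; apply: cvgMl_tmp; exact: moms.
have /cvgrPdist_le /(_ _ e0) [n2 _ Hn2] := Sp.
have JJ := JP g p (2 * e) ltac:(lra) cg Hp.
exists (maxn n1 n2) => // n /=; rewrite geq_max => /andP[n1n n2n].
have T1 : `|avg f (Z n) - avg (fun z => complex.Re q.[z]) (Z n)| <= 4 * e.
  apply: avg_dist; first lra.
  move=> z /(Hn1 _ n1n)[t tI]; rewrite lt_min => /andP[zd zd1].
  have H1 := Hd _ _ tI zd; have H2 := Hd1 _ _ tI zd1; have H3 := Hp _ tI.
  rewrite /g in H3.
  rewrite (_ : f z - _ = (f z - f t%:C%C) + (f t%:C%C - p.[t]) -
      (complex.Re q.[z] - p.[t])); last by ring.
  have {}H2 : `|complex.Re q.[z] - p.[t]| < e.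
    by apply: le_lt_trans H2; rewrite -[X in _ - X]/(complex.Re (_%:C%C)) -ReB Re_le_normc.
  rewrite (le_trans (ler_normB _ _))// (le_trans (lerD (ler_normD _ _) (lexx _)))//.
  lra.
have T2 : `|avg (fun z => complex.Re q.[z]) (Z n) - \sum_(k < size p) p`_k * mom k| <= e.
  rewrite -Re_cavg -[X in _ - X]/(complex.Re (_%:C%C)) -ReB.
  rewrite (le_trans (Re_le_normc _))//.
  have -> : cavg (fun z => q.[z]) (Z n) - (\sum_(k < size p) p`_k * mom k)%:C%C =
    \sum_(k < size p) (p`_k)%:C%C * (cavg (fun z => z ^+ k) (Z n) - (mom k)%:C%C).
    rewrite rmorph_sum (eq_bigr _ (fun _ _ => mulrBr _ _ _)) sumrB; congr (_ - _).
      rewrite /cavg (eq_bigr (fun z => \sum_(k < size p) (p`_k)%:C%C * z ^+ k)).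
        rewrite exchange_big mulr_sumr; apply: eq_bigr => k _.
        by rewrite -mulr_sumr mulrCA.
      by move=> z _; rewrite horner_coef size_map_poly; apply: eq_bigr => k _; rewrite coef_map.
    by apply: eq_bigr => k _; rewrite rmorphM.
  have := Hn2 n n2n; rewrite sub0r normrN ger0_norm.
    apply: le_trans; rewrite (le_trans (normc_sum_ord _))//; apply: ler_sum => k _.
    by rewrite normcM normc_real.
  by apply: sumr_ge0 => k _; rewrite mulr_ge0// normc_ge0.
have -> : J (fun t => f t%:C%C) - avg f (Z n) =
  (J g - \sum_(k < size p) p`_k * mom k) -
  (avg (fun z => complex.Re q.[z]) (Z n) - \sum_(k < size p) p`_k * mom k) -
  (avg f (Z n) - avg (fun z => complex.Re q.[z]) (Z n)) by rewrite /g; ring.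
rewrite (le_trans (ler_normB _ _))// (le_trans (lerD (ler_normB _ _) (lexx _)))//.
rewrite /e in T1 T2 JJ *; lra.
Qed.

End WeakLimit.

(** * Moments from resolvents *)

Section Resolvents.
Context {R : realType}.
Import ComplexField.Normc.
Implicit Types (s : seq R[i]) (f g : R[i] -> R[i]).

Lemma cavg_le f s (e : R) : 0 <= e -> (forall z, z \in s -> normc (f z) <= e) ->
  normc (cavg f s) <= e.
Proof.
move=> e0 H; rewrite /cavg normcM normc_real ger0_norm ?invr_ge0//.
have [->|s0] := eqVneq (size s) 0%N; first by rewrite invr0 mul0r.
have s1 : 0 < (size s)%:R :> R by rewrite ltr0n lt0n.
rewrite ler_pdivrMl// (le_trans (normc_sum _ _))//.
rewrite big_seq (le_trans (ler_sum _ H))// -big_seq big_const_seq count_predT.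
by rewrite iter_addr addr0 mulr_natl.
Qed.

Lemma cavgD f g s : cavg (fun z => f z + g z) s = cavg f s + cavg g s.
Proof. by rewrite /cavg big_split mulrDr. Qed.

Lemma cavgZ (a : R[i]) f s : cavg (fun z => a * f z) s = a * cavg f s.
Proof. by rewrite /cavg -mulr_sumr mulrCA. Qed.

Lemma cavg_sum (I : Type) (r : seq I) (F : I -> R[i] -> R[i]) s :
  cavg (fun z => \sum_(i <- r) F i z) s = \sum_(i <- r) cavg (F i) s.
Proof. by rewrite /cavg exchange_big mulr_sumr. Qed.

Lemma eq_cavg f g s : (forall z, z \in s -> f z = g z) -> cavg f s = cavg g s.
Proof. by move=> H; rewrite /cavg; congr (_ * _); apply: eq_big_seq. Qed.

Definition resolvent (z : R) s := cavg (fun y => (z%:C%C - y)^-1) s.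

Lemma resolvent_expand (z B : R) k s : B < z -> (forall y, y \in s -> normc y <= B) ->
  z%:C%C ^+ k.+1 * resolvent z s =
  z%:C%C ^+ 0 * cavg (fun y => y ^+ k) s
  + \sum_(j < k) z%:C%C ^+ (k - j) * cavg (fun y => y ^+ j) s
  + cavg (fun y => y ^+ k.+1 / (z%:C%C - y)) s.
Proof.
move=> Bz sB; rewrite /resolvent -!cavgZ.
rewrite (eq_bigr (fun j : 'I_k => cavg (fun y => z%:C%C ^+ (k - j) * y ^+ j) s)); last first.
  by move=> j _; rewrite cavgZ.
rewrite -cavg_sum -!cavgD; apply: eq_cavg => y ys.
have zy : z%:C%C - y != 0.
  rewrite -normc_gt0 (lt_le_trans _ (normc_ge_subl _ _))// subr_gt0.
  by rewrite normc_real (le_lt_trans (sB _ ys))// (lt_le_trans Bz)// ler_norm.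
have : z%:C%C ^+ k.+1 = (z%:C%C - y) * (\sum_(j < k) z%:C%C ^+ (k - j) * y ^+ j + y ^+ k) + y ^+ k.+1.
  by have := subrXX z%:C%C y k.+1; rewrite big_ord_recr /= subnn expr0 mul1r => <-; rewrite subrK.
by move=> ->; field.
Qed.

(** Induction on k: after multiplication by z^(k + 1), the resolvent difference and the lower
    moments tend to 0 for fixed z, and the remainder is O(1 / z). So z is chosen first and n
    afterwards. *)
Lemma moments_of_resolvent (Z Y : nat -> seq R[i]) (B : R) : 0 <= B ->
  (exists n0, forall n, (n0 <= n)%N -> forall y, y \in Z n \/ y \in Y n -> normc y <= B) ->
  (forall z, B < z ->
     normc (resolvent z (Z n) - resolvent z (Y n)) @[n --> \oo] --> (0 : R)) ->
  forall k, normc (cavg (fun y => y ^+ k) (Z n) - cavg (fun y => y ^+ k) (Y n))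
     @[n --> \oo] --> (0 : R).
Proof.
move=> B0 [n0 Hn0] res; pose D j n := cavg (fun y => y ^+ j) (Z n) - cavg (fun y => y ^+ j) (Y n).
elim/ltn_ind => k IH; apply/cvgrPdist_le => eps eps0.
(* With this z the remainder B^(k + 1) / (z - B) is at most eps / 4 for each of the two
   sequences. *)
pose z := B + 1 + 4 * B ^+ k.+1 / eps.
have C0 : 0 <= 4 * B ^+ k.+1 / eps by rewrite divr_ge0 ?mulr_ge0 ?exprn_ge0// ltW.
have Bz : B < z by rewrite /z; lra.
have z0 : 0 < z by lra.
pose v n := z ^+ k.+1 * normc (resolvent z (Z n) - resolvent z (Y n)) +
  \sum_(j < k) z ^+ (k - j) * normc (D j n).
have v0 : v n @[n --> \oo] --> (0 : R).
  rewrite (_ : 0 = z ^+ k.+1 * 0 + \sum_(j < k) z ^+ (k - j) * 0); last first.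
    by rewrite mulr0 add0r big1// => j _; rewrite mulr0.
  apply: cvgD; first by apply: cvgMl_tmp; exact: res.
  by apply: cvg_sumr => j; apply: cvgMl_tmp; exact: IH.
have e20 : 0 < eps / 2 by rewrite divr_gt0.
have /cvgrPdist_le /(_ _ e20) [n1 _ Hn1] := v0.
exists (maxn n0 n1) => // n /=; rewrite geq_max => /andP[n0n n1n].
rewrite sub0r normrN ger0_norm ?normc_ge0// -/(D k n).
pose t s := cavg (fun y => y ^+ k.+1 / (z%:C%C - y)) s.
have tB s : (forall y, y \in s -> normc y <= B) -> normc (t s) <= eps / 4.
  move=> sB; apply: cavg_le => [|y ys]; first by rewrite divr_ge0// ltW.
  have yB := sB _ ys; rewrite normcM normcV normcX.
  have zy : z - B <= normc (z%:C%C - y).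
    have := normc_ge_subl z%:C%C y; rewrite normc_real gtr0_norm// => ?; lra.
  rewrite ler_pdivrMr; last by lra.
  apply: (@le_trans _ _ (B ^+ k.+1)); first by apply: lerXn2r => //; rewrite nnegrE normc_ge0.
  apply: (@le_trans _ _ (eps / 4 * (z - B))).
    have -> : eps / 4 * (z - B) = eps / 4 + B ^+ k.+1 by rewrite /z; field; rewrite gt_eqF.
    by rewrite lerDr divr_ge0// ltW.
  by rewrite ler_wpM2l// divr_ge0// ltW.
have HZ : forall y, y \in Z n -> normc y <= B by move=> y yZ; apply: (Hn0 n) => //; left.
have HY : forall y, y \in Y n -> normc y <= B by move=> y yY; apply: (Hn0 n) => //; right.
have EZ := resolvent_expand k Bz HZ; have EY := resolvent_expand k Bz HY.
have -> : D k n = z%:C%C ^+ k.+1 * (resolvent z (Z n) - resolvent z (Y n))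
   - \sum_(j < k) z%:C%C ^+ (k - j) * D j n - (t (Z n) - t (Y n)).
  rewrite mulrBr EZ EY /D (eq_bigr _ (fun _ _ => mulrBr _ _ _)) sumrB /t expr0.
  by ring.
rewrite (le_trans (normcB _ _))// (le_trans (lerD (normcB _ _) (normcB _ _)))//.
have := Hn1 n n1n; rewrite sub0r normrN => H1.
have {}H1 : v n <= eps / 2 by rewrite (le_trans (ler_norm _)).
have TZ := tB _ HZ; have TY := tB _ HY.
apply: (@le_trans _ _ (v n + (eps / 4 + eps / 4))); last lra.
rewrite lerD ?lerD// /v; last first.
  rewrite (le_trans (normc_sum_ord _))//; apply: ler_sum => j _.
  by rewrite normcM normcX normc_real gtr0_norm.
by rewrite normcM normcX normc_real gtr0_norm.
Qed.

(** [d] is 1 for Laguerre and 2 for Hermite; [e] holds the O(1 / n) coefficients of the power sum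
    recurrences. *)
Lemma moment_recursion_limit (d : nat) (mom : nat -> R) (a e : nat -> nat -> R) :
  (0 < d)%N ->
  (forall k, (k < d)%N -> a ^~ k @ \oo --> mom k) ->
  (forall k, mom (k + d)%N = 4^-1 * \sum_(i < k.+1) mom (k - i)%N * mom i) ->
  (forall k, e ^~ k @ \oo --> (0 : R)) ->
  (exists n0, forall n, (n0 <= n)%N -> forall k, a n (k + d)%N =
     e n k * a n k + 4^-1 * \sum_(i < k.+1) a n (k - i)%N * a n i) ->
  forall k, a ^~ k @ \oo --> mom k.
Proof.
move=> d0 base momS e0 [n0 Hn0]; elim/ltn_ind => k IH.
have [/base//|dk] := ltnP k d.
rewrite -(subnK dk); set j := (k - d)%N.
have jk i : (i <= j)%N -> (i < k)%N.
  by move=> ij; rewrite (leq_ltn_trans ij)// /j ltn_subrL d0 (leq_trans d0).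
rewrite momS -[X in _ --> X]add0r -{1}(mul0r (mom j)).
have : (fun n => e n j * a n j + 4^-1 * \sum_(i < j.+1) a n (j - i)%N * a n i) @ \oo -->
   0 * mom j + 4^-1 * \sum_(i < j.+1) mom (j - i)%N * mom i.
  apply: cvgD; first by apply: cvgM; [exact: e0 | exact/IH/jk].
  apply: cvgMl_tmp; apply: cvg_sumr => i; apply: cvgM; apply: IH; apply: jk.
    exact: leq_subr.
  by rewrite -ltnS.
apply: cvg_trans; apply: near_eq_cvg; exists n0 => // n /= n0n.
by rewrite Hn0.
Qed.

End Resolvents.

(** * Zeros of the derivative *)

Section LogDerivatives.
Context {F : fieldType}.
Implicit Types s : seq F.

Definition isum s x n := \sum_(z <- s) (x - z)^-1 ^+ n.

Lemma logder_prod s x : x \notin s ->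
  (\prod_(z <- s) ('X - z%:P))^`().[x] = (\prod_(z <- s) ('X - z%:P)).[x] * isum s x 1.
Proof. exact: deriv_prod_XsubC. Qed.

Lemma logder2_prod s x : x \notin s ->
  (\prod_(z <- s) ('X - z%:P))^`()^`().[x] =
  (\prod_(z <- s) ('X - z%:P)).[x] * (isum s x 1 ^+ 2 - isum s x 2).
Proof.
rewrite /isum; elim: s => [|z s IH].
  by rewrite !big_nil -polyC1 !derivC horner0 expr0n subrr mulr0.
rewrite inE negb_or => /andP[xz xs]; rewrite !big_cons.
rewrite derivM derivXsubC mul1r derivD derivM derivXsubC mul1r.
rewrite !hornerD !hornerM IH// logder_prod// hornerXsubC /isum.
by field; rewrite subr_eq0.
Qed.

End LogDerivatives.

Section DerivativeZeros.
Context {R : realType}.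
Import ComplexField.Normc.
Implicit Types s : seq R[i].

Lemma notin_prod_far s (x : R[i]) : (forall z, z \in s -> x - z != 0) -> x \notin s.
Proof. by move=> H; apply/negP => /H; rewrite subrr eqxx. Qed.

(** A quantitative Gauss-Lucas theorem: seen from a point w at distance at least eps from the
    interval, the interval lies in a half plane with margin kap |w| >= kap eps. Zeros within that
    margin of it stay in the half plane, so the sum of 1 / (w - z) cannot vanish. *)
Lemma gauss_lucas_near (lo hi eps : R) : lo <= 0 -> 0 <= hi -> 0 < eps ->
  exists2 d, 0 < d & forall s, (0 < size s)%N ->
   (forall z, z \in s -> exists2 t, lo <= t <= hi & normc (z - t%:C%C) < d) ->
   forall w, root (\prod_(z <- s) ('X - z%:P))^`() w ->
   exists2 t, lo <= t <= hi & normc (w - t%:C%C) < eps.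
Proof.
move=> lo0 hi0 eps0; pose B := hi - lo + eps; pose kap := (1 + 2 * B / eps)^-1.
have B0 : 0 <= B by rewrite /B; lra.
have kp : 0 < kap by rewrite invr_gt0 ltr_pwDl// divr_ge0 ?mulr_ge0// ltW.
exists (kap * eps) => [|s s0 sd w]; first exact: mulr_gt0.
apply: contraPP => wfar.
have {}wfar t : lo <= t <= hi -> eps <= normc (w - t%:C%C).
  by move=> tI; rewrite leNgt; apply/negP => wt; apply: wfar; exists t.
have [[u [u1 Hu]] weps] := separated_interval lo0 hi0 eps0 ltr01 wfar.
rewrite mul1r mulr1 in Hu weps; rewrite -/B -/kap in Hu.
have dpos z : z \in s -> 0 < dotc u (w - z).
  move=> /sd[t tI zt]; have [|H _] := Hu t; first by rewrite divr1; lra.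
  have := dotc_le (t%:C%C - z) (_ : normc (- u) = 1); rewrite normcN => /(_ u1) G.
  have E : dotc u (w - z) = dotc u (w - t%:C%C) - dotc (- u) (t%:C%C - z).
    by case: (w) => ? ?; case: (z) => ? ?; case: (u) => ? ?; rewrite /dotc /=; ring.
  rewrite E subr_gt0 (le_lt_trans G)// normc_distC (lt_le_trans zt)//.
  by rewrite (le_trans _ H)// ler_wpM2l ?(ltW kp).
have wz z : z \in s -> w - z != 0.
  move=> /dpos; apply: contraTneq => ->; rewrite /dotc /= !mulr0 addr0 ltxx//.
have ws := notin_prod_far wz.
apply/negP; rewrite /root logder_prod// mulf_eq0 negb_or.
apply/andP; split.
  by have := root_prod_XsubC s w; rewrite /root => ->.
apply: contraTneq isT => S0.
have : dotc u^*%C (isum s w 1) = 0 by rewrite S0 /dotc /= !mulr0 addr0.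
rewrite /isum dotc_sum => /eqP; rewrite gt_eqF//.
case: s s0 sd dpos wz ws S0 => // z s _ _ dpos wz _ _; rewrite big_cons ltr_pwDl//.
  rewrite expr1 dotcV divr_gt0 ?dpos ?mem_head// exprn_gt0// normc_gt0 wz//.
  exact: mem_head.
rewrite big_seq; apply: sumr_ge0 => y ys; rewrite expr1 dotcV divr_ge0 ?sqr_ge0//.
by rewrite ltW// dpos// inE ys orbT.
Qed.

Lemma resolventE z s : resolvent z s = (size s)%:R^-1%:C%C * isum s z%:C%C 1.
Proof. by []. Qed.

(** With S1 and S2 the sums of (x - y)^-1 and (x - y)^-2 over [s], p' / p = S1 and p'' / p' = S1 -
    S2 / S1. The two summands of the bound come from (1 / (n - 1) - 1 / n) S1 and from S2 / S1
    divided by n - 1. The latter needs S1 to be of order n, which holds because the real parts of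
    its terms are bounded below by a positive constant. *)
Lemma resolvent_deriv (z B : R) s s' (c : R[i]) : 0 <= B -> B < z -> c != 0 ->
  (1 < size s)%N -> size s' = (size s).-1 ->
  (forall y, y \in s -> normc y <= B) -> (forall y, y \in s' -> normc y <= B) ->
  (\prod_(y <- s) ('X - y%:P))^`() = c *: \prod_(y <- s') ('X - y%:P) ->
  normc (resolvent z s' - resolvent z s) <=
   ((z - B)^-1 + (z + B) ^+ 2 / (z - B) ^+ 3) / (size s).-1%:R.
Proof.
move=> B0 Bz c0 s1 ss' sB s'B ders.
have zB0 : 0 < z - B by rewrite subr_gt0.
have zB1 : 0 < z + B by lra.
have z0 : 0 < z by lra.
pose x : R[i] := z%:C%C.
have far y : normc y <= B -> z - B <= normc (x - y) <= z + B.
  move=> yB; have := normc_ge_subl x y; have := normcB x y.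
  by rewrite normc_real gtr0_norm// => *; lra.
have neq y : normc y <= B -> x - y != 0.
  by move=> /far/andP[H _]; rewrite -normc_gt0; lra.
have xs : x \notin s by apply: notin_prod_far => y /sB/neq.
have xs' : x \notin s' by apply: notin_prod_far => y /s'B/neq.
set n := size s in s1 ss' *.
have n0 : 0 < n%:R :> R by rewrite ltr0n; lia.
have n10 : 0 < n.-1%:R :> R by rewrite ltr0n; lia.
have nE : n%:R = n.-1%:R + 1 :> R by rewrite natr1 prednK//; lia.
set p := \prod_(y <- s) ('X - y%:P) in ders.
have px : p.[x] != 0 by have := root_prod_XsubC s x; rewrite /root => ->.
set S1 := isum s x 1; set S2 := isum s x 2.
have S1le : normc S1 <= n%:R / (z - B).
  rewrite /S1 /isum (le_trans (normc_sum _ _))//.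
  rewrite big_seq (@le_trans _ _ (\sum_(y <- s | y \in s) (z - B)^-1))//.
    apply: ler_sum => y ys; rewrite expr1 normcV lef_pV2 ?posrE//.
      by case/andP: (far _ (sB _ ys)).
    by rewrite normc_gt0 neq ?sB.
  by rewrite -big_seq big_const_seq count_predT iter_addr addr0 mulr_natl.
have S2le : normc S2 <= n%:R / (z - B) ^+ 2.
  rewrite /S2 /isum (le_trans (normc_sum _ _))//.
  rewrite big_seq (@le_trans _ _ (\sum_(y <- s | y \in s) ((z - B) ^+ 2)^-1))//.
    apply: ler_sum => y ys; have /andP[H _] := far _ (sB _ ys).
    rewrite normcX normcV exprVn lef_pV2 ?posrE ?exprn_gt0//; last by rewrite normc_gt0 neq ?sB.
    by apply: lerXn2r; rewrite ?nnegrE ?normc_ge0// ltW.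
  by rewrite -big_seq big_const_seq count_predT iter_addr addr0 mulr_natl.
have S1ge : n%:R * ((z - B) / (z + B) ^+ 2) <= normc S1.
  apply: le_trans (Re_le_normc _); apply: le_trans (ler_norm _).
  have -> : complex.Re S1 = \sum_(y <- s) complex.Re ((x - y)^-1 ^+ 1).
    rewrite /S1 /isum; elim: (s) => [|y r IH]; first by rewrite !big_nil.
    rewrite !big_cons -IH; case: (_ ^+ 1) => ? ?; case: (\sum_(_ <- _) _) => ? ?//.
  have -> : n%:R * ((z - B) / (z + B) ^+ 2) = \sum_(y <- s) (z - B) / (z + B) ^+ 2.
    by rewrite big_const_seq count_predT iter_addr addr0 mulr_natl.
  rewrite big_seq [leRHS]big_seq; apply: ler_sum => y ys.
  have /andP[H1 H2] := far _ (sB _ ys); have n1 : 0 < normc (x - y) by lra.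
  have -> : complex.Re ((x - y)^-1 ^+ 1) = dotc 1 (x - y) / normc (x - y) ^+ 2.
    have {1}-> : (x - y)^-1 ^+ 1 = (x - y)^-1 by rewrite expr1.
    rewrite -dotcV /dotc /= mul1r oppr0 mul0r addr0//.
  rewrite ler_pdivrMr ?exprn_gt0// mulrAC ler_pdivlMr ?exprn_gt0//.
  apply: ler_pM.
  - exact: ltW.
  - by rewrite exprn_ge0// ltW.
  - rewrite /dotc /= mul1r mul0r addr0.
    have := Re_le_normc y; rewrite ler_norml => /andP[_ G].
    by case: (y) (sB _ ys) G => a1 b1 /= *; lra.
  - by apply: lerXn2r; rewrite ?nnegrE ?normc_ge0// ltW.
have S1gt : 0 < normc S1.
  by apply: lt_le_trans S1ge; rewrite mulr_gt0// divr_gt0// exprn_gt0.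
have S10 : S1 != 0 by rewrite -normc_gt0.
have logs' : isum s' x 1 = S1 - S2 / S1.
  have H1 : p^`().[x] = p.[x] * S1 by rewrite /p logder_prod.
  have H2 : p^`()^`().[x] = p.[x] * (S1 ^+ 2 - S2) by rewrite /p logder2_prod.
  have H3 : p^`()^`().[x] = p^`().[x] * isum s' x 1.
    by rewrite ders derivZ !hornerZ logder_prod// mulrA.
  apply: (mulfI (_ : p.[x] * S1 != 0)); first by rewrite mulf_neq0.
  by rewrite -{1}H1 -H3 H2; field.
rewrite !resolventE ss' -/n -/x -/S1 logs'.
have -> : (n.-1%:R^-1)%:C%C * (S1 - S2 / S1) - (n%:R^-1)%:C%C * S1 =
  (n.-1%:R^-1 - n%:R^-1)%:C%C * S1 - (n.-1%:R^-1)%:C%C * (S2 / S1).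
  by rewrite rmorphB; ring.
rewrite (le_trans (normcB _ _))// mulrDl lerD//.
  rewrite normcM normc_real.
  have -> : n.-1%:R^-1 - n%:R^-1 = (n%:R * n.-1%:R)^-1 :> R.
    by rewrite nE; field; rewrite -nE !gt_eqF.
  rewrite ger0_norm ?invr_ge0 ?mulr_ge0//.
  apply: (@le_trans _ _ ((n%:R * n.-1%:R)^-1 * (n%:R / (z - B)))).
    by rewrite ler_wpM2l// invr_ge0 mulr_ge0.
  by rewrite le_eqVlt; apply/orP; left; apply/eqP; field; rewrite !gt_eqF.
rewrite normcM normc_real ger0_norm ?invr_ge0// mulrC ler_wpM2r ?invr_ge0//.
rewrite normcM normcV ler_pdivrMr// (le_trans S2le)//.
apply: le_trans (_ : (z + B) ^+ 2 / (z - B) ^+ 3 * (n%:R * ((z - B) / (z + B) ^+ 2)) <= _).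
  by rewrite le_eqVlt; apply/orP; left; apply/eqP; field; rewrite !gt_eqF.
by rewrite ler_wpM2l// divr_ge0 ?exprn_ge0// ltW.
Qed.

End DerivativeZeros.

Section Zeros.
Context {R : realType}.
Implicit Types p : {poly R[i]}.

Lemma zerosE p : p = lead_coef p *: \prod_(z <- zeros p) ('X - z%:P).
Proof. by rewrite /zeros; case: closed_field_poly_normal. Qed.

Lemma mem_zeros p z : p != 0 -> (z \in zeros p) = root p z.
Proof.
by move=> p0; rewrite [in RHS](zerosE p) rootZ ?lead_coef_eq0// root_prod_XsubC.
Qed.

Lemma size_zeros_poly p : p != 0 -> size (zeros p) = (size p).-1.
Proof.
move=> p0; rewrite [in RHS](zerosE p) size_scale ?lead_coef_eq0//.
by rewrite size_prod_XsubC.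
Qed.

Lemma logder_zeros p z : p != 0 -> p.[z] != 0 ->
  p^`().[z] / p.[z] = isum (zeros p) z 1.
Proof.
move=> p0 pz; have zs : z \notin zeros p by rewrite mem_zeros.
have l0 : lead_coef p != 0 by rewrite lead_coef_eq0.
have -> : p^`().[z] = p.[z] * isum (zeros p) z 1.
  by rewrite {1 2}(zerosE p) derivZ !hornerZ logder_prod// mulrA.
by rewrite mulrC mulKf.
Qed.

End Zeros.

Section QpertSize.
Context {R : rcfType} (E M : {scalar {poly R}}) (L P : nat -> {poly R}).
Context (posE : posdef E) (opsL : orthopoly E L) (opsP : orthopoly M P).

Lemma size_Qpert m n : (m < n)%N -> size (Qpert E L P m n) = n.+1.
Proof.
move=> mn; rewrite /Qpert big_ord_recl subn0.
have -> : conn E L P n n = 1.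
  have H : E (P n * L n) = E (L n * L n).
    by rewrite mulrC (ops_lead opsL) ?(ops_size opsP)// (ops_coefn opsP) mul1r.
  by rewrite /conn H divff// gt_eqF// (ops_norm_gt0 posE opsL).
have n0 : (0 < n)%N by exact: leq_ltn_trans mn.
rewrite mulr1 divff ?pnatr_eq0 -?lt0n// scale1r size_polyDl (ops_size opsL)//.
rewrite ltnS; elim/big_ind: _ => [|p q sp sq|k _]; first by rewrite size_poly0.
  by rewrite (leq_trans (size_polyD _ _))// geq_max sp sq.
rewrite (leq_trans (size_scale_leq _ _))// (ops_size opsL) /bump /=.
by rewrite ltn_subrL n0.
Qed.

End QpertSize.

(** * Location and limit moments of the scaled zeros *)

Section ScaledZeros.
Context {R : realType} (E M : {scalar {poly R}}) (L P : nat -> {poly R}).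
Context (posE : posdef E) (opsL : orthopoly E L).
Context (posM : posdef M) (opsP : orthopoly M P).
Context (rho : {poly R}) (m : nat) (srho : size rho = m.+1).
Context (EM : forall p, E p = M (rho * p)).
Context (c : nat -> R) (lo hi : R) (lo0 : lo <= 0) (hi0 : 0 <= hi).
Context (c_large : forall A : R, exists n0, forall n, (n0 <= n)%N -> A <= c n).
Context (zeros_near : forall (eps : R) r, 0 < eps -> exists n0, forall n, (n0 <= n)%N ->
  forall N y, (N <= n + r)%N -> root (L N) y || root (P N) y ->
  lo - eps <= y / c n <= hi + eps).
Context (norm_growth : exists kap : R, [/\ 0 < kap, kap <= 1 & exists n0,
  forall n, (n0 <= n)%N -> forall j, (n - m <= j < n + m)%N ->
  kap * c n ^+ 2 * E (L j * L j) <= E (L j.+1 * L j.+1)]).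
Context (mom : nat -> R).
Context (mom_cvg : forall s : nat -> seq R,
  (forall n, L n = \prod_(y <- s n) ('X - y%:P)) ->
  forall k, psum (s n) k / (n%:R * c n ^+ k) @[n --> \oo] --> mom k).
Import ComplexField.Normc.
Local Notation toC := (map_poly (real_complex R)).

Definition Qscaled n : {poly R[i]} :=
  toC ((c n ^+ n)^-1 *: (Qpert E L P m n \Po (c n *: 'X))).

Let asymp := Qpert_asymptotics posE opsL posM opsP srho EM lo0 hi0 c_large zeros_near norm_growth.

Lemma horner_Qscaled n z :
  (Qscaled n).[z] = ((c n ^+ n)^-1)%:C%C * (toC (Qpert E L P m n)).[(c n)%:C%C * z].
Proof.
by rewrite /Qscaled map_polyZ map_comp_poly hornerZ horner_comp map_polyZ map_polyX hornerZ hornerX.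
Qed.

Lemma horner_deriv_Qscaled n z : (Qscaled n)^`().[z] =
  ((c n ^+ n)^-1)%:C%C * ((c n)%:C%C * (toC (Qpert E L P m n)^`()).[(c n)%:C%C * z]).
Proof.
rewrite /Qscaled deriv_map derivZ deriv_comp derivZ derivX map_polyZ rmorphM /=.
rewrite map_comp_poly hornerZ hornerM horner_comp !map_polyZ map_polyX hornerZ hornerX.
by rewrite rmorph1 hornerZ hornerC mulr1 [_ * (c n)%:C%C]mulrC.
Qed.

Lemma size_Qscaled n : (m < n)%N -> 0 < c n -> size (Qscaled n) = n.+1.
Proof.
move=> mn c0; rewrite /Qscaled size_map_poly size_scale ?invr_neq0 ?expf_neq0 ?gt_eqF//.
rewrite size_comp_poly2 ?(size_Qpert posE opsL opsP mn)//.
by rewrite size_scale ?gt_eqF// size_polyX.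
Qed.

Lemma Qscaled_neq0 n : (m < n)%N -> 0 < c n -> Qscaled n != 0.
Proof. by move=> mn c0; rewrite -size_poly_eq0 size_Qscaled. Qed.

Lemma size_deriv_Qscaled n : (m < n)%N -> 0 < c n -> size (Qscaled n)^`() = n.
Proof.
move=> mn c0; have n0 : (0 < n)%N by exact: leq_ltn_trans mn.
apply/eqP; rewrite eqn_leq; apply/andP; split.
  by rewrite -ltnS -(size_Qscaled mn c0) lt_size_deriv ?Qscaled_neq0.
have : (Qscaled n)^`()`_n.-1 != 0.
  rewrite coef_deriv prednK// mulrn_eq0 negb_or -lt0n n0 /=.
  have := Qscaled_neq0 mn c0; rewrite -lead_coef_eq0 lead_coefE size_Qscaled//.
by apply: contraNT; rewrite -ltnNge => h; rewrite nth_default// -ltnS prednK.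
Qed.

Lemma deriv_Qscaled_neq0 n : (m < n)%N -> 0 < c n -> (Qscaled n)^`() != 0.
Proof.
move=> mn c0; rewrite -size_poly_eq0 size_deriv_Qscaled// -lt0n.
exact: leq_ltn_trans mn.
Qed.

Lemma zeros_Qscaled_near (d : R) : 0 < d -> exists n0, forall n, (n0 <= n)%N ->
  forall z, z \in zeros (Qscaled n) -> exists2 t, lo <= t <= hi & normc (z - t%:C%C) < d.
Proof.
move=> d0; have [C [n0 [C0 Hn0]]] := asymp d0.
exists (maxn n0 m.+1) => n; rewrite geq_max => /andP[n0n mn] z.
have [c0 H] := Hn0 _ n0n.
rewrite mem_zeros ?Qscaled_neq0//; apply: contraPP => zfar.
have [|Q0 _ _] := H z.
  by move=> t tI; rewrite leNgt; apply/negP => zt; apply: zfar; exists t.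
rewrite /root horner_Qscaled; apply/negP; rewrite mulf_neq0//.
by rewrite (fmorph_eq0 (real_complex R)) invr_eq0 expf_neq0// gt_eqF.
Qed.

Lemma c_gt0 : exists n0, forall n, (n0 <= n)%N -> 0 < c n.
Proof. by have [n0 H] := c_large 1; exists n0 => n /H; apply: lt_le_trans. Qed.

Lemma zeros_deriv_Qscaled_near (d : R) : 0 < d -> exists n0, forall n, (n0 <= n)%N ->
  forall z, z \in zeros (Qscaled n)^`() -> exists2 t, lo <= t <= hi & normc (z - t%:C%C) < d.
Proof.
move=> d0; have [e e0 GL] := gauss_lucas_near lo0 hi0 d0.
have [n0 Hn0] := zeros_Qscaled_near e0; have [n1 Hn1] := c_gt0.
exists (maxn (maxn n0 n1) m.+1) => n; rewrite !geq_max => /andP[/andP[n0n n1n] mn] w.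
have c0 := Hn1 _ n1n.
rewrite mem_zeros ?deriv_Qscaled_neq0// => rw.
apply: (GL _ _ (Hn0 _ n0n)).
  by rewrite size_zeros_poly ?Qscaled_neq0// size_Qscaled// (leq_ltn_trans _ mn).
move: rw; rewrite {1}(zerosE (Qscaled n)) derivZ rootZ//.
by rewrite lead_coef_eq0 Qscaled_neq0.
Qed.

Let Bd := hi - lo + 1.

Lemma near_bounded (z : R[i]) :
  (exists2 t, lo <= t <= hi & normc (z - t%:C%C) < 1) -> normc z <= Bd.
Proof.
have loN := lo0; have hiP := hi0.
case=> t tI zt; have := normcD (z - t%:C%C) t%:C%C; rewrite subrK normc_real => H.
have : `|t| <= hi - lo by rewrite ler_norml; lra.
by rewrite /Bd; lra.
Qed.

(** At real z beyond [Bd] the resolvents of the scaled Qhat and of the scaled L n are c_n / n times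
    their logarithmic derivatives at x = c_n z. They differ by at most c_n C / (n |x|) = C / (n z),
    so the moments have the same limit, and it is known for L n. *)
Lemma zeros_Qscaled_moment k :
  normc (cavg (fun z => z ^+ k) (zeros (Qscaled n)) - (mom k)%:C%C) @[n --> \oo] --> (0 : R).
Proof.
have loN := lo0; have hiP := hi0.
pose s n := sval (cid (ops_splits posE opsL n)).
have Ls n : L n = \prod_(y <- s n) ('X - y%:P) := svalP (cid (ops_splits posE opsL n)).
pose Y n := [seq (y / c n)%:C%C | y <- s n].
have ss n : size (s n) = n := size_zeros opsL (Ls n).
have YE n i : cavg (fun z => z ^+ i) (Y n) = (psum (s n) i / (n%:R * c n ^+ i))%:C%C.
  rewrite /cavg /Y size_map ss big_map /psum.
  rewrite (eq_bigr (fun y => (y ^+ i * (c n ^+ i)^-1)%:C%C)) => [|y _]; last first.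
    by rewrite -rmorphXn exprMn exprVn.
  by rewrite -rmorph_sum -rmorphM /= -mulr_suml invfM; congr (_%:C)%C; ring.
have D : normc (cavg (fun z => z ^+ k) (zeros (Qscaled n)) - cavg (fun z => z ^+ k) (Y n))
    @[n --> \oo] --> (0 : R).
  have Bd0 : 0 <= Bd by rewrite /Bd; lra.
  apply: (moments_of_resolvent Bd0) => [|z Bz].
    have [n0 Hn0] := zeros_Qscaled_near ltr01.
    have [n1 Hn1] := zeros_near 0 ltr01.
    exists (maxn n0 n1) => n; rewrite geq_max => /andP[n0n n1n] y [yZ|/mapP[x xs ->]].
      exact/near_bounded/(Hn0 n).
    have := Hn1 _ n1n n x; rewrite addn0 leqnn (root_ops (Ls n)) xs => /(_ isT isT) xI.
    by rewrite normc_real ler_norml /Bd; lra.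
  have [C [n0 [C0 Hn0]]] := asymp ltr01.
  have z0 : 0 < z by rewrite (le_lt_trans _ Bz).
  apply/cvgrPdist_le => eps eps0.
  have [n1 Hn1] : exists n1, forall n, (n1 <= n)%N -> C / z / eps <= n%:R.
    exists (Num.bound (C / z / eps)) => n nn; apply/ltW.
    have A0 : 0 <= C / z / eps by rewrite !divr_ge0// ltW.
    by apply: (lt_le_trans (archi_boundP A0)); rewrite ler_nat.
  exists (maxn (maxn n0 n1) m.+1) => // n /=.
  rewrite !geq_max => /andP[/andP[n0n n1n] mn].
  have n0' : 0 < n%:R :> R by rewrite ltr0n (leq_ltn_trans _ mn).
  have [c0 H] := Hn0 _ n0n.
  have [|Q0 L0 B] := H z%:C%C.
    move=> t tI; rewrite -rmorphB normc_real (le_trans _ (ler_norm _))//.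
    by move: Bz; rewrite /Bd; lra.
  set x := (c n)%:C%C * z%:C%C in Q0 L0 B.
  have cC : (c n)%:C%C != 0 by rewrite (fmorph_eq0 (real_complex R)) gt_eqF.
  have cnC : ((c n ^+ n)^-1)%:C%C != 0 :> R[i].
    by rewrite (fmorph_eq0 (real_complex R)) invr_eq0 expf_neq0// gt_eqF.
  rewrite sub0r normrN ger0_norm ?normc_ge0// !resolventE size_zeros_poly ?Qscaled_neq0//.
  rewrite size_Qscaled// /Y size_map ss -mulrBr normcM normc_real ger0_norm ?invr_ge0//.
  have -> : isum (zeros (Qscaled n)) z%:C%C 1 =
      (c n)%:C%C * ((toC (Qpert E L P m n)^`()).[x] / (toC (Qpert E L P m n)).[x]).
    rewrite -logder_zeros ?Qscaled_neq0//; last by rewrite horner_Qscaled mulf_neq0.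
    rewrite horner_Qscaled horner_deriv_Qscaled -/x.
    by rewrite -mulf_div divff// mul1r mulrA.
  have -> : isum [seq (y / c n)%:C%C | y <- s n] z%:C%C 1 =
      (c n)%:C%C * ((toC (L n)^`()).[x] / (toC (L n)).[x]).
    have LC : toC (L n) = \prod_(y <- map (real_complex R) (s n)) ('X - y%:P).
      by rewrite Ls map_prod_XsubC big_map.
    have xs : x \notin map (real_complex R) (s n).
      by move: L0; rewrite LC -/(root _ _) root_prod_XsubC.
    rewrite -deriv_map LC logder_prod// [X in X / _]mulrC mulfK; last first.
      by rewrite -LC.
    rewrite /isum !big_map mulr_sumr; apply: eq_big_seq => y ys; rewrite !expr1.
    have xy : x - y%:C%C != 0.
      by apply: contraNneq xs => /eqP; rewrite subr_eq0 => /eqP ->; apply: map_f.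
    rewrite rmorphM fmorphV /= /x; field.
    rewrite cC /=; apply/andP; split; last by rewrite -/x.
    by [].
  rewrite -mulrBr normcM normc_real gtr0_norm//.
  rewrite ler_pdivrMl//.
  apply: (@le_trans _ _ (c n * (C / normc x))); first by rewrite ler_pM2l.
  have -> : c n * (C / normc x) = C / z.
    by rewrite /x normcM !normc_real !gtr0_norm//; field; rewrite !gt_eqF.
  by have := Hn1 _ n1n; rewrite ler_pdivrMr.
have Mk := @mom_cvg s Ls k.
apply/cvgrPdist_le => eps eps0; have e20 : 0 < eps / 2 by rewrite divr_gt0.
have /cvgrPdist_le /(_ _ e20) [n1 _ H1] := D.
have /cvgrPdist_le /(_ _ e20) [n2 _ H2] := Mk.
exists (maxn n1 n2) => // n /=; rewrite geq_max => /andP[n1n n2n].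
have := H1 _ n1n; have := H2 _ n2n; rewrite /= !sub0r !normrN => {}H2 {}H1.
rewrite (ger0_norm (normc_ge0 _)) in H1; rewrite (ger0_norm (normc_ge0 _)).
rewrite -[X in normc X](subrKA (cavg (fun z => z ^+ k) (Y n))).
rewrite (le_trans (normcD _ _))// YE -rmorphB normc_real.
rewrite YE in H1; rewrite distrC in H2; lra.
Qed.

(** The same comparison of resolvents, now with the zeros of Qscaled itself and with
    [resolvent_deriv] as the estimate. *)
Lemma zeros_deriv_Qscaled_moment k :
  normc (cavg (fun z => z ^+ k) (zeros (Qscaled n)^`()) - (mom k)%:C%C) @[n --> \oo] --> (0 : R).
Proof.
have loN := lo0; have hiP := hi0.
have D : normc (cavg (fun z => z ^+ k) (zeros (Qscaled n)^`()) -
    cavg (fun z => z ^+ k) (zeros (Qscaled n))) @[n --> \oo] --> (0 : R).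
  have Bd0 : 0 <= Bd by rewrite /Bd; lra.
  have [n0 Hn0] := zeros_Qscaled_near ltr01.
  have [n1 Hn1] := zeros_deriv_Qscaled_near ltr01.
  apply: (moments_of_resolvent Bd0) => [|z Bz].
    exists (maxn n0 n1) => n; rewrite geq_max => /andP[n0n n1n] y [yZ|yZ].
      exact/near_bounded/(Hn1 n).
    exact/near_bounded/(Hn0 n).
  have z0 : 0 < z by rewrite (le_lt_trans _ Bz).
  apply/cvgrPdist_le => eps eps0.
  pose C := (z - Bd)^-1 + (z + Bd) ^+ 2 / (z - Bd) ^+ 3.
  have C0 : 0 <= C.
    have zB : 0 <= z - Bd by rewrite subr_ge0 ltW.
    by rewrite addr_ge0 ?invr_ge0// divr_ge0 ?exprn_ge0// addr_ge0// ltW.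
  have [n2 Hn2] : exists n1, forall n, (n1 <= n)%N -> C / eps <= n.-1%:R.
    exists (Num.bound (C / eps)).+1 => n nn; apply/ltW.
    have A0 : 0 <= C / eps by rewrite !divr_ge0// ltW.
    apply: (lt_le_trans (archi_boundP A0)); rewrite ler_nat.
    by rewrite -ltnS (ltn_predK nn).
  have [n3 Hn3] := c_gt0.
  exists (maxn (maxn (maxn n0 n1) (maxn n2 n3)) m.+2) => // n /=.
  rewrite !geq_max => /andP[/andP[/andP[n0n n1n] /andP[n2n n3n]] mn].
  have c0 := Hn3 _ n3n; have mn' : (m < n)%N by rewrite ltnW.
  have n1' : (1 < n)%N by rewrite (leq_trans _ mn).
  have n0' : 0 < n.-1%:R :> R by rewrite ltr0n -subn1 subn_gt0.
  rewrite sub0r normrN ger0_norm ?normc_ge0//.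
  have q0 := Qscaled_neq0 mn' c0; have dq0 := deriv_Qscaled_neq0 mn' c0.
  have sz : size (zeros (Qscaled n)) = n by rewrite size_zeros_poly// size_Qscaled.
  have sz' : size (zeros (Qscaled n)^`()) = n.-1.
    by rewrite size_zeros_poly// size_deriv_Qscaled.
  pose l := lead_coef (Qscaled n); have l0 : l != 0 by rewrite lead_coef_eq0.
  pose l' := lead_coef (Qscaled n)^`(); have l'0 : l' != 0 by rewrite lead_coef_eq0.
  have cl : l' / l != 0 by rewrite mulf_neq0 ?invr_neq0.
  apply: (le_trans (resolvent_deriv Bd0 Bz cl _ _ _ _ _)) => //.
  - by rewrite sz.
  - by rewrite sz sz'.
  - by move=> y yZ; exact/near_bounded/(Hn0 n).
  - by move=> y yZ; exact/near_bounded/(Hn1 n).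
  - have := zerosE (Qscaled n)^`(); rewrite {1}(zerosE (Qscaled n)) derivZ -/l -/l'.
    move=> /(congr1 (fun p => l^-1 *: p)); rewrite !scalerA mulVf// scale1r => ->.
    by rewrite mulrC.
  rewrite sz -/C ler_pdivrMr// mulrC -ler_pdivrMr//.
  exact: Hn2.
have Mk := zeros_Qscaled_moment k.
apply/cvgrPdist_le => eps eps0; have e20 : 0 < eps / 2 by rewrite divr_gt0.
have /cvgrPdist_le /(_ _ e20) [n1 _ H1] := D.
have /cvgrPdist_le /(_ _ e20) [n2 _ H2] := Mk.
exists (maxn n1 n2) => // n /=; rewrite geq_max => /andP[n1n n2n].
have := H1 _ n1n; have := H2 _ n2n; rewrite /= !sub0r !normrN => {}H2 {}H1.
rewrite !(ger0_norm (normc_ge0 _)) in H1 H2 *.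
rewrite -[X in normc X](subrKA (cavg (fun z => z ^+ k) (zeros (Qscaled n)))).
by rewrite (le_trans (normcD _ _))//; lra.
Qed.

End ScaledZeros.

(** * Integrals with a density *)

Section Density.
Local Open Scope ereal_scope.
Context d (T : measurableType d) (R : realType).
Context (mu nu : {measure set T -> \bar R}) (h : T -> R).
Context (mh : measurable_fun [set: T] h) (h0 : forall x, (0 <= h x)%R).
Context (nuE : forall A, measurable A -> nu A = \int[mu]_(x in A) (h x)%:E).

Import HBNNSimple.

(** The density is known through the values of nu on sets; simple functions and monotone convergence
    pass from sets to functions. *)
Lemma ge0_integral_density (f : T -> \bar R) : measurable_fun [set: T] f ->
  (forall x, 0 <= f x) -> \int[nu]_x f x = \int[mu]_x (f x * (h x)%:E).
Proof.
move=> mf f0; pose f_ := nnsfun_approx measurableT mf.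
have f_cvg x : (EFin \o f_ ^~ x) @ \oo --> f x by exact: cvg_nnsfun_approx.
have f_nd x : {homo (fun n => (f_ n x)%:E) : m n / (m <= n)%N >-> m <= n}.
  by move=> m n mn; rewrite lee_fin; exact/lefP/nd_nnsfun_approx.
transitivity (limn (fun n => \int[nu]_x (f_ n x)%:E)).
  rewrite -monotone_convergence//.
  - by apply: eq_integral => x _; apply/esym/cvg_lim => //; exact: f_cvg.
  - by move=> n; exact/measurable_EFinP/measurable_funTS.
  - by move=> n x _; rewrite lee_fin.
transitivity (limn (fun n => \int[mu]_x ((f_ n x)%:E * (h x)%:E))).
  congr (limn _); apply/funext => n.
  under eq_integral do rewrite fimfunE -fsumEFin//.
  rewrite ge0_integral_fsum//; last 2 first.
    by move=> r; exact/measurable_EFinP/measurableT_comp.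
    by move=> r x _; rewrite nnfun_muleindic_ge0.
  have E x : (f_ n x)%:E * (h x)%:E =
      \sum_(k \in range (f_ n)) ((k * \1_(f_ n @^-1` [set k]) x)%:E * (h x)%:E).
    rewrite -ge0_mule_fsuml => [|y]; last exact: nnfun_muleindic_ge0.
    by rewrite fsumEFin// -fimfunE.
  under [RHS]eq_integral do rewrite E.
  rewrite [RHS]ge0_integral_fsum//; last 2 first.
    move=> r; apply: emeasurable_funM; last exact/measurable_EFinP.
    exact/measurable_EFinP/measurableT_comp.
    by move=> r x _; apply: mule_ge0; [exact: nnfun_muleindic_ge0 | rewrite lee_fin].
  apply: eq_fsbigr => r _; rewrite integralZl_indic_nnsfun//.
  rewrite integral_indic// setIT nuE//.
  (* The simple approximations are nonnegative, so a negative value has empty preimage. *)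
  have [r0|r0] := ltP r 0%R.
    rewrite preimage_nnfun0// integral_set0 mule0.
    by rewrite integral0_eq// => x _; rewrite indicE in_set0 mulr0 mul0e.
  rewrite -ge0_integralZl ?lee_fin//; last 2 first.
    exact/measurable_EFinP/measurable_funTS.
    by move=> x _; rewrite lee_fin.
  rewrite integral_mkcond; apply: eq_integral => x _.
  rewrite patchE indicE; case: ifPn => _; first by rewrite mulr1.
  by rewrite mulr0 mul0e.
rewrite -monotone_convergence//.
- apply: eq_integral => x _; apply/cvg_lim => //.
  by apply: cvgeZr => //; exact: f_cvg.
- move=> n; apply: emeasurable_funM; last exact/measurable_EFinP.
  exact/measurable_EFinP/measurable_funTS.
- by move=> n x _; rewrite mule_ge0 ?lee_fin.
- by move=> x _ m n mn; rewrite lee_pmul ?lee_fin//; exact: f_nd.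
Qed.

Let posM (f : T -> R) : (fun x => (EFin \o f)^\+ x * (h x)%:E) =
  (EFin \o (fun x => (f x * h x)%R))^\+.
Proof.
apply/funext => x; rewrite !funeposE /= -!EFin_max -EFinM; congr EFin.
by rewrite maxr_pMl// mul0r.
Qed.

Let negM (f : T -> R) : (fun x => (EFin \o f)^\- x * (h x)%:E) =
  (EFin \o (fun x => (f x * h x)%R))^\-.
Proof.
apply/funext => x; rewrite !funenegE /= -!EFin_max -EFinM; congr EFin.
by rewrite maxr_pMl// mul0r mulNr.
Qed.

Lemma integral_density (f : T -> R) : measurable_fun [set: T] f ->
  \int[nu]_x (f x)%:E = \int[mu]_x (f x * h x)%:E.
Proof.
move=> mf; have mf' : measurable_fun [set: T] (EFin \o f) by exact/measurable_EFinP.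
rewrite integralE [RHS]integralE; congr (_ - _).
  by rewrite ge0_integral_density// ?posM//; exact: measurable_funepos.
by rewrite ge0_integral_density// ?negM//; exact: measurable_funeneg.
Qed.

Lemma integrable_density (f : T -> R) : measurable_fun [set: T] f ->
  nu.-integrable [set: T] (EFin \o f) <->
  mu.-integrable [set: T] (EFin \o (fun x => (f x * h x)%R)).
Proof.
move=> mf.
have E : \int[nu]_x `|(EFin \o f) x| = \int[mu]_x `|(EFin \o (fun x => (f x * h x)%R)) x|.
  rewrite ge0_integral_density//; last by do 2 apply: measurableT_comp => //.
  by apply: eq_integral => x _ /=; rewrite -EFinM normrM (ger0_norm (h0 x)).
split=> /integrableP[_ H]; apply/integrableP; split.
- by apply/measurable_EFinP; exact: measurable_funM.
- by rewrite -E.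
- exact/measurable_EFinP.
- by rewrite E.
Qed.

End Density.

Section IntegralFacts.
Context {R : realType}.
Local Notation leb := (@lebesgue_measure R).

(** The difference of two infinite parts is -oo by convention, so a finite value forces both parts
    to be finite. This extracts integrability from an orthogonality relation. *)
Lemma integrable_of_fin_num d (T : measurableType d)
    (mu : {measure set T -> \bar R}) (f : T -> R) :
  measurable_fun [set: T] f -> (\int[mu]_x (f x)%:E)%E \is a fin_num ->
  mu.-integrable [set: T] (EFin \o f).
Proof.
move=> mf; have mf' : measurable_fun [set: T] (EFin \o f) by exact/measurable_EFinP.
rewrite integralE; set a := (\int[mu]_x _^\+ x)%E; set b := (\int[mu]_x _^\- x)%E => ab.
have a0 : (0 <= a)%E by apply: integral_ge0 => x _; exact: funepos_ge0.
have b0 : (0 <= b)%E by apply: integral_ge0 => x _; exact: funeneg_ge0.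
have [afin bfin] : (a < +oo /\ b < +oo)%E.
  by case: (a) (b) ab a0 b0 => [x| |] [y| |] //=; rewrite ?ltry.
apply/integrableP; split => //.
rewrite -[X in (\int[mu]_x X x)%E]/(abse \o (EFin \o f)) fune_abse.
rewrite ge0_integralD//; [exact: lte_add_pinfty | exact: measurable_funepos | exact: measurable_funeneg].
Qed.

Lemma integral_gt0_point (D : set R) (f : R -> R) (x0 : R) : measurable D ->
  nbhs x0 D -> measurable_fun D f -> (forall x, D x -> 0 <= f x) ->
  {for x0, continuous f} -> 0 < f x0 -> (0 < \int[leb]_(x in D) (f x)%:E)%E.
Proof.
move=> mD Dx0 mf f0 cf fx0.
have e20 : 0 < f x0 / 2 by rewrite divr_gt0.
have /cvgrPdist_lt /(_ _ e20) H : f x @[x --> x0] --> f x0 by [].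
have /nbhs_ballP[e /= e0 He] : nbhs x0 (D `&` [set x | `|f x0 - f x| < f x0 / 2]).
  exact: filterI.
pose A : set R := `[x0, x0 + e / 2]%classic.
have AD x : A x -> D x /\ f x0 / 2 <= f x.
  rewrite /A /= in_itv /= => /andP[x0x xe].
  have [] := He x; first by rewrite /ball /= ltr_norml; lra.
  by move=> Dx /=; rewrite ltr_norml => /andP[? ?]; split => //; lra.
apply: (@lt_le_trans _ _ (\int[leb]_(x in A) (f x0 / 2)%:E)%E).
  rewrite integral_cst; last exact: measurable_itv.
  rewrite [X in (_ * X)%E](_ : _ = (e / 2)%:E); last first.
    apply: etrans (lebesgue_measure_itv `[x0, x0 + e / 2]) _.
    by rewrite /= lte_fin ltrDl divr_gt0// -EFinD addrAC subrr add0r.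
  by rewrite -EFinM lte_fin mulr_gt0// divr_gt0.
apply: (@le_trans _ _ (\int[leb]_(x in A) (f x)%:E)%E).
  apply: ge0_le_integral => //.
  - exact: measurable_itv.
  - by move=> x _; rewrite lee_fin divr_ge0// ltW.
  - apply/measurable_EFinP; apply: measurable_funS mf => //.
    by move=> x /AD[].
  - by move=> x /AD[_ H1]; rewrite lee_fin.
apply: ge0_subset_integral => //.
- exact: measurable_itv.
- exact/measurable_EFinP.
- by move=> x /AD[].
Qed.

Section ImproperFTC.
Context (f F : R -> R) (D : set R) (u v : nat -> R) (A B : R).
Context (uv : forall n, u n < v n).
Context (u_ni : {homo u : m n / (m <= n)%N >-> n <= m}).
Context (v_nd : {homo v : m n / (m <= n)%N >-> m <= n}).
Context (DE : D = \bigcup_n `[u n, v n]%classic).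
Context (dF : forall x, D x -> is_derive x 1 F (f x)).
Context (cf : forall x, D x -> {for x, continuous f}).
Context (Fu : F (u n) @[n --> \oo] --> A) (Fv : F (v n) @[n --> \oo] --> B).

Let uvD n x : `[u n, v n]%classic x -> D x.
Proof. by move=> xn; rewrite DE; exists n. Qed.

Let cF x : D x -> {for x, continuous F}.
Proof.
by move=> /dF H; apply/differentiable_continuous/derivable1_diffP; exact: ex_derive.
Qed.

Let FTC n : (\int[leb]_(x in `[u n, v n]) (f x)%:E = (F (v n))%:E - (F (u n))%:E)%E.
Proof.
have un : `[u n, v n]%classic (u n) by rewrite /= in_itv /= lexx ltW.
have vn : `[u n, v n]%classic (v n) by rewrite /= in_itv /= lexx ltW.
apply: continuous_FTC2 => //.
- by apply: continuous_in_subspaceT => x; rewrite inE => /uvD/cf.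
- split.
  + move=> x; rewrite in_itv /= => /andP[ux xv].
    have Dx : D x by apply: (@uvD n); rewrite /= in_itv /= !ltW.
    by have := dF Dx => ?; exact: ex_derive.
  + by apply: cvg_at_right_filter; exact/cF/uvD/un.
  + by apply: cvg_at_left_filter; exact/cF/uvD/vn.
- move=> x; rewrite in_itv /= => /andP[ux xv].
  have Dx : D x by apply: (@uvD n); rewrite /= in_itv /= !ltW.
  by have := dF Dx => ?; rewrite derive1E derive_val.
Qed.

Let lim : (\int[leb]_(x in `[u n, v n]) (f x)%:E)%E @[n --> \oo] --> (B - A)%:E.
Proof.
under eq_fun do rewrite FTC -EFinB.
by apply: cvg_EFin; [exact: nearW | exact: cvgB].
Qed.

Let ni : {homo (fun n => `[u n, v n]%classic) : m n / (m <= n)%N >-> (m <= n)%O}.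
Proof.
move=> m n mn; apply/subsetPset => x /=; rewrite !in_itv /= => /andP[ux xv].
by rewrite (le_trans (u_ni mn) ux) (le_trans xv (v_nd mn)).
Qed.

Lemma measurable_improper : measurable D /\ measurable_fun D f.
Proof.
have mD : measurable D by rewrite DE; exact: bigcup_measurable.
split=> //; rewrite DE; apply/measurable_fun_bigcup => // n.
apply: subspace_continuous_measurable_fun => //.
by apply: continuous_in_subspaceT => x; rewrite inE => /uvD/cf.
Qed.

(** Compact intervals exhaust D; the fundamental theorem holds on each, and monotone convergence
    identifies the limit. *)
Lemma ge0_improper_FTC2 : (forall x, D x -> 0 <= f x) ->
  (\int[leb]_(x in D) (f x)%:E = (B - A)%:E)%E.
Proof.
move=> f0; have [mD mf] := measurable_improper.
have H : (\int[leb]_(x in `[u n, v n]) (f x)%:E)%E @[n --> \oo] -->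
   (\int[leb]_(x in D) (f x)%:E)%E.
  rewrite DE; apply: ge0_nondecreasing_set_cvg_integral => // n.
  - apply/measurable_EFinP; apply: measurable_funS mf => //; exact: uvD.
  - by move=> x /uvD Dx; rewrite lee_fin f0.
by apply/esym; apply: (cvg_unique (@ereal_hausdorff R) lim H).
Qed.

(** Monotone convergence for the positive and the negative part separately; integrability keeps
    their difference meaningful. *)
Lemma improper_FTC2 : leb.-integrable D (EFin \o f) ->
  (\int[leb]_(x in D) (f x)%:E = (B - A)%:E)%E.
Proof.
move=> intf; have [mD mf] := measurable_improper.
have mf' : measurable_fun D (EFin \o f) by exact/measurable_EFinP.
have Hp : (\int[leb]_(x in `[u n, v n]) (EFin \o f)^\+ x)%E @[n --> \oo] -->
   (\int[leb]_(x in D) (EFin \o f)^\+ x)%E.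
  rewrite DE; apply: ge0_nondecreasing_set_cvg_integral => // n.
  by apply: measurable_funepos; apply: measurable_funS mf' => //; exact: uvD.
have Hn : (\int[leb]_(x in `[u n, v n]) (EFin \o f)^\- x)%E @[n --> \oo] -->
   (\int[leb]_(x in D) (EFin \o f)^\- x)%E.
  rewrite DE; apply: ge0_nondecreasing_set_cvg_integral => // n.
  by apply: measurable_funeneg; apply: measurable_funS mf' => //; exact: uvD.
apply/esym; apply: (cvg_unique (@ereal_hausdorff R) lim).
rewrite /= integralE; under eq_fun do rewrite integralE.
apply: cvgeB => //; apply: fin_num_adde_defl.
rewrite fin_numN ge0_fin_numE; first exact: integral_funeneg_lt_pinfty.
by apply: integral_ge0 => x _; exact: funeneg_ge0.
Qed.

End ImproperFTC.

End IntegralFacts.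

Section WeightFunctionals.
Context {R : realType}.
Local Notation leb := (@lebesgue_measure R).
Implicit Types (p : {poly R}) (k : R -> R).

Definition poly_integrable k :=
  forall p, leb.-integrable [set: R] (EFin \o (fun x => p.[x] * k x)).

Lemma measurable_horner p : measurable_fun [set: R] (horner p).
Proof. by apply: continuous_measurable_fun => x; exact: continuous_horner. Qed.

Lemma poly_functional k : poly_integrable k ->
  exists E : {scalar {poly R}}, forall p,
    (\int[leb]_x (p.[x] * k x)%:E = (E p)%:E)%E.
Proof.
move=> ik; pose E p := \int[leb]_x (p.[x] * k x).
have El : linear_for *%R E.
  move=> a p q; rewrite /E.
  have -> : (fun x => (a *: p + q).[x] * k x) =
      (fun x => a * (p.[x] * k x) + q.[x] * k x).
    by apply/funext => x; rewrite hornerD hornerZ mulrDl mulrA.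
  rewrite RintegralD//; last first.
    have -> : EFin \o (fun x => a * (p.[x] * k x)) =
        (fun x => a%:E * (EFin \o (fun y => (p.[y] * k y)%R)) x)%E by [].
    exact: integrableZl.
  by rewrite RintegralZl.
pose El' := GRing.isLinear.Build R {poly R} R *%R E El.
pose EE : {scalar {poly R}} := HB.pack E El'.
exists EE => p; rewrite /EE /= /E /Rintegral fineK//.
by apply: integrable_fin_num => //; exact: ik.
Qed.

Lemma span_integrable d (mu : {measure set (measurableTypeR R) -> \bar R})
    (P : nat -> {poly R}) : (forall n, size (P n) = n.+1) ->
  (forall n, mu.-integrable [set: R] (EFin \o (fun x => (P n).[x]))) ->
  forall p, (size p <= d)%N -> mu.-integrable [set: R] (EFin \o (fun x => p.[x])).
Proof.
move=> sP iP; elim: d => [|d IH] p sp.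
  rewrite (_ : _ \o _ = cst 0%E); first exact: integrable0.
  by apply/funext => x /=; rewrite (size_poly_leq0P _ sp) horner0.
have l0 : (P d)`_d != 0.
  by rewrite (_ : _`_d = lead_coef (P d)) ?lead_coef_eq0 -?size_poly_eq0 ?sP// lead_coefE sP.
pose a := p`_d / (P d)`_d; pose q := p - a *: P d.
have sq : (size q <= d)%N.
  apply/leq_sizeP => j; rewrite leq_eqVlt => /orP[/eqP <-|dj].
    by rewrite coefB coefZ /a divfK// subrr.
  rewrite coefB coefZ !(leq_sizeP _ _ _ _ dj) ?mulr0 ?subr0//.
  by rewrite sP.
have -> : EFin \o (fun x => p.[x]) =
    ((EFin \o (fun x => q.[x])) \+ (fun x => a%:E * (EFin \o (fun x => (P d).[x])) x))%E.
  by apply/funext => x /=; rewrite -EFinM -EFinD /q hornerD hornerN hornerZ subrK.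
by apply: integrableD => //; [exact: IH | exact: integrableZl].
Qed.

Lemma countable_roots p : p != 0 -> countable [set x | root p x].
Proof.
move=> p0; apply: finite_set_countable; apply: contrapT.
move=> /(infinite_set_fset (size p))[B Bp sB].
have := @max_poly_roots _ p (finmap.enum_fset B) p0; rewrite ltnNge sB => H.
suff : false by []; apply: H; last exact: finmap.fset_uniq.
by apply/allP => x xB; exact: Bp.
Qed.

(** The roots of q are the exceptional points of the density k. Since p q has finitely many roots,
    some positive integer avoids them, and there p k is continuous and positive. *)
Lemma integral_poly_gt0 k (D : R -> Prop) p : poly_integrable k ->
  measurable_fun [set: R] k ->
  (forall x, ~ D x -> k x = 0) -> (forall x, 0 <= k x) ->
  (exists2 q : {poly R}, q != 0 &
     forall x, 0 < x -> ~~ root q x -> {for x, continuous k} /\ 0 < k x) ->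
  p != 0 -> (forall x, D x -> 0 <= p.[x]) ->
  (0 < \int[leb]_x (p.[x] * k x)%:E)%E.
Proof.
move=> ik mk kD k0 [q q0 Hq] p0 pD.
have Dk x : 0 <= p.[x] * k x.
  have [/pD Dx|/kD ->] := pselect (D x); last by rewrite mulr0.
  by rewrite mulr_ge0.
have [x0 [x00 px0]] : exists x, 0 < x /\ ~~ root (p * q) x.
  apply: contrapT => H; have pq0 : p * q != 0 by rewrite mulf_neq0.
  have := @max_poly_roots _ (p * q) [seq i.+1%:R | i <- iota 0 (size (p * q))] pq0.
  rewrite size_map size_iota ltnn => F; suff : false by []; apply: F.
    apply/allP => y /mapP[i _ ->]; apply/negPn/negP => Hi; apply: H.
    by exists i.+1%:R; rewrite ltr0n.
  rewrite map_inj_uniq ?iota_uniq// => i j /eqP; rewrite eqr_nat => /eqP[].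
  done.
move: px0; rewrite rootM negb_or => /andP[px0 qx0].
have [ck kx0] := Hq _ x00 qx0.
apply: (@integral_gt0_point _ _ _ x0) => //.
- exact: filterT.
- by apply: measurable_funM => //; exact: measurable_horner.
- apply: continuousM => //; exact: continuous_horner.
- rewrite lt_neqAle Dk andbT eq_sym mulf_neq0// gt_eqF//.
Qed.

End WeightFunctionals.

(** * Measures of class P_m *)

Section ClassP.
Context {R : realType} (c : weight_case R).
Local Notation leb := (@lebesgue_measure R).

Definition w_full (x : R) : R := w_density c x * \1_(Delta c) x.

Lemma measurable_w_full : measurable_fun [set: R] w_full.
Proof. by apply/measurable_EFinP; exact: (measurable_w_density c). Qed.

Lemma w_full_ge0 x : 0 <= w_full x.
Proof. exact: w_density_ge0. Qed.

Lemma Delta_le (x y : R) : Delta c x -> x <= y -> Delta c y.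
Proof.
by case: c => //= _; rewrite !in_itv /= !andbT; exact: le_trans.
Qed.

Lemma w_full_out x : ~ Delta c x -> w_full x = 0.
Proof. by move=> Dx; rewrite /w_full indicE memNset// mulr0. Qed.

Lemma w_full_gt0 (x0 x : R) : Delta c x0 -> x0 < x ->
  {for x, continuous w_full} /\ 0 < w_full x.
Proof.
move=> Dx0 x0x; have D0 : \forall y \near x, x0 < y by exact: lt_nbhsr.
have xc : if c is Laguerre _ then 0 < x else true.
  by case: c Dx0 => //= _; rewrite in_itv /= andbT => /le_lt_trans; exact.
split; last first.
  rewrite /w_full indicE mem_set ?mulr1; last exact: Delta_le (ltW x0x).
  by case: c xc => [al|] /= xc; rewrite ?mulr_gt0 ?expR_gt0 ?powR_gt0.
have H : \forall y \near x, w_density c y = w_full y.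
  near=> y; rewrite /w_full indicE mem_set ?mulr1//; apply: (Delta_le Dx0).
  by apply: ltW; near: y.
rewrite /prop_for /continuous_at /w_full indicE mem_set ?mulr1; last exact: Delta_le (ltW x0x).
apply: cvg_trans; first exact: near_eq_cvg H.
case: c xc => [al|] /= xc.
  apply: cvgM; last first.
    apply: (@continuous_comp _ _ _ (fun y : R => - y) expR).
      exact: opp_continuous.
    exact: continuous_expR.
  suff : {for x, continuous (fun y : R => y `^ al)} by [].
  apply: differentiable_continuous; apply/derivable1_diffP.
  by have := @is_derive1_powR R al _ xc => ?; exact: ex_derive.
apply: (@continuous_comp _ _ _ (fun y : R => - y ^+ 2) expR).
  by apply: cvgN; exact: exprn_continuous.
exact: continuous_expR.
Unshelve. all: by end_near.
Qed.

Lemma integral_w (f : R -> R) (A : set R) : measurable A -> measurable_fun [set: R] f ->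
  (\int[w c]_(x in A) (f x)%:E = \int[leb]_(x in A) (f x * w_full x)%:E)%E.
Proof.
move=> mA mf; rewrite integral_mkcond [RHS]integral_mkcond.
have E1 : (fun x => (f x)%:E) \_ A = fun x => (f x * \1_A x)%:E.
  apply/funext => x; rewrite patchE indicE; case: ifP; first by rewrite mulr1.
  by rewrite mulr0.
rewrite E1 (@integral_density _ _ _ leb (w c) w_full)//.
- apply: eq_integral => x _; rewrite patchE indicE; case: ifP; rewrite ?mulr1//.
  by rewrite mulr0 mul0r.
- exact: measurable_w_full.
- exact: w_full_ge0.
- by apply: measurable_funM => //; exact: measurable_indic.
Qed.

Section Mu.
Context (m : nat) (mu : {finite_measure set (measurableTypeR R) -> \bar R}).
Context (rho : {poly R}) (srho : size rho = m.+1).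
Context (muE : forall A : set (measurableTypeR R), measurable A ->
  mu A = (\int[w c]_(x in A) (rho.[x]^-1)%:E)%E).

Definition mu_full (x : R) : R := rho.[x]^-1 * w_full x.

Let rho0 : rho != 0. Proof. by rewrite -size_poly_eq0 srho. Qed.

Let mrhoV : measurable_fun [set: R] (fun x => rho.[x]^-1).
Proof. by apply: (measurableT_comp measurable_inv); exact: measurable_horner. Qed.

Let mk : measurable_fun [set: R] mu_full.
Proof. by apply: measurable_funM => //; exact: measurable_w_full. Qed.

Let muE' A : measurable A -> mu A = (\int[leb]_(x in A) (mu_full x)%:E)%E.
Proof. by move=> mA; rewrite muE// integral_w. Qed.

Let mu_full_cvg (x0 x : R) : Delta c x0 -> x0 < x -> rho.[x] != 0 ->
  {for x, continuous mu_full}.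
Proof.
move=> Dx0 x0x rx; apply: cvgM; last exact: (w_full_gt0 Dx0 x0x).1.
by apply: cvgV => //; exact: continuous_horner.
Qed.

(** If rho were negative at a point of Delta, it would be so on an interval to the right, which
    stays in Delta even when the point is the endpoint 0. The density of mu would be negative there,
    and the measure of the interval below 0. *)
Lemma class_P_rho_ge0 x : Delta c x -> 0 <= rho.[x].
Proof.
move=> Dx; rewrite leNgt; apply/negP => rx.
have cr : {for x, continuous (horner rho)} by exact: continuous_horner.
have : \forall y \near x, rho.[y] < 0 by exact: (cvgr_lt _ cr).
move=> /nbhs_ballP[e /= e0 He]; pose x1 := x + e / 2.
have e20 : 0 < e / 2 by rewrite divr_gt0.
have xx1 : x < x1 by rewrite ltrDl.
pose A : set R := `]x, x + e[%classic.
have x1A : A x1 by rewrite /A /= in_itv /= xx1 /=; rewrite /x1; lra.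
have mA : measurable A by exact: measurable_itv.
have rA y : A y -> rho.[y] < 0.
  by rewrite /A /= in_itv /= => /andP[? ?]; apply: He; rewrite /ball /= ltr_norml; lra.
have Ak y : A y -> 0 <= - mu_full y.
  move=> /rA ry; rewrite /mu_full -mulNr mulr_ge0 ?w_full_ge0//.
  by rewrite oppr_ge0 invr_le0 ltW.
have := @integral_gt0_point _ A (fun y => - mu_full y) x1 mA.
have nA : nbhs x1 A by apply: near_in_itvoo; exact: x1A.
have mA' : measurable_fun A (fun y => - mu_full y).
  by apply: measurable_funTS; exact: measurableT_comp.
move=> /(_ nA mA' Ak) H.
have : (0 < \int[leb]_(y in A) (- mu_full y)%:E)%E.
  apply: H; first by apply: cvgN; apply: (mu_full_cvg Dx xx1); rewrite lt_eqF// rA.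
  have := (w_full_gt0 Dx xx1).2 => w0.
  by rewrite /mu_full -mulNr mulr_gt0// oppr_gt0 invr_lt0 rA.
have -> : (\int[leb]_(y in A) (- mu_full y)%:E = - mu A)%E.
  rewrite muE'// -[RHS]oppeK oppeK.
  have -> : (\int[leb]_(y in A) (mu_full y)%:E = - \int[leb]_(y in A) (- mu_full y)%:E)%E.
    by rewrite -integral_ge0N//; apply: eq_integral => y _; rewrite -EFinN opprK.
  by rewrite oppeK.
by rewrite oppe_gt0 ltNge measure_ge0.
Qed.

Lemma mu_full_ge0 x : 0 <= mu_full x.
Proof.
rewrite /mu_full; have [Dx|Dx] := pselect (Delta c x); last by rewrite w_full_out ?mulr0.
by rewrite mulr_ge0 ?w_full_ge0// invr_ge0 class_P_rho_ge0.
Qed.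

Lemma mu_full_gt0 (x : R) : 0 < x -> ~~ root rho x ->
  {for x, continuous mu_full} /\ 0 < mu_full x.
Proof.
move=> x0 rx; have D0 : Delta c 0 by case: c => //= _; rewrite in_itv /= lexx.
split; first exact: (mu_full_cvg D0 x0 rx).
rewrite lt_neqAle mu_full_ge0 andbT eq_sym /mu_full mulf_neq0 ?invr_eq0//.
by rewrite gt_eqF// (w_full_gt0 D0 x0).2.
Qed.

Lemma integral_mu (f : R -> R) : measurable_fun [set: R] f ->
  (\int[mu]_x (f x)%:E = \int[leb]_x (f x * mu_full x)%:E)%E.
Proof. by move=> mf; apply: integral_density => //; exact: mu_full_ge0. Qed.

Context (P : nat -> {poly R}) (hP : monic_OPS mu P).

(** The existence of moments has to be derived. For n > 0 the integral of P n against P 0 = 1 is 0,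
    hence finite, so P n is integrable; P 0 is integrable because mu is finite; and the P n span all
    polynomials. *)
Lemma mu_poly_integrable : poly_integrable mu_full.
Proof.
have [P0 Po] := hP.
have H p : mu.-integrable [set: R] (EFin \o (fun x => p.[x])).
  apply: (@span_integrable _ (size p) mu P) => // n; first by case: (P0 n).
  case: n => [|n].
    have [mP sP] := P0 0%N; have -> : P 0%N = 1.
      by rewrite (size1_polyC (eq_leq sP)); move: mP; rewrite monicE lead_coefE sP => /eqP ->.
    rewrite (_ : _ \o _ = EFin \o cst 1); first exact: finite_measure_integrable_cst.
    by apply/funext => x /=; rewrite hornerC.
  apply: integrable_of_fin_num; first exact: measurable_horner.
  rewrite (_ : integral _ _ _ = 0%E)//.
  have := Po n.+1 0%N isT; have [mP sP] := P0 0%N; have -> : P 0%N = 1.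
    by rewrite (size1_polyC (eq_leq sP)); move: mP; rewrite monicE lead_coefE sP => /eqP ->.
  move=> <-; apply: eq_integral => x _.
  by rewrite hornerC mulr1.
move=> p; apply: (@integrable_density _ _ _ leb mu mu_full mk mu_full_ge0 muE' _ _).1 (H p).
exact: measurable_horner.
Qed.

Let ae_rho (p : {poly R}) : ae_eq leb [set: R]
  (EFin \o (fun x => (rho * p).[x] * mu_full x)) (EFin \o (fun x => p.[x] * w_full x)).
Proof.
exists [set x | root rho x]; split.
- by apply: countable_measurable; [exact: measurable_set1 | exact: countable_roots].
- by apply: countable_lebesgue_measure0; exact: countable_roots.
- move=> x /= H; apply: contrapT => /negP rx; apply: H => _; congr EFin.
  by rewrite /mu_full hornerM [_ * p.[x]]mulrC -mulrA (mulrA _ _ (w_full x)) divff// mul1r.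
Qed.

(** Off the roots of rho, p times the density of w is rho p times the density of mu, so w inherits
    its moments from mu. *)
Lemma w_poly_integrable : poly_integrable w_full.
Proof.
move=> p; have /integrableP[m1 H] := mu_poly_integrable (rho * p).
have mp : measurable_fun [set: R] (EFin \o (fun x => p.[x] * w_full x)).
  apply/measurable_EFinP; apply: measurable_funM; first exact: measurable_horner.
  exact: measurable_w_full.
apply/integrableP; split => //; apply: le_lt_trans H; rewrite le_eqVlt; apply/orP; left.
apply/eqP/esym; apply: ae_eq_integral; [by []|exact: measurableT_comp|exact: measurableT_comp|].
exact: (ae_eq_comp abse (ae_rho p)).
Qed.

Lemma integral_w_mu (p : {poly R}) :
  (\int[leb]_x (p.[x] * w_full x)%:E = \int[leb]_x ((rho * p).[x] * mu_full x)%:E)%E.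
Proof.
apply/esym/ae_eq_integral => //; last exact: ae_rho.
- by apply/measurable_EFinP; apply: measurable_funM => //; exact: measurable_horner.
- apply/measurable_EFinP; apply: measurable_funM; first exact: measurable_horner.
  exact: measurable_w_full.
Qed.

End Mu.

Lemma posdef_of_pos (E : {scalar {poly R}}) (D : R -> Prop) :
  (forall p : {poly R}, p != 0 -> (forall x, D x -> 0 <= p.[x]) -> 0 < E p) -> posdef E.
Proof.
move=> H p p0; apply: H; first by rewrite mulf_neq0.
by move=> x _; rewrite hornerM -expr2 sqr_ge0.
Qed.

(** The bridge from measures to the functionals of the algebraic part. The integral formula for E is
    kept for the Pearson identity. *)
Lemma class_P_functionals (m : nat)
    (mu : {finite_measure set (measurableTypeR R) -> \bar R}) (P L : nat -> {poly R}) :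
  class_P c m mu -> monic_OPS mu P -> monic_OPS (w c) L ->
  exists (E M : {scalar {poly R}}) (rho : {poly R}),
  [/\ forall p : {poly R}, p != 0 -> (forall x, Delta c x -> 0 <= p.[x]) -> 0 < E p,
      forall p : {poly R}, p != 0 -> (forall x, Delta c x -> 0 <= p.[x]) -> 0 < M p,
      orthopoly E L & orthopoly M P] /\
  [/\ size rho = m.+1, forall p, E p = M (rho * p),
      forall x, Delta c x -> 0 <= rho.[x],
      forall p, (\int[leb]_x (p.[x] * w_full x)%:E = (E p)%:E)%E &
      forall n j, coef_b c P L n j = conn E L P n j].
Proof.
move=> [_ [rho [srho muE]]] hP hL; have rho0 : rho != 0 by rewrite -size_poly_eq0 srho.
have iw := w_poly_integrable srho muE hP; have imu := mu_poly_integrable muE hP.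
have [E HE] := poly_functional iw; have [M HM] := poly_functional imu.
have wE p : (\int[w c]_x (p.[x])%:E = (E p)%:E)%E.
  by rewrite integral_w//; exact: measurable_horner.
have mkk : measurable_fun [set: R] (mu_full rho).
  apply: measurable_funM; last exact: measurable_w_full.
  by apply: (measurableT_comp measurable_inv); exact: measurable_horner.
have D0 : Delta c 0 by case: c => //= _; rewrite in_itv /= lexx.
have [hP1 hP2] := hP; have [hL1 hL2] := hL.
exists E, M, rho; split; split => //.
- move=> p p0 pD; rewrite -lte_fin -HE; apply: (integral_poly_gt0 (D := Delta c)) => //.
  + exact: measurable_w_full.
  + exact: w_full_out.
  + exact: w_full_ge0.
  + by exists 1; [exact: oner_neq0 | move=> x x0 _; exact: w_full_gt0 D0 x0].
- move=> p p0 pD; rewrite -lte_fin -HM; apply: (integral_poly_gt0 (D := Delta c)) => //.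
  + by move=> x Dx; rewrite /mu_full w_full_out ?mulr0.
  + exact: (mu_full_ge0 muE).
  + by exists rho => // x x0 rx; exact: (mu_full_gt0 muE).
- split=> [n|n|i j ij]; [by case: (hL1 n)|by case: (hL1 n)|].
  apply: EFin_inj; rewrite -wE; apply: etrans (hL2 i j ij).
  by apply: eq_integral => x _; rewrite hornerM.
- split=> [n|n|i j ij]; [by case: (hP1 n)|by case: (hP1 n)|].
  apply: EFin_inj; rewrite -HM; apply: etrans (hP2 i j ij).
  rewrite (integral_mu muE); last by apply: measurable_funM; exact: measurable_horner.
  by apply: eq_integral => x _; rewrite hornerM.
- by move=> p; apply: EFin_inj; rewrite -HE (integral_w_mu srho) HM.
- exact: (class_P_rho_ge0 muE).
- move=> n j; rewrite /coef_b /conn /Rintegral.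
  have -> : (\int[w c]_x ((P n).[x] * (L j).[x])%:E = (E (P n * L j))%:E)%E.
    by rewrite -wE; apply: eq_integral => x _; rewrite hornerM.
  have -> : (\int[w c]_x ((L j).[x] ^+ 2)%:E = (E (L j * L j))%:E)%E.
    by rewrite -wE; apply: eq_integral => x _; rewrite hornerM expr2.
  by [].
Qed.

End ClassP.

(** * Pearson identities for the two weights *)

Section Pearson.
Context {R : realType}.
Local Notation leb := (@lebesgue_measure R).

Lemma exprV_expRN_le (i : nat) (x : R) : 0 < x ->
  x ^+ i * expR (- x) <= (i.+1)`!%:R * x^-1.
Proof.
move=> x0; have H := expR_ge1Dxn i (ltW x0).
have f0 : 0 < i.+1`!%:R :> R by rewrite ltr0n fact_gt0.
rewrite expRN ler_pdivrMr ?expR_gt0// mulrAC ler_pdivlMr// -exprSr mulrC -ler_pdivrMr//.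
by apply: le_trans H; rewrite lerDr.
Qed.

Lemma poly_expRN_cvg0 (p : {poly R}) :
  p.[n.+1%:R] * expR (- n.+1%:R) @[n --> \oo] --> (0 : R).
Proof.
have H i : n.+1%:R ^+ i * expR (- n.+1%:R) @[n --> \oo] --> (0 : R).
  apply: (@squeeze_cvgr _ _ _ _ (fun=> 0) (fun n => i.+1`!%:R * n.+1%:R^-1)).
  - near=> n; rewrite exprV_expRN_le// andbT mulr_ge0 ?expR_ge0// exprn_ge0//.
  - exact: cvg_cst.
  - by rewrite -[X in _ --> X](mulr0 i.+1`!%:R); apply: cvgMr; exact: cvg_harmonic.
rewrite (_ : (fun n => _) = (fun n => \sum_(i <- index_iota 0 (size p))
    p`_i * (n.+1%:R ^+ i * expR (- n.+1%:R)))); last first.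
  apply/funext => n; rewrite horner_coef mulr_suml.
  by rewrite big_mkord; apply: eq_bigr => i _; rewrite mulrA.
rewrite -[X in _ --> X](_ : \sum_(i <- index_iota 0 (size p)) p`_i * 0 = 0); last first.
  by rewrite big1// => i _; rewrite mulr0.
by apply: cvg_sumr => i; apply: cvgMr; exact: H.
Unshelve. all: by end_near.
Qed.

Lemma poly_sqr_expRN_cvg0 (p : {poly R}) :
  p.[n.+1%:R] * expR (- (n.+1%:R ^+ 2)) @[n --> \oo] --> (0 : R).
Proof.
have H := poly_expRN_cvg0 p; apply/cvgrPdist_le => e e0.
move/cvgrPdist_le : H => /(_ e e0) [n0 _ Hn]; exists n0 => // n /Hn /=.
rewrite !sub0r !normrN; apply: le_trans.
rewrite !normrM ler_wpM2l// !ger0_norm ?expR_ge0// ler_expR lerN2.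
by rewrite expr2 ler_peMl// ler1n.
Qed.

Context (E : {scalar {poly R}}).

(** The integrand is the derivative of x^(al + 1) exp(-x) p, and al > -1 makes this primitive vanish
    at 0. *)
Lemma laguerre_pearson (al : R) : -1 < al ->
  (forall p, (\int[leb]_x (p.[x] * w_full (Laguerre al) x)%:E = (E p)%:E)%E) ->
  pearson E 0 1 (1 + al).
Proof.
move=> hal HE p; set q := _ + _.
pose F x := x `^ (al + 1) * (expR (- x) * p.[x]).
pose f x := q.[x] * (x `^ al * expR (- x)).
apply: EFin_inj; rewrite -HE.
have -> : (\int[leb]_x (q.[x] * w_full (Laguerre al) x)%:E =
    \int[leb]_(x in `[0%R, +oo[) (f x)%:E)%E.
  rewrite [RHS]integral_mkcond; apply: eq_integral => x _.
  rewrite patchE /w_full indicE /=; case: ifP => _; first by rewrite mulr1.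
  by rewrite !mulr0.
have mf : measurable_fun [set: R] f.
  apply: measurable_funM; first exact: measurable_horner.
  apply: measurable_funM; first exact: (measurable_powR al).
  by apply: measurableT_comp.
have iq : leb.-integrable [set: R] (EFin \o (fun x => q.[x] * w_full (Laguerre al) x)).
  apply: integrable_of_fin_num; last by rewrite HE.
  by apply: measurable_funM; [exact: measurable_horner | exact: measurable_w_full].
rewrite -integral_itv_obnd_cbnd; last by apply/measurable_EFinP/measurable_funTS.
rewrite -[RHS](_ : (0 - 0)%:E = _); last by rewrite subr0.
have e1 x : 0 < x -> x `^ (al + 1) = x * x `^ al.
  by move=> x0; rewrite powRD ?powRr1 1?mulrC ?(ltW x0)// (gt_eqF x0) implybT.
(* The intervals are [1 / (n + 2), n + 1]; the shift keeps the endpoints distinct at n = 0. *)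
apply: (@improper_FTC2 _ f F _ (fun n => harmonic n.+1) (fun n => n.+1%:R)).
- move=> n; rewrite /harmonic (@lt_le_trans _ _ 1)//; last by rewrite ler1n.
  by rewrite invf_lt1// ltr1n.
- by move=> i j ij; rewrite /harmonic lef_pV2 ?posrE// ler_nat !ltnS.
- by move=> i j ij; rewrite ler_nat ltnS.
- apply/seteqP; split => x /=; rewrite ?in_itv /= ?andbT.
    move=> x0; have xV : 0 < x^-1 by rewrite invr_gt0.
    have [N H] : exists N, x + x^-1 < N%:R.
      by exists (Num.bound (x + x^-1)); apply: archi_boundP; lra.
    exists N => //=; rewrite in_itv /=.
    apply/andP; split; last by rewrite -natr1; lra.
    by rewrite -[leRHS]invrK lef_pV2 ?posrE ?invr_gt0 ?ltr0n// -(natr1 N.+1) -natr1; lra.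
  move=> [n _] /=; rewrite !in_itv /= => /andP[+ _].
  by apply: lt_le_trans; rewrite invr_gt0.
- move=> x; rewrite /= in_itv /= andbT => x0.
  have H := @is_derive1_powR R (al + 1) _ x0.
  have H2 := is_derive1_comp (is_derive_expR (- x)) (is_deriveNid x 1).
  have := is_deriveM H (is_deriveM H2 (is_derive_poly p x)).
  move=> /is_derive_eq; apply.
  rewrite /f /q /= e1// addrK scale1r !hornerE mulrfctE /GRing.scale /=; ring.
- move=> x; rewrite /= in_itv /= andbT => x0.
  apply: cvgM; first exact: continuous_horner.
  apply: cvgM.
    suff : {for x, continuous (fun y : R => y `^ al)} by [].
    apply: differentiable_continuous; apply/derivable1_diffP.
    by have := @is_derive1_powR R al _ x0 => ?; exact: ex_derive.
  apply: (@continuous_comp _ _ _ (fun y : R => - y) expR).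
    exact: opp_continuous.
  exact: continuous_expR.
- rewrite -[X in _ --> X](mul0r (expR (- 0) * p.[0])).
  have : F x @[x --> 0^'+] --> 0 * (expR (- 0) * p.[0]).
    apply: cvgM; first by apply: powR_cvg0; lra.
    apply: cvg_at_right_filter; apply: cvgM; last exact: continuous_horner.
    apply: (@continuous_comp _ _ _ (fun y : R => - y) expR).
      exact: opp_continuous.
    exact: continuous_expR.
  move=> /cvg_at_rightP; apply; split; first by move=> n; rewrite invr_gt0.
  by have := @cvg_harmonic R; rewrite -(cvg_shiftS (@harmonic R)).
(* At x = n + 1 >= 1 the power x^(al + 1) is at most x^N, which reduces the limit to a polynomial
   times exp(-x). *)
- pose N := Num.bound (`|al + 1|).
  have NN : al + 1 <= N%:R.
    by apply: le_trans (ler_norm _) _; apply/ltW/archi_boundP/normr_ge0.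
  have := poly_expRN_cvg0 ('X^N * p) => /cvgrPdist_le H; apply/cvgrPdist_le => e e0.
  have [n0 _ Hn] := H e e0; exists n0 => // n /Hn /=.
  rewrite !sub0r !normrN; apply: le_trans; rewrite /F hornerM hornerXn -(mulrA (_ ^+ N)) (mulrC p.[_]).
  rewrite normrM [leRHS]normrM ler_wpM2r// !ger0_norm ?powR_ge0 ?exprn_ge0//.
  by rewrite -powR_mulrn// ler_powR// ler1n.
- have : leb.-integrable `]0, +oo[ (EFin \o (fun x => q.[x] * w_full (Laguerre al) x)).
    by apply: integrableS iq.
  apply: eq_integrable => // x; rewrite inE /= in_itv /= andbT => x0.
  by rewrite /f /w_full indicE mem_set ?mulr1//= in_itv /= ltW.
Qed.

(** The integrand is the derivative of exp(-x^2) p / 2; the limit at minus infinity is that of the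
    reflected polynomial at plus infinity. *)
Lemma hermite_pearson :
  (forall p, (\int[leb]_x (p.[x] * w_full Hermite x)%:E = (E p)%:E)%E) ->
  pearson E 2^-1 0 0.
Proof.
move=> HE p; set q := _ + _.
pose F x := 2^-1 * (expR (- x ^+ 2) * p.[x]).
pose f x := q.[x] * w_full Hermite x.
have fE x : f x = q.[x] * expR (- x ^+ 2) by rewrite /f /w_full /= indicT mulr1.
apply: EFin_inj; rewrite -HE.
have mf : measurable_fun [set: R] f.
  by apply: measurable_funM; [exact: measurable_horner | exact: measurable_w_full].
have iq : leb.-integrable [set: R] (EFin \o f).
  by apply: integrable_of_fin_num => //; rewrite HE.
rewrite -[RHS](_ : (0 - 0)%:E = _); last by rewrite subr0.
have cg (x : R) : expR (- y ^+ 2) @[y --> x] --> expR (- x ^+ 2).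
  apply: (@continuous_comp _ _ _ (fun y : R => - y ^+ 2) expR).
    by apply: cvgN; exact: exprn_continuous.
  exact: continuous_expR.
apply: (@improper_FTC2 _ f F _ (fun n => - n.+1%:R) (fun n => n.+1%:R)).
- by move=> n; rewrite gtrN.
- by move=> i j ij; rewrite lerN2 ler_nat ltnS.
- by move=> i j ij; rewrite ler_nat ltnS.
- apply/seteqP; split => x //= _; exists (Num.bound `|x|) => //=.
  have H : `|x| < (Num.bound `|x|)%:R by exact: archi_boundP.
  by rewrite in_itv /= -ler_norml -natr1; lra.
- move=> x _; rewrite fE.
  have H2 := @is_derive1_comp R expR (- id ^+ 2) x _ _
    (is_derive_expR _) (is_deriveN (is_deriveX 2 (is_derive_id x 1))).
  have := is_deriveZ 2^-1 (is_deriveM H2 (is_derive_poly p x)).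
  move=> /is_derive_eq; apply.
  rewrite /q /= !hornerE /GRing.scale /=; by field.
- move=> x _; rewrite (_ : f = fun x => q.[x] * expR (- x ^+ 2)); last exact/funext/fE.
  by apply: cvgM; [exact: continuous_horner | exact: cg].
- have := poly_sqr_expRN_cvg0 (2^-1 *: (p \Po - 'X)).
  apply: cvg_trans; apply: near_eq_cvg; apply: nearW => n.
  by rewrite /F hornerZ horner_comp hornerN hornerX sqrrN; ring.
- have := poly_sqr_expRN_cvg0 (2^-1 *: p).
  apply: cvg_trans; apply: near_eq_cvg; apply: nearW => n.
  by rewrite /F hornerZ; ring.
- exact: iq.
Qed.

End Pearson.

(** * Scaling of the Laguerre and Hermite zeros *)

Section ScaleEstimates.
Context {R : realType} (E M : {scalar {poly R}}) (L P : nat -> {poly R}).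
Context (D : R -> Prop).
Context (posE : posdef E) (opsL : orthopoly E L).
Context (posM : posdef M) (opsP : orthopoly M P).
Context (posED : forall p : {poly R}, p != 0 -> (forall x, D x -> 0 <= p.[x]) -> 0 < E p).
Context (posMD : forall p : {poly R}, p != 0 -> (forall x, D x -> 0 <= p.[x]) -> 0 < M p).
Context (rho : {poly R}) (m : nat) (srho : size rho = m.+1).
Context (EM : forall p, E p = M (rho * p)).
Context (rho_ge0 : forall x, D x -> 0 <= rho.[x]).

Let rho0 : rho != 0. Proof. by rewrite -size_poly_eq0 srho. Qed.

Lemma ops0_root y : root (L 0) y = false.
Proof.
have [s Ls] := ops_splits posE opsL 0; rewrite Ls root_prod_XsubC.
by rewrite (size0nil (size_zeros opsL Ls)).
Qed.

Lemma large_nat (a : R) : exists n0, forall n, (n0 <= n)%N -> a <= n%:R.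
Proof.
exists (Num.bound `|a|) => n nn; rewrite (le_trans (ler_norm _))// ltW//.
by apply: (lt_le_trans (archi_boundP (normr_ge0 a))); rewrite ler_nat.
Qed.

Lemma cvg_natV : n%:R^-1 @[n --> \oo] --> (0 : R).
Proof.
apply/cvgrPdist_le => eps eps0; have [n0 H] := large_nat (eps^-1 + 1).
exists n0 => // n /H /= nn; have e0 : 0 < eps^-1 by rewrite invr_gt0.
rewrite sub0r normrN ger0_norm ?invr_ge0// -[leRHS]invrK lef_pV2 ?posrE//; lra.
Qed.

Section UniformZeros.
Context (T c : nat -> R).
Context (T_homo : {homo T : i j / (i <= j)%N >-> i <= j}).
Context (T0 : forall N, 0 <= T N).
Context (rootL : forall N y, root (L N) y -> `|y| <= T N).
Context (c_large : forall A : R, exists n0, forall n, (n0 <= n)%N -> A <= c n).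
Context (Tc : forall (eps : R) r, 0 < eps -> exists n0, forall n, (n0 <= n)%N ->
   T (n + r)%N <= (1 + eps) * c n).
Context (rootP : exists B : R, forall N x1, root (P N) x1 ->
  `|x1| <= Num.max B (T (N + m.+1)%N)).

Lemma zeros_scaled_le (eps : R) r : 0 < eps -> exists n0, forall n, (n0 <= n)%N ->
  forall N y, (N <= n + r)%N -> root (L N) y || root (P N) y ->
  0 < c n /\ `|y| <= (1 + eps) * c n.
Proof.
move=> eps0; have [B HB] := rootP.
have [n1 Hn1] := c_large (`|B| + 1); have [n2 Hn2] := Tc (r + m.+1) eps0.
exists (maxn n1 n2) => n; rewrite geq_max => /andP[n1n n2n] N y Nn H.
have Bc := Hn1 _ n1n; have TTc := Hn2 _ n2n; rewrite addnA in TTc.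
have B0 := normr_ge0 B; have BB := ler_norm B.
have c0 : 0 < c n by lra.
split=> //; have TN k : (k <= m.+1)%N -> T (N + k)%N <= (1 + eps) * c n.
  by move=> km; apply: le_trans TTc; apply: T_homo; apply: leq_add.
case/orP: H => [/rootL H|/HB H]; first by rewrite (le_trans H)// -(addn0 N) TN.
rewrite (le_trans H)// ge_max TN// andbT; nra.
Qed.

End UniformZeros.

(** [ops_root_transfer] with q = 1: for x1 beyond B, rho(x) - rho(x1) and x^2 - x1^2 have the same
    sign on the half line, because rho(y) with y >= B is at least every value taken on [0, y]. *)
Lemma half_line_root_bound (T : nat -> R) :
  (forall x, D x <-> 0 <= x) ->
  {homo T : i j / (i <= j)%N >-> i <= j} -> (forall N, 0 <= T N) ->
  (forall N y, root (L N) y -> `|y| <= T N) ->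
  exists B : R, forall N x1, root (P N) x1 -> `|x1| <= Num.max B (T (N + m.+1)%N).
Proof.
move=> DP T_homo T0 rootL.
have l0 : 0 < lead_coef rho.
  by apply: lead_coef_gt0 => // x x0; apply: rho_ge0; apply/DP.
have [B HB] := poly_increasing_large l0.
exists B => N x1 rx; rewrite le_max.
have x10 : 0 <= x1.
  rewrite leNgt; apply/negP => x1n; apply: (ops_root_hull posM opsP posMD rx).
  by move=> x /DP x0; rewrite (le_trans (ltW x1n)).
have [xB|Bx] := leP x1 B; first by rewrite ger0_norm// xB.
apply/orP; right.
apply: (ops_root_transfer posE opsL posM opsP posED posMD EM (oner_neq0 _) _ rx (N := (N + m.+1)%N)).
- by move=> x; rewrite hornerC.
- by rewrite mulr1 rho_ge0//; apply/DP.
- move=> x /DP x0; rewrite mulr1.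
  have [xx|/ltW xx] := leP x x1.
    rewrite mulr_le0//; first by rewrite subr_le0; apply: lerXn2r; rewrite ?nnegrE.
    by rewrite subr_le0; apply: HB => //; exact: ltW.
  apply: mulr_ge0; first by rewrite subr_ge0; apply: lerXn2r; rewrite ?nnegrE.
  by rewrite subr_ge0; apply: HB => //; rewrite (le_trans (ltW Bx)).
- exact: T0.
- by rewrite size_poly1 doubleD -addnn leq_add2l.
- exact: rootL.
Qed.

(* rho(x) rho(-x) is a polynomial in x^2, which takes the role of rho itself. *)
Lemma full_line_root_bound (T : nat -> R) :
  (forall x, D x) ->
  {homo T : i j / (i <= j)%N >-> i <= j} -> (forall N, 0 <= T N) ->
  (forall N y, root (L N) y -> `|y| <= T N) ->
  exists B : R, forall N x1, root (P N) x1 -> `|x1| <= Num.max B (T (N + m.+1)%N).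
Proof.
move=> DP T_homo T0 rootL; pose q := rho \Po (- 'X).
have qx x : q.[x] = rho.[- x] by rewrite horner_comp hornerN hornerX.
have sq : size q = m.+1 by rewrite size_comp_poly2 ?size_polyN ?size_polyX.
have q0 : q != 0 by rewrite -size_poly_eq0 sq.
(* Even and odd parts give rho(x) rho(-x) = e(x^2)^2 - x^2 o(x^2)^2, that is, G at x^2. *)
pose e := even_poly rho; pose o := odd_poly rho; pose G := e ^+ 2 - 'X * o ^+ 2.
have GE x : (rho * q).[x] = G.[x ^+ 2].
  have rE y : rho.[y] = e.[y ^+ 2] + o.[y ^+ 2] * y.
    by rewrite -{1}(poly_even_odd rho) !hornerE !horner_comp !hornerE.
  by rewrite hornerM qx !rE sqrrN /G hornerD hornerN !hornerM hornerX; ring.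
have G0 : G != 0.
  apply/eqP => G0; have : rho * q != 0 by rewrite mulf_neq0.
  move=> /negP; apply; rewrite -size_poly_eq0; apply/negPn/negP => s0.
  have : rho * q = 0.
    apply: (@roots_geq_poly_eq0 _ _ (map (fun k : nat => k%:R) (iota 0 (size (rho * q)%R)))).
    - by apply/allP => x _; rewrite /root GE G0 horner0.
    - by rewrite map_inj_uniq ?iota_uniq// => i j /eqP; rewrite eqr_nat => /eqP.
    - by rewrite size_map size_iota.
  by move=> rq; rewrite rq size_poly0 in s0.
have l0 : 0 < lead_coef G.
  apply: lead_coef_gt0 => // x x0; rewrite -(sqr_sqrtr x0) -GE hornerM qx.
  by rewrite mulr_ge0 ?rho_ge0.
have [B HB] := poly_increasing_large l0.
(* From |x1| > 1 + |B| follows x1^2 >= B, as the argument of G is a square. *)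
exists (1 + `|B|) => N x1 rx; rewrite le_max.
have [xB|Bx] := leP `|x1| (1 + `|B|); first by [].
apply/orP; right.
have x1B : B <= x1 ^+ 2.
  rewrite -[x1 ^+ 2](real_normK (num_real x1)).
  have BB := ler_norm B; have B0 := normr_ge0 B; nra.
apply: (ops_root_transfer posE opsL posM opsP posED posMD EM q0 _ rx (N := (N + m.+1)%N)).
- by move=> x; rewrite qx rho_ge0.
- by rewrite hornerM qx mulr_ge0 ?rho_ge0.
- move=> x _; rewrite !GE; have [xx|/ltW xx] := leP (x ^+ 2) (x1 ^+ 2).
    by rewrite mulr_le0// subr_le0// HB// sqr_ge0.
  by rewrite mulr_ge0// subr_ge0// HB ?sqr_ge0// (le_trans x1B).
- exact: T0.
- by rewrite sq doubleD leq_add2l -addnn leq_addr.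
- exact: rootL.
Qed.

Section Laguerre.
Context (t : R) (pearsonE : pearson E 0 1 t) (DP : forall x, D x <-> 0 <= x).
Let c (n : nat) : R := 4 * n%:R.
Let T (N : nat) : R := 4 * N%:R + 3 * `|t|.

Lemma laguerre_c_large (A : R) : exists n0, forall n, (n0 <= n)%N -> A <= c n.
Proof.
have [n0 H] := large_nat A; exists n0 => n /H; rewrite /c => An.
by have := ler0n R n; lra.
Qed.

(** [ops_root_le] with A = |t| + 2 n and s = n + |t| + 1 gives 4 n + 3 |t| + 2 for L n.+1, whence
    the form of [T]. *)
Lemma laguerre_rootL N y : root (L N) y -> `|y| <= T N.
Proof.
case: N => [|n]; first by rewrite ops0_root.
move=> ry; have t0 := normr_ge0 t; have tt := ler_norm t.
have tt' : - t <= `|t| by rewrite -normrN ler_norm.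
have n0 : 0 <= n%:R :> R by [].
have s0 : 0 < n%:R + `|t| + 1 :> R by lra.
rewrite (le_trans (ops_root_le posE opsL pearsonE (A := `|t| + 2 * n%:R) s0 ry _ _))//.
- move=> k kn; rewrite /rec_a mulr1 (le_trans (ler_normD _ _))// lerD2l.
  by rewrite normrM !ger0_norm// ler_wpM2l// ler_nat.
- move=> k /andP[k0 kn]; rewrite /rec_b add0r mul1r mul1r.
  have kn' : k%:R <= n%:R :> R by rewrite ler_nat.
  have k1 : k.-1%:R <= k%:R :> R by rewrite ler_nat leq_pred.
  have k0' : 0 <= k%:R :> R by []. have k10 : 0 <= k.-1%:R :> R by [].
  nra.
- by rewrite /T -natr1; lra.
Qed.

Lemma laguerre_T_homo : {homo T : i j / (i <= j)%N >-> i <= j}.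
Proof. by move=> i j ij; rewrite /T lerD2r ler_wpM2l// ler_nat. Qed.

Lemma laguerre_T_ge0 N : 0 <= T N. Proof. by rewrite addr_ge0 ?mulr_ge0. Qed.

Lemma laguerre_Tc (eps : R) r : 0 < eps -> exists n0, forall n, (n0 <= n)%N ->
  T (n + r)%N <= (1 + eps) * c n.
Proof.
move=> eps0; have [n0 H] := large_nat ((4 * r%:R + 3 * `|t|) / eps).
exists n0 => n /H; rewrite ler_pdivrMr// /T /c natrD => Hn.
by have := ler0n R n; nra.
Qed.

Lemma laguerre_zeros_near (eps : R) r : 0 < eps -> exists n0, forall n, (n0 <= n)%N ->
  forall N y, (N <= n + r)%N -> root (L N) y || root (P N) y ->
  0 - eps <= y / c n <= 1 + eps.
Proof.
move=> eps0.
have rP := half_line_root_bound DP laguerre_T_homo laguerre_T_ge0 laguerre_rootL.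
have [n0 H] := zeros_scaled_le laguerre_T_homo laguerre_rootL laguerre_c_large laguerre_Tc rP r eps0.
exists n0 => n n0n N y Nn ry; have [c0 yc] := H n n0n N y Nn ry.
have y0 : 0 <= y.
  rewrite leNgt; apply/negP => yn.
  have yD x : D x -> y <= x by move=> /DP x0; rewrite (le_trans (ltW yn)).
  by case/orP: ry => [/(ops_root_hull posE opsL posED)|/(ops_root_hull posM opsP posMD)]; apply.
rewrite ler_pdivrMr// (le_trans (ler_norm _) yc) andbT.
by apply: (@le_trans _ _ 0); [lra | rewrite divr_ge0// ltW].
Qed.

Lemma laguerre_norm_growth : exists kap : R, [/\ 0 < kap, kap <= 1 & exists n0,
  forall n, (n0 <= n)%N -> forall j, (n - m <= j < n + m)%N ->
  kap * c n ^+ 2 * E (L j * L j) <= E (L j.+1 * L j.+1)].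
Proof.
(* For large n, j + 1 >= n / 2 and j + t >= n / 4, so rec_b j.+1 >= n^2 / 8 = (4 n)^2 / 128. *)
exists (128^-1); split; [by rewrite invr_gt0 | by rewrite invf_le1// ler1n | ].
have [n0 H] := large_nat (4 * `|t| + 2 * m%:R).
exists n0 => n /H Hn j /andP[nj _]; rewrite (ops_norm_rec posE opsL pearsonE).
have N0 : 0 < E (L j * L j) := ops_norm_gt0 posE opsL j.
rewrite ler_pM2r// /rec_b /= add0r mul1r mul1r /c.
have nj' : n%:R <= j%:R + m%:R :> R by rewrite -natrD ler_nat addnC -leq_subLR.
have t0 := normr_ge0 t; have tt : - t <= `|t| by rewrite -normrN ler_norm.
have m0 : 0 <= m%:R :> R by [].
have -> : 128^-1 * (4 * n%:R) ^+ 2 = (n%:R / 2) * (n%:R / 4) :> R by field.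
by rewrite -[j.+1%:R]natr1; apply: ler_pM; rewrite ?divr_ge0//; lra.
Qed.

(** Divide [ops_psum] by n c^(k + 1) with c = 4 n: the convolution receives the factor 1 / 4, and
    the terms with coefficient t - (k + 1) keep an extra 1 / n, which is [e]. *)
Lemma laguerre_mom_cvg (mom : nat -> R) : mom 0%N = 1 ->
  (forall k, mom k.+1 = 4^-1 * \sum_(i < k.+1) mom (k - i)%N * mom i) ->
  forall s : nat -> seq R, (forall n, L n = \prod_(y <- s n) ('X - y%:P)) ->
  forall k, psum (s n) k / (n%:R * c n ^+ k) @[n --> \oo] --> mom k.
Proof.
move=> mom0 momS s Ls.
pose a n k := psum (s n) k / (n%:R * c n ^+ k).
pose e (n k : nat) : R := (t - k.+1%:R) / 4 * n%:R^-1.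
apply: (@moment_recursion_limit R 1 mom a e) => //.
- move=> k; rewrite ltnS leqn0 => /eqP ->; rewrite mom0.
  apply: cvg_near_cst; exists 1%N => // n /= n0; rewrite /a /psum.
  rewrite (eq_bigr (fun=> 1)) => [|y _]; last by rewrite expr0.
  rewrite expr0 mulr1 big_const_seq count_predT iter_addr addr0 (size_zeros opsL (Ls n)).
  by rewrite divff// pnatr_eq0 -lt0n.
- by move=> k; rewrite addn1.
- move=> k; rewrite -(mulr0 ((t - k.+1%:R) / 4)); apply: cvgMl_tmp.
  exact: cvg_natV.
- exists 1%N => n n0 k; rewrite addn1 /a /e.
  have n1 : n%:R != 0 :> R by rewrite pnatr_eq0 -lt0n.
  have cn : c n != 0 by rewrite mulf_neq0.
  rewrite (ops_psum posE opsL pearsonE k (Ls n)) mul0r addr0 mul1r /=.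
  have -> : \sum_(i < k.+1) psum (s n) (k - i) / (n%:R * c n ^+ (k - i)) *
      (psum (s n) i / (n%:R * c n ^+ i)) =
     (n%:R ^+ 2 * c n ^+ k)^-1 * \sum_(i < k.+1) psum (s n) (k - i) * psum (s n) i.
    rewrite mulr_sumr; apply: eq_bigr => i _.
    have -> : c n ^+ k = c n ^+ (k - i) * c n ^+ i by rewrite -exprD subnK// -ltnS.
    by field; rewrite n1 !expf_neq0.
  have cE : c n = 4 * n%:R by [].
  rewrite (_ : \sum_(i < k.+1) psum (s n) (k.+1 - i.+1) * psum (s n) i =
    \sum_(i < k.+1) psum (s n) (k - i) * psum (s n) i) //.
  set X := \sum_(_ < _) _; set S := psum (s n) k.
  rewrite exprS; move: (c n ^+ k) (expf_neq0 k cn) => d d0; rewrite cE.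
  by field; rewrite n1 d0.
Qed.

End Laguerre.

Section Hermite.
Context (pearsonE : pearson E 2^-1 0 0) (DP : forall x, D x).
Let c (n : nat) : R := Num.sqrt (2 * n%:R).
Let T (N : nat) : R := Num.sqrt (2 * N%:R).

Lemma hermite_c_large (A : R) : exists n0, forall n, (n0 <= n)%N -> A <= c n.
Proof.
have [n0 H] := large_nat (A ^+ 2); exists n0 => n /H; rewrite /c => An.
rewrite (le_trans (ler_norm _))// -sqrtr_sqr ler_wsqrtr//.
by have := ler0n R n; lra.
Qed.

Lemma hermite_rootL N y : root (L N) y -> `|y| <= T N.
Proof.
case: N => [|n]; first by rewrite ops0_root.
move=> ry; have s0 : 0 < T n.+1 / 2 by rewrite divr_gt0// sqrtr_gt0 mulr_gt0.
rewrite (le_trans (ops_root_le posE opsL pearsonE (A := 0) s0 ry _ _))//.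
- by move=> k _; rewrite /rec_a mulr0 mul0r addr0 normr0.
- move=> k /andP[k0 kn]; rewrite /rec_b mul0r addr0 expr_div_n sqr_sqrtr ?mulr_ge0//.
  have kn' : k%:R <= n.+1%:R :> R by rewrite ler_nat leqW.
  lra.
- lra.
Qed.

Lemma hermite_T_homo : {homo T : i j / (i <= j)%N >-> i <= j}.
Proof. by move=> i j ij; rewrite /T ler_wsqrtr// ler_wpM2l// ler_nat. Qed.

Lemma hermite_T_ge0 N : 0 <= T N. Proof. exact: sqrtr_ge0. Qed.

Lemma hermite_Tc (eps : R) r : 0 < eps -> exists n0, forall n, (n0 <= n)%N ->
  T (n + r)%N <= (1 + eps) * c n.
Proof.
move=> eps0; have [n0 H] := large_nat (r%:R / eps).
exists n0 => n /H; rewrite ler_pdivrMr// /T /c natrD => Hn.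
have n0' := ler0n R n; have e1 : 0 <= 1 + eps by lra.
rewrite -(ger0_norm e1) -sqrtr_sqr -sqrtrM ?sqr_ge0// ler_wsqrtr//.
rewrite (_ : (1 + eps) ^+ 2 = 1 + 2 * eps + eps ^+ 2); last by ring.
by have := sqr_ge0 eps; nra.
Qed.

Lemma hermite_zeros_near (eps : R) r : 0 < eps -> exists n0, forall n, (n0 <= n)%N ->
  forall N y, (N <= n + r)%N -> root (L N) y || root (P N) y ->
  - 1 - eps <= y / c n <= 1 + eps.
Proof.
move=> eps0.
have rP := full_line_root_bound DP hermite_T_homo hermite_T_ge0 hermite_rootL.
have [n0 H] := zeros_scaled_le hermite_T_homo hermite_rootL hermite_c_large hermite_Tc rP r eps0.
exists n0 => n n0n N y Nn ry; have [c0 yc] := H n n0n N y Nn ry.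
rewrite ler_pdivrMr// ler_pdivlMr//; move: yc; rewrite ler_norml => /andP[H1 H2].
by rewrite H2 andbT; move: H1; congr (_ <= _); ring.
Qed.

Lemma hermite_norm_growth : exists kap : R, [/\ 0 < kap, kap <= 1 & exists n0,
  forall n, (n0 <= n)%N -> forall j, (n - m <= j < n + m)%N ->
  kap * c n ^+ 2 * E (L j * L j) <= E (L j.+1 * L j.+1)].
Proof.
(* For large n, rec_b j.+1 = (j + 1) / 2 is at least n / 4 = (2 n) / 8. *)
exists (8^-1); split; [by rewrite invr_gt0 | by rewrite invf_le1// ler1n | ].
have [n0 H] := large_nat (2 * m%:R).
exists n0 => n /H Hn j /andP[nj _]; rewrite (ops_norm_rec posE opsL pearsonE).
have N0 : 0 < E (L j * L j) := ops_norm_gt0 posE opsL j.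
rewrite ler_pM2r// /rec_b /= mul0r addr0 /c sqr_sqrtr ?mulr_ge0//.
have nj' : n%:R <= j%:R + m%:R :> R by rewrite -natrD ler_nat addnC -leq_subLR.
have m0 : 0 <= m%:R :> R by [].
by rewrite -[j.+1%:R]natr1; lra.
Qed.

(** Now c^2 = 2 n, and the recurrence advances by two indices, so two starting values are needed;
    the first power sum is exactly 0. *)
Lemma hermite_mom_cvg (mom : nat -> R) : mom 0%N = 1 -> mom 1%N = 0 ->
  (forall k, mom k.+2 = 4^-1 * \sum_(i < k.+1) mom (k - i)%N * mom i) ->
  forall s : nat -> seq R, (forall n, L n = \prod_(y <- s n) ('X - y%:P)) ->
  forall k, psum (s n) k / (n%:R * c n ^+ k) @[n --> \oo] --> mom k.
Proof.
move=> mom0 mom1 momS s Ls.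
pose a n k := psum (s n) k / (n%:R * c n ^+ k).
pose e (n k : nat) : R := - k.+1%:R / 4 * n%:R^-1.
have rec n k := ops_psum posE opsL pearsonE k (Ls n).
apply: (@moment_recursion_limit R 2 mom a e) => //.
- move=> [_|[_|//]].
    rewrite mom0; apply: cvg_near_cst; exists 1%N => // n /= n0; rewrite /a /psum.
    rewrite (eq_bigr (fun=> 1)) => [|y _]; last by rewrite expr0.
    rewrite expr0 mulr1 big_const_seq count_predT iter_addr addr0 (size_zeros opsL (Ls n)).
    by rewrite divff// pnatr_eq0 -lt0n.
  rewrite mom1; apply: cvg_near_cst; exists 0%N => // n _.
  by rewrite /a (rec n 0%N) big_ord0 /= !mul0r subr0 mulr0 !addr0 mul0r.
- by move=> k; rewrite addn2.
- move=> k; rewrite -(mulr0 (- k.+1%:R / 4)); apply: cvgMl_tmp.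
  exact: cvg_natV.
- exists 1%N => n n0 k; rewrite addn2 /a /e.
  have n1 : n%:R != 0 :> R by rewrite pnatr_eq0 -lt0n.
  have cn : c n != 0 by rewrite gt_eqF// sqrtr_gt0 mulr_gt0// ltr0n.
  rewrite (rec n k.+1) mul0r !mul0r addr0 add0r /=.
  have -> : \sum_(i < k.+1) psum (s n) (k - i) / (n%:R * c n ^+ (k - i)) *
      (psum (s n) i / (n%:R * c n ^+ i)) =
     (n%:R ^+ 2 * c n ^+ k)^-1 * \sum_(i < k.+1) psum (s n) (k - i) * psum (s n) i.
    rewrite mulr_sumr; apply: eq_bigr => i _.
    have -> : c n ^+ k = c n ^+ (k - i) * c n ^+ i by rewrite -exprD subnK// -ltnS.
    by field; rewrite n1 !expf_neq0.
  have cE : c n ^+ 2 = 2 * n%:R by rewrite sqr_sqrtr// mulr_ge0.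
  rewrite (_ : \sum_(i < k.+1) psum (s n) (k.+1 - i.+1) * psum (s n) i =
    \sum_(i < k.+1) psum (s n) (k - i) * psum (s n) i) //.
  set X := \sum_(_ < _) _; set S := psum (s n) k.
  have -> : c n ^+ k.+2 = c n ^+ k * (2 * n%:R) by rewrite -cE -exprD addn2.
  move: (c n ^+ k) (expf_neq0 k cn) => d d0.
  by field; rewrite n1 d0.
Qed.

End Hermite.

End ScaleEstimates.

(** * Moments of the limit measure *)

Section OpenInterval.
Context {R : realType} (lo hi : R) (lohi : lo < hi).
Local Notation leb := (@lebesgue_measure R).

(** The distance to the end is (hi - lo) / (n + 3), at most a third of the length, so the closed
    intervals are nondegenerate from n = 0 on. *)
Definition itv_lb n : R := lo + (hi - lo) * harmonic n.+2.
Definition itv_ub n : R := hi - (hi - lo) * harmonic n.+2.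

Let harm_gt0 n : 0 < (hi - lo) * harmonic n.+2.
Proof. by rewrite mulr_gt0 ?subr_gt0// invr_gt0 ltr0n. Qed.

Let harm_cvg0 : (hi - lo) * harmonic n.+2 @[n --> \oo] --> 0.
Proof.
rewrite -[X in _ --> X](mulr0 (hi - lo)); apply: cvgMr.
have h1 : harmonic n.+1 @[n --> \oo] --> (0 : R).
  by have := @cvg_harmonic R; rewrite -(cvg_shiftS (@harmonic R)).
by rewrite -(cvg_shiftS (fun n => @harmonic R n.+1)) in h1.
Qed.

Lemma itv_lb_cvg : itv_lb n @[n --> \oo] --> lo.
Proof. by rewrite -[X in _ --> X](addr0 lo); apply: cvgD; [exact: cvg_cst|exact: harm_cvg0]. Qed.

Lemma itv_ub_cvg : itv_ub n @[n --> \oo] --> hi.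
Proof. by rewrite -[X in _ --> X](subr0 hi); apply: cvgB; [exact: cvg_cst|exact: harm_cvg0]. Qed.

Let harm_homo i j : (i <= j)%N -> (hi - lo) * harmonic j.+2 <= (hi - lo) * harmonic i.+2.
Proof.
move=> ij; rewrite ler_wpM2l//; first by rewrite subr_ge0 ltW.
by rewrite /harmonic lef_pV2 ?posrE// ler_nat !ltnS.
Qed.

Let bigcup_itv : `]lo, hi[%classic = \bigcup_n `[itv_lb n, itv_ub n]%classic.
Proof.
apply/seteqP; split => x /=; last first.
  move=> [n _] /=; rewrite !in_itv /= /itv_lb /itv_ub => /andP[? ?].
  by have := harm_gt0 n => ?; apply/andP; split; lra.
rewrite in_itv /= => /andP[lx xh].
have : \forall n \near \oo, itv_lb n < x /\ x < itv_ub n.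
  by near=> n; split; near: n; [exact: (cvgr_lt _ itv_lb_cvg)|exact: (cvgr_gt _ itv_ub_cvg)].
move=> [n _ /(_ n (leqnn n))[? ?]]; exists n => //=.
by rewrite in_itv /= !ltW.
Unshelve. all: by end_near.
Qed.

Context (f F : R -> R) (A B : R).
Context (dF : forall x, lo < x < hi -> is_derive x 1 F (f x)).
Context (cf : forall x, lo < x < hi -> {for x, continuous f}).
Context (Fu : F (itv_lb n) @[n --> \oo] --> A) (Fv : F (itv_ub n) @[n --> \oo] --> B).

Let lb_lt n : itv_lb n < itv_ub n.
Proof.
have : harmonic n.+2 <= 3^-1 :> R by rewrite lef_pV2 ?posrE// ler_nat.
have l : 0 < hi - lo by rewrite subr_gt0.
rewrite /itv_lb /itv_ub; set h := harmonic _ => H; nra.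
Qed.

Let lb_homo : {homo itv_lb : m n / (m <= n)%N >-> n <= m}.
Proof. by move=> i j ij; rewrite lerD2l harm_homo. Qed.

Let ub_homo : {homo itv_ub : m n / (m <= n)%N >-> m <= n}.
Proof. by move=> i j ij; rewrite lerD2l lerN2 harm_homo. Qed.

Lemma ge0_itv_FTC2 : (forall x, lo < x < hi -> 0 <= f x) ->
  (\int[leb]_(x in `]lo, hi[) (f x)%:E = (B - A)%:E)%E.
Proof.
move=> f0; apply: (ge0_improper_FTC2 lb_lt lb_homo ub_homo bigcup_itv _ _ Fu Fv) => x /=; rewrite in_itv.
- exact: cf.
- exact: f0.
Qed.

Lemma itv_FTC2 : leb.-integrable `]lo, hi[ (EFin \o f) ->
  (\int[leb]_(x in `]lo, hi[) (f x)%:E = (B - A)%:E)%E.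
Proof.
move=> intf; apply: (improper_FTC2 lb_lt lb_homo ub_homo bigcup_itv _ _ Fu Fv intf) => x /=; rewrite in_itv.
- exact: cf.
Qed.

End OpenInterval.

Section NuMoments.
Context {R : realType}.
Local Notation leb := (@lebesgue_measure R).
Implicit Types (c : weight_case R) (t x : R).

Definition nu_full c t : R := nu_density c t * \1_(Delta_c c) t.
Definition nu_lo c : R := if c is Laguerre _ then 0 else -1.

Lemma nu_lo_lt1 c : nu_lo c < 1.
Proof. by case: c => /=; [|lra]. Qed.

Lemma Delta_cE c : Delta_c c = `[nu_lo c, 1]%classic.
Proof. by case: c. Qed.

Lemma measurable_nu_full c : measurable_fun [set: R] (nu_full c).
Proof. by apply/measurable_EFinP; exact: (measurable_nu_density c). Qed.

Lemma nu_full_ge0 c t : 0 <= nu_full c t.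
Proof. exact: nu_density_ge0. Qed.

Lemma integral_nu_full c (f : R -> R) : measurable_fun [set: R] f ->
  (\int[leb]_t (f t * nu_full c t)%:E =
   \int[leb]_(t in `]nu_lo c, 1%R[) (f t * nu_density c t)%:E)%E.
Proof.
move=> mf; have mfn : measurable_fun [set: R] (fun t => f t * nu_full c t).
  by apply: measurable_funM => //; exact: measurable_nu_full.
transitivity (\int[leb]_(t in `]nu_lo c, 1%R[) (f t * nu_full c t)%:E)%E; last first.
  apply: eq_integral => t; rewrite inE /= in_itv /= => /andP[? ?].
  by rewrite /nu_full indicE mem_set ?mulr1// Delta_cE /= in_itv /= !ltW.
rewrite -(@integral_itv_bndoo _ _ _ _ true false); last first.
  by apply/measurable_EFinP/measurable_funTS.
rewrite -Delta_cE [RHS]integral_mkcond; apply: eq_integral => t _.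
by rewrite patchE /nu_full; case: ifPn => [//|H]; rewrite indicE (negbTE H) !mulr0.
Qed.

Lemma sqrt_ratio t : 0 < t < 1 ->
  Num.sqrt ((1 - t) / t) = (1 - t) / Num.sqrt (t * (1 - t)).
Proof.
move=> /andP[t0 t1]; have t1' : 0 < 1 - t by lra.
have p0 : 0 < t * (1 - t) by rewrite mulr_gt0.
set r := Num.sqrt (t * (1 - t)); have r0 : 0 < r by rewrite sqrtr_gt0.
have -> : (1 - t) / t = ((1 - t) / r) ^+ 2.
  by rewrite expr_div_n sqr_sqrtr ?ltW//; field; rewrite !gt_eqF.
by rewrite sqrtr_sqr ger0_norm// divr_ge0// ltW.
Qed.

Lemma is_derive_sqrt_prod t : 0 < t < 1 ->
  is_derive t 1 (fun t => Num.sqrt (t * (1 - t))) ((1 - 2 * t) / (2 * Num.sqrt (t * (1 - t)))).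
Proof.
move=> /andP[t0 t1]; have p0 : 0 < t * (1 - t) by rewrite mulr_gt0// subr_gt0.
have p0' : 0 < ('X * (1 - 'X) : {poly R}).[t] by rewrite !hornerE.
have := is_derive1_comp (is_derive1_sqrt p0') (is_derive_poly ('X * (1 - 'X)) t).
rewrite (_ : _ \o _ = (fun t => Num.sqrt (t * (1 - t)))); last first.
  by apply/funext => x /=; rewrite !hornerE.
move=> /is_derive_eq; apply; rewrite !poly.derivE !hornerE.
have s0 : Num.sqrt (t * (1 - t)) != 0 by rewrite gt_eqF// sqrtr_gt0.
by field.
Qed.

Lemma is_derive_sqrt_sqr t : - 1 < t < 1 ->
  is_derive t 1 (fun t => Num.sqrt (1 - t ^+ 2)) (- t / Num.sqrt (1 - t ^+ 2)).
Proof.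
move=> /andP[t0 t1]; have p0 : 0 < 1 - t ^+ 2 by nra.
have p0' : 0 < (1 - 'X ^+ 2 : {poly R}).[t] by rewrite !hornerE.
have := is_derive1_comp (is_derive1_sqrt p0') (is_derive_poly (1 - 'X ^+ 2) t).
rewrite (_ : _ \o _ = (fun t => Num.sqrt (1 - t ^+ 2))); last first.
  by apply/funext => x /=; rewrite !hornerE.
move=> /is_derive_eq; apply; rewrite !poly.derivE !hornerE /=.
have s0 : Num.sqrt (1 - t ^+ 2) != 0 by rewrite gt_eqF// sqrtr_gt0.
by field.
Qed.

Lemma is_derive_atan_ratio t : 0 < t < 1 ->
  is_derive t 1 (fun t => atan (Num.sqrt ((1 - t) / t))) (- (2 * Num.sqrt (t * (1 - t)))^-1).
Proof.
move=> t01; have /andP[t0 t1] := t01; have p0 : 0 < t * (1 - t) by rewrite mulr_gt0// subr_gt0.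
have q0 : 0 < (1 - t) / t by rewrite divr_gt0// subr_gt0.
have X0 : ('X : {poly R}).[t] != 0 by rewrite hornerX gt_eqF.
have dq := is_deriveM (is_derive_poly (1 - 'X) t) (is_deriveV X0 (is_derive_poly 'X t)).
have q0' : 0 < (horner (1 - 'X) * (fun y => ('X : {poly R}).[y]^-1)) t.
  by rewrite mulrfctE !hornerE.
have := is_derive1_comp (is_derive1_atan _) (is_derive1_comp (is_derive1_sqrt q0') dq).
rewrite (_ : _ \o _ = (fun t => atan (Num.sqrt ((1 - t) / t)))); last first.
  by apply/funext => x /=; rewrite mulrfctE !hornerE.
move=> /is_derive_eq; apply; rewrite !poly.derivE !mulrfctE /GRing.scale /= !hornerE /=.
have r0 : 0 < Num.sqrt (t * (1 - t)) by rewrite sqrtr_gt0.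
have rE := sqr_sqrtr (ltW p0).
rewrite sqr_sqrtr ?ltW// sqrt_ratio//; set r := Num.sqrt (t * (1 - t)) in r0 rE *.
have -> : 1 + (1 - t) / t = t^-1 by field; rewrite gt_eqF.
have t1' : 0 < 1 - t by lra.
transitivity (- r / (2 * (t * (1 - t)))); first by field; rewrite !gt_eqF.
by rewrite -rE; field; rewrite gt_eqF.
Qed.

Let lb01 n : itv_lb 0 1 n = harmonic n.+2 :> R.
Proof. by rewrite /itv_lb subr0 mul1r add0r. Qed.

Lemma atan_ratio_lb_cvg :
  atan (Num.sqrt ((1 - itv_lb 0 1 n) / itv_lb 0 1 n)) @[n --> \oo] --> (pi / 2 : R).
Proof.
have E n : Num.sqrt ((1 - itv_lb 0 1 n) / itv_lb 0 1 n) = Num.sqrt (n.+2%:R : R).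
  rewrite lb01 /harmonic invrK mulrBl mul1r mulVf ?pnatr_eq0//.
  by rewrite -(natr1 n.+2) addrK.
under eq_fun do rewrite E.
have : Num.sqrt (n.+2%:R : R) @[n --> \oo] --> +oo.
  apply/cvgryPge => A; exists (Num.bound (A ^+ 2)) => // n /= An.
  rewrite (le_trans (ler_norm A))// -sqrtr_sqr ler_wsqrtr// ltW//.
  apply: lt_le_trans (archi_boundP (sqr_ge0 A)) _.
  by rewrite ler_nat (leq_trans An)// leqW.
by move=> H; apply: cvg_comp H _; exact: cvgy_atan.
Qed.

Let ub01_cvg := @itv_ub_cvg R 0 1.

Lemma atan_ratio_ub_cvg :
  atan (Num.sqrt ((1 - itv_ub 0 1 n) / itv_ub 0 1 n)) @[n --> \oo] --> (0 : R).
Proof.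
have : (1 - itv_ub 0 1 n) / itv_ub 0 1 n @[n --> \oo] --> ((1 - 1) / 1 : R).
  apply: cvgM; first by apply: cvgB; [exact: cvg_cst | exact: ub01_cvg].
  by apply: cvgV; [exact: oner_neq0 | exact: ub01_cvg].
rewrite subrr mul0r => H.
rewrite -[X in _ --> X](_ : atan (Num.sqrt 0) = 0); last by rewrite sqrtr0 atan0.
apply: (cvg_comp _ _ (cvg_comp _ _ H _)); last exact: continuous_atan.
exact: sqrt_continuous.
Qed.

Let pi0 : pi != 0 :> R. Proof. by rewrite gt_eqF// pi_gt0. Qed.

Lemma nu_density_continuous c t : nu_lo c < t < 1 -> {for t, continuous (nu_density c)}.
Proof.
move=> /andP[lt t1]; apply: cvgM; first exact: cvg_cst.
case: c lt => [al|] /= lt.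
  apply: (@continuous_comp _ _ _ (fun t => (1 - t) / t) Num.sqrt); last exact: sqrt_continuous.
  apply: cvgM; first by apply: cvgB; [exact: cvg_cst | exact: cvg_id].
  by apply: cvgV; [rewrite gt_eqF | exact: cvg_id].
apply: (@continuous_comp _ _ _ (fun t => 1 - t ^+ 2) Num.sqrt); last exact: sqrt_continuous.
by apply: cvgB; [exact: cvg_cst | exact: exprn_continuous].
Qed.

Let sqrt_prod_cvg (u : nat -> R) (a : R) : u n @[n --> \oo] --> a -> a * (1 - a) = 0 ->
  Num.sqrt (u n * (1 - u n)) @[n --> \oo] --> (0 : R).
Proof.
move=> ua a0; have : u n * (1 - u n) @[n --> \oo] --> a * (1 - a).
  by apply: cvgM => //; apply: cvgB => //; exact: cvg_cst.
rewrite a0 -[X in _ -> _ --> X](@sqrtr0 R) => H.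
by apply: (cvg_comp _ _ H); exact: sqrt_continuous.
Qed.

Let lb01_cvg := @itv_lb_cvg R 0 1.

(** An explicit primitive: (2 / pi) (sqrt (t (1 - t)) - atan (sqrt ((1 - t) / t))) for Laguerre, and
    a similar one in (1 + t) / 2 for Hermite. It tends to -1 at the left end and to 0 at the right
    end. *)
Lemma nu_mass c : (\int[leb]_t (nu_full c t)%:E = 1)%E.
Proof.
transitivity (\int[leb]_t (cst 1 t * nu_full c t)%:E)%E.
  by apply: eq_integral => t _; rewrite mul1r.
rewrite integral_nu_full//.
under eq_integral do rewrite mul1r.
have d0 t : nu_lo c < t < 1 -> 0 <= nu_density c t.
  move=> /andP[? ?]; have := nu_full_ge0 c t.
  by rewrite /nu_full indicE mem_set ?mulr1// Delta_cE /= in_itv /= !ltW.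
have e1 : 1 = 2 / pi * 0 - 2 / pi * (- (pi / 2)) :> R by rewrite mulr0 mulrN sub0r opprK mulrA divfK ?divff// pi0.
case: c d0 => [al|] /= d0; rewrite [X in _ = X%:E]e1.
  pose F t := 2 / pi * (Num.sqrt (t * (1 - t)) - atan (Num.sqrt ((1 - t) / t))).
  have dF (t : R) : 0 < t < 1 -> is_derive t 1 F (nu_density (Laguerre al) t).
    move=> t01; have := is_deriveZ (2 / pi)
      (is_deriveB (is_derive_sqrt_prod t01) (is_derive_atan_ratio t01)).
    move=> /is_derive_eq; apply; rewrite /nu_density sqrt_ratio// /GRing.scale /=; congr (_ * _).
    have r0 : Num.sqrt (t * (1 - t)) != 0.
      by have /andP[? ?] := t01; rewrite gt_eqF// sqrtr_gt0 mulr_gt0// subr_gt0.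
    by field.
  have Flb : F (itv_lb 0 1 n) @[n --> \oo] --> 2 / pi * (- (pi / 2)).
    apply: cvgMr; rewrite -[X in _ --> X](add0r); apply: cvgB; last exact: atan_ratio_lb_cvg.
    by apply: sqrt_prod_cvg lb01_cvg _; rewrite mul0r.
  have Fub : F (itv_ub 0 1 n) @[n --> \oo] --> 2 / pi * 0.
    apply: cvgMr; rewrite -[X in _ --> X](subr0 0); apply: cvgB; last exact: atan_ratio_ub_cvg.
    by apply: sqrt_prod_cvg ub01_cvg _; rewrite subrr mulr0.
  have cd := @nu_density_continuous (Laguerre al).
  exact: (ge0_itv_FTC2 ltr01 dF cd Flb Fub d0).
(* The substitution x = (1 + t) / 2 maps [-1, 1] onto [0, 1], where the derivatives and limits
   already computed apply. *)
pose x (t : R) := (2^-1 *: (1 + 'X) : {poly R}).[t].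
have xE t : x t = (1 + t) / 2 by rewrite /x !hornerE mulrC.
pose F t := 2 / pi * (t * Num.sqrt (x t * (1 - x t)) - atan (Num.sqrt ((1 - x t) / x t))).
have lbE n : x (itv_lb (-1) 1 n) = itv_lb 0 1 n by rewrite xE /itv_lb; field.
have ubE n : x (itv_ub (-1) 1 n) = itv_ub 0 1 n by rewrite xE /itv_ub; field.
have dF (t : R) : - 1 < t < 1 -> is_derive t 1 F (nu_density Hermite t).
  move=> t01; have x01 : 0 < x t < 1 by rewrite xE; have /andP[? ?] := t01; apply/andP; split; lra.
  have dx := is_derive_poly (2^-1 *: (1 + 'X) : {poly R}) t.
  have d1 := @is_derive1_comp R _ x _ _ _ (is_derive_sqrt_prod x01) dx.
  have d2 := @is_derive1_comp R _ x _ _ _ (is_derive_atan_ratio x01) dx.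
  have := is_deriveZ (2 / pi) (is_deriveB (is_deriveM (is_derive_poly 'X t) d1) d2).
  rewrite (_ : _ \*: _ = F); last first.
    apply/funext => y; rewrite /F -[X in X * Num.sqrt _](hornerX y).
    by [].
  move=> /is_derive_eq; apply; rewrite /nu_density /GRing.scale /=; congr (_ * _).
  rewrite !poly.derivE !hornerE /=.
  set r := Num.sqrt _.
  have r0 : 0 < r by have /andP[? ?] := x01; rewrite sqrtr_gt0 mulr_gt0// subr_gt0.
  have rr : r ^+ 2 = (1 - t ^+ 2) / 4.
    rewrite sqr_sqrtr ?xE; first by field.
    by have /andP[? ?] := t01; rewrite mulr_ge0//; lra.
  have -> : Num.sqrt (1 - t ^+ 2) = 2 * r.
    have -> : 1 - t ^+ 2 = (2 * r) ^+ 2 by rewrite exprMn rr; field.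
    by rewrite sqrtr_sqr ger0_norm// mulr_ge0// ltW.
  rewrite xE.
  have r0' : r != 0 by rewrite gt_eqF.
  transitivity (r + (1 - t ^+ 2) / 4 / r); first by field.
  by rewrite -rr; field.
have Flb : F (itv_lb (-1) 1 n) @[n --> \oo] --> 2 / pi * (- (pi / 2)).
  have E n : F (itv_lb (-1) 1 n) = 2 / pi * (itv_lb (-1) 1 n *
      Num.sqrt (itv_lb 0 1 n * (1 - itv_lb 0 1 n)) -
      atan (Num.sqrt ((1 - itv_lb 0 1 n) / itv_lb 0 1 n))) by rewrite /F lbE.
  rewrite (funext E).
  apply: cvgMr; rewrite -[X in _ --> X](add0r); apply: cvgB; last exact: atan_ratio_lb_cvg.
  rewrite -[X in _ --> X](mulr0 (-1)); apply: cvgM; first exact: itv_lb_cvg.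
  by apply: sqrt_prod_cvg lb01_cvg _; rewrite mul0r.
have Fub : F (itv_ub (-1) 1 n) @[n --> \oo] --> 2 / pi * 0.
  have E n : F (itv_ub (-1) 1 n) = 2 / pi * (itv_ub (-1) 1 n *
      Num.sqrt (itv_ub 0 1 n * (1 - itv_ub 0 1 n)) -
      atan (Num.sqrt ((1 - itv_ub 0 1 n) / itv_ub 0 1 n))) by rewrite /F ubE.
  rewrite (funext E).
  apply: cvgMr; rewrite -[X in _ --> X](subr0 0); apply: cvgB; last exact: atan_ratio_ub_cvg.
  rewrite -[X in _ --> X](mulr0 1); apply: cvgM; first exact: itv_ub_cvg.
  by apply: sqrt_prod_cvg ub01_cvg _; rewrite subrr mulr0.
exact: (ge0_itv_FTC2 (nu_lo_lt1 Hermite) dF (@nu_density_continuous Hermite) Flb Fub d0).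
Qed.

Lemma nu_poly_integrable c : poly_integrable (nu_full c).
Proof.
move=> p; have mp : measurable_fun [set: R] (EFin \o (fun x => p.[x] * nu_full c x)).
  apply/measurable_EFinP; apply: measurable_funM; first exact: measurable_horner.
  exact: measurable_nu_full.
have inu : leb.-integrable [set: R] (EFin \o nu_full c).
  by apply: integrable_of_fin_num; [exact: measurable_nu_full | rewrite nu_mass].
have ib : leb.-integrable [set: R] (fun x => (horner_bound p 1)%:E * (EFin \o nu_full c) x)%E.
  exact: integrableZl.
apply: le_integrable ib => //.
move=> x _ /=; rewrite lee_fin [leLHS]normrM [leRHS]normrM.
have [Dx|Dx] := pselect (Delta_c c x); last first.
  by rewrite /nu_full indicE memNset// mulr0 normr0 !mulr0.
rewrite ler_wpM2r//; apply: le_trans (ler_norm _); have x1 : `|x| <= 1 * 1.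
  move: Dx; rewrite Delta_cE /= in_itv /= mulr1 ler_norml => /andP[lx ->].
  by rewrite andbT (le_trans _ lx)//; case: (c) => //= _; lra.
by have := horner_boundP p (lexx 1) ler01 x1; rewrite expr1n mulr1.
Qed.

Let prim_cvg0 c (p : {poly R}) (u : nat -> R) (a : R) : u n @[n --> \oo] --> a ->
  (if c is Laguerre _ then a * (1 - a) else 1 - a ^+ 2) = 0 ->
  p.[u n] * Num.sqrt (if c is Laguerre _ then u n * (1 - u n) else 1 - u n ^+ 2)
    @[n --> \oo] --> (0 : R).
Proof.
move=> ua a0; rewrite -[X in _ --> X](mulr0 p.[a]); apply: cvgM.
  by apply: (cvg_comp _ _ ua); exact: continuous_horner.
rewrite -(@sqrtr0 R) -a0.
case: c {a0} => [_|]; (apply: (@cvg_comp _ _ _ _ Num.sqrt); last exact: sqrt_continuous).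
  by apply: cvgM => //; apply: cvgB => //; exact: cvg_cst.
by apply: cvgB; [exact: cvg_cst | exact: (cvgM ua ua)].
Qed.

(* The integrand is the derivative of q (1 - x) sqrt (x (1 - x)) in the Laguerre
   case and of q (1 - x^2) sqrt (1 - x^2) in the Hermite case. *)
Lemma nu_pearson c (N : {scalar {poly R}}) :
  (forall p, (\int[leb]_x (p.[x] * nu_full c x)%:E = (N p)%:E)%E) ->
  forall q, N (if c is Laguerre _ then 'X * (1 - 'X) * q^`() + (2^-1%:P - 2 *: 'X) * q
               else (1 - 'X ^+ 2) * q^`() - 3 *: 'X * q) = 0.
Proof.
move=> HN q; set g := (X in N X).
have ig := @nu_poly_integrable c g.
have mg : measurable_fun [set: R] (horner g) by exact: measurable_horner.
have igd : leb.-integrable `]nu_lo c, 1[ (EFin \o (fun x => g.[x] * nu_density c x)).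
  have : leb.-integrable `]nu_lo c, 1[ (EFin \o (fun x => g.[x] * nu_full c x)).
    by apply: integrableS ig.
  apply: eq_integrable => // x; rewrite inE /= in_itv /= => /andP[? ?].
  by rewrite /nu_full indicE mem_set ?mulr1// Delta_cE /= in_itv /= !ltW.
apply: EFin_inj; rewrite -HN integral_nu_full//.
have cg x : nu_lo c < x < 1 -> {for x, continuous (fun x => g.[x] * nu_density c x)}.
  by move=> x01; apply: cvgM; [exact: continuous_horner | exact: nu_density_continuous].
pose p : {poly R} := (2 / pi) *: (if c is Laguerre _ then (1 - 'X) * q else (1 - 'X ^+ 2) * q).
pose F x := p.[x] * Num.sqrt (if c is Laguerre _ then x * (1 - x) else 1 - x ^+ 2).
have Flb : F (itv_lb (nu_lo c) 1 n) @[n --> \oo] --> 0.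
  apply: prim_cvg0; first exact: itv_lb_cvg.
  by case: (c) => [_|] /=; [rewrite mul0r | rewrite sqrrN expr1n subrr].
have Fub : F (itv_ub (nu_lo c) 1 n) @[n --> \oo] --> 0.
  apply: prim_cvg0; first exact: itv_ub_cvg.
  by case: (c) => [_|] /=; [rewrite subrr mulr0 | rewrite expr1n subrr].
have dF x : nu_lo c < x < 1 -> is_derive x 1 F (g.[x] * nu_density c x).
  rewrite /F /p /g /nu_density; case: (c) => [_|] /= x01; have /andP[lx x1] := x01.
    have := is_deriveM (is_derive_poly ((2 / pi) *: ((1 - 'X) * q)) x) (is_derive_sqrt_prod x01).
    move=> /is_derive_eq; apply; rewrite sqrt_ratio// /GRing.scale /= !poly.derivE !hornerE /=.
    have x0 : 0 < x * (1 - x) by rewrite mulr_gt0// subr_gt0.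
    have rr := sqr_sqrtr (ltW x0); have r0 : Num.sqrt (x * (1 - x)) != 0.
      by rewrite gt_eqF// sqrtr_gt0.
    move: rr r0; move: (Num.sqrt _) (pi^-1) => r pV rr r0.
    have rE : r = x * (1 - x) / r by rewrite -rr; field.
    by rewrite {2}rE; field.
  have := is_deriveM (is_derive_poly ((2 / pi) *: ((1 - 'X ^+ 2) * q)) x) (is_derive_sqrt_sqr x01).
  move=> /is_derive_eq; apply; rewrite /GRing.scale /= !poly.derivE !hornerE /=.
  have x0 : 0 < 1 - x ^+ 2 by nra.
  have rr := sqr_sqrtr (ltW x0); have r0 : Num.sqrt (1 - x ^+ 2) != 0.
    by rewrite gt_eqF// sqrtr_gt0.
  move: rr r0; move: (Num.sqrt _) (pi^-1) => r pV rr r0.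
  by rewrite -{1}rr; field.
have := itv_FTC2 (nu_lo_lt1 c) dF cg Flb Fub igd.
by rewrite subr0.
Qed.

End NuMoments.

(** * From first-order recurrences of moments to convolutions *)

Section CatalanConvolution.
Context {R : realFieldType} (a : nat -> R) (a0 : a 0%N = 1).
Let D n := \sum_(i < n.+1) a (n - i)%N * a i.

(** The indices i and n - i carry the same product, so the weight i averages to n / 2. *)
Let sum_sym n : \sum_(i < n.+1) i%:R * (a (n - i)%N * a i) = n%:R / 2 * D n.
Proof.
set S := LHS; suff : S + S = n%:R * D n by move=> H; apply: (mulIf (x := 2)) => //; lra.
rewrite {2}/S (reindex_inj rev_ord_inj) -big_split /D mulr_sumr; apply: eq_bigr => i _ /=.
have i_n : (i <= n)%N by rewrite -ltnS.
by rewrite subSS subKn// natrB// (mulrC (a i)); ring.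
Qed.

Let sum_symD n (b : R) : \sum_(i < n.+1) (i%:R + b) * (a (n - i)%N * a i) = (n%:R / 2 + b) * D n.
Proof.
under eq_bigr do rewrite mulrDl.
by rewrite big_split /= sum_sym -mulr_sumr mulrDl.
Qed.

(** The solution is Catalan(k) / 4^k. By symmetry the sum of (i + 1) a_(k + 1 - i) a_i is ((k + 3) /
    2) D (k + 1); in its terms with i >= 1 the hypothesis lowers the index, which leaves ((k + 1) /
    2) D k. Induction replaces D k by 4 a_(k + 1), and D (k + 1) follows. *)
Lemma catalan_conv1 : (forall k, (k%:R + 2) * a k.+1 = (k%:R + 2^-1) * a k) ->
  forall k, a k.+1 = 4^-1 * D k.
Proof.
move=> H; elim=> [|k IH].
  by have := H 0%N; rewrite /D big_ord1 a0 !mulr1 => ?; lra.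
have S := sum_symD k.+1 1; rewrite big_ord_recl /= a0 in S.
have E : \sum_(i < k.+1) ((bump 0 i)%:R + 1) * (a (k.+1 - bump 0 i)%N * a (bump 0 i)) =
    (k%:R / 2 + 2^-1) * D k.
  rewrite -sum_symD; apply: eq_bigr => i _; rewrite /bump add1n subSS.
  by rewrite mulrCA -(natr1 i) -addrA H mulrCA.
rewrite E subn0 in S; have := H k.+1; rewrite -(natr1 k) in S *.
have k0 : 0 <= k%:R :> R by []; move: (k%:R) S k0 => x S x0.
move=> H1; apply: (mulfI (x := x + 3)); first by rewrite gt_eqF//; lra.
move: S IH H1; move: (D _) (D _) (a _) (a _) => d1 d2 a1 a2; nra.
Qed.

(** The same argument with weight i + 2 and steps of two: a_(2 k) is Catalan(k) / 4^k and odd terms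
    vanish. Two consecutive indices are proved together because the recurrence skips one. *)
Lemma catalan_conv2 : a 1%N = 0 -> (forall k, (k%:R + 4) * a k.+2 = (k%:R + 1) * a k) ->
  forall k, a k.+2 = 4^-1 * D k.
Proof.
move=> a1 H; suff HH k : a k.+2 = 4^-1 * D k /\ a k.+3 = 4^-1 * D k.+1.
  by move=> k; case: (HH k).
elim: k => [|k [IH1 IH2]].
  have := H 0%N; have := H 1%N; rewrite /D big_ord1 !big_ord_recl big_ord0 /= /bump /= a0 a1.
  by split; lra.
split=> //; have S := sum_symD k.+2 2; rewrite 2!big_ord_recl /= a0 in S.
have E : \sum_(i < k.+1) ((bump 0 (bump 0 i))%:R + 2) *
    (a (k.+2 - bump 0 (bump 0 i))%N * a (bump 0 (bump 0 i))) =
    (k%:R / 2 + 1) * D k.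
  rewrite -sum_symD; apply: eq_bigr => i _; rewrite /bump !add1n !subSS.
  have -> : i.+2%:R + 2 = i%:R + 4 :> R by rewrite -(natr1 i.+1) -(natr1 i); ring.
  by rewrite mulrCA H mulrCA.
rewrite E subn0 /bump /= a1 !mulr0 add0r in S; have := H k.+2; rewrite -(natr1 k.+1) -(natr1 k) in S *.
have k0 : 0 <= k%:R :> R by []; move: (k%:R) S k0 => x S x0.
move=> H1; apply: (mulfI (x := x + 6)); first by rewrite gt_eqF//; lra.
move: S IH1 H1; move: (D _) (D _) (a _) (a _) => d1 d2 b1 b2; nra.
Qed.

End CatalanConvolution.

Section NuFunctional.
Context {R : realType} (c : weight_case R).
Local Notation leb := (@lebesgue_measure R).

(** [nu_pearson] at powers of X gives first-order recurrences for the moments, which the Catalan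
    lemmas turn into the convolutions satisfied by the limits of the power sums. *)
Lemma nu_functional : exists N : {scalar {poly R}},
  [/\ forall p, (\int[leb]_x (p.[x] * nu_full c x)%:E = (N p)%:E)%E, N 1 = 1 &
      if c is Laguerre _
      then forall k, N 'X^(k.+1) = 4^-1 * \sum_(i < k.+1) N 'X^(k - i) * N 'X^i
      else N 'X = 0 /\
           forall k, N 'X^(k.+2) = 4^-1 * \sum_(i < k.+1) N 'X^(k - i) * N 'X^i].
Proof.
have [N HN] := poly_functional (nu_poly_integrable c); exists N.
have N1 : N 1 = 1.
  apply: EFin_inj; rewrite -HN -(nu_mass c); apply: eq_integral => x _.
  by rewrite hornerC mul1r.
have a0 : N 'X^0 = 1 by rewrite expr0.
split => //; have := nu_pearson HN; case: c => [_|] H.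
  apply: (@catalan_conv1 _ (fun k => N 'X^k) a0) => k; have := H 'X^k.
  have -> : 'X * (1 - 'X) * ('X^k)^`() + (2^-1%:P - 2 *: 'X) * 'X^k =
      (k%:R + 2^-1) *: 'X^k - (k%:R + 2) *: 'X^(k.+1) :> {poly R}.
    have -> : 'X * (1 - 'X) * ('X^k)^`() = k%:R *: ((1 - 'X) * 'X^k) :> {poly R}.
      case: k => [|k]; first by rewrite expr0 derivC mulr0 scale0r.
      by rewrite derivXn /= mulrnAr scaler_nat exprS; congr (_ *+ _); ring.
    rewrite mulrBl mul1r scalerBr mulrBl mul_polyC -scalerAl -!exprS !scalerDl.
    by rewrite addrACA -opprD.
  by rewrite functionalB !functionalZ => /eqP; rewrite subr_eq0 eq_sym => /eqP.
have N1' : N 'X^1 = 0.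
  have := H 1; rewrite derivC mulr0 add0r mulr1 linearN linearZ /= => /eqP.
  by rewrite oppr_eq0 mulf_eq0 pnatr_eq0 => /eqP.
split => //; apply: (@catalan_conv2 _ (fun k => N 'X^k) a0) => // k; have := H 'X^(k.+1).
have -> : (1 - 'X ^+ 2) * ('X^(k.+1))^`() - 3 *: 'X * 'X^(k.+1) =
    (k%:R + 1) *: 'X^k - (k%:R + 4) *: 'X^(k.+2) :> {poly R}.
  rewrite derivXn /= mulrnAr -scaler_nat -natr1 mulrBl mul1r -exprD -scalerAl -exprS add2n.
  rewrite scalerBr -addrA -opprD -scalerDl; congr (_ - _ *: _); ring.
by rewrite functionalB !functionalZ => /eqP; rewrite subr_eq0 eq_sym => /eqP.
Qed.

End NuFunctional.

(** * Zero counting measures *)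

Section CountingIntegral.
Context {R : realType}.
Local Notation leb := (@lebesgue_measure R).

Lemma continuous_measurable_borelC (f : R[i] -> R) : continuous f ->
  measurable_fun [set: borelC R] (f : borelC R -> R).
Proof.
move=> /continuousP cf; apply: (measurability _ (RGenOpens.measurableE R)).
move=> _ [_ [a [b ->] <-]]; rewrite setTI.
by apply: sub_sigma_algebra; apply/cf/interval_open.
Qed.

Lemma ge0_integral_root_counting (q : {poly R[i]}) (f : borelC R -> R) : q != 0 ->
  measurable_fun [set: borelC R] f -> (forall z, 0 <= f z) ->
  (\int[root_counting_measure q]_z (f z)%:E = (avg f (zeros q))%:E)%E.
Proof.
move=> q0 mf f0.
have mf' : measurable_fun [set: borelC R] (EFin \o f) by exact/measurable_EFinP.
have f0' (z : borelC R) : [set: borelC R] z -> (0 <= (f z)%:E)%E by rewrite lee_fin.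
rewrite /root_counting_measure ge0_integral_mscale//.
rewrite ge0_integral_measure_sum//.
under eq_bigr do rewrite integral_dirac// diracT mul1e.
rewrite sumEFin -EFinM /avg size_zeros_poly//; congr (_ * _)%:E.
by rewrite (big_nth 0) big_mkord size_zeros_poly.
Qed.

Lemma integral_root_counting (q : {poly R[i]}) (f : R[i] -> R) : q != 0 -> continuous f ->
  (\int[root_counting_measure q]_z (f z)%:E = (avg f (zeros q))%:E)%E.
Proof.
move=> q0 cf; rewrite integralE; have mf := continuous_measurable_borelC cf.
have -> : (\int[root_counting_measure q]_z (fun z => (f z)%:E)^\+ z =
    (avg (fun z => Num.max (f z) 0) (zeros q))%:E)%E.
  rewrite -ge0_integral_root_counting//.
  - by apply: eq_integral => z _; rewrite funeposE -EFin_max.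
  - by apply: measurable_maxr => //; exact: measurable_cst.
  - by move=> z; rewrite le_max lexx orbT.
have -> : (\int[root_counting_measure q]_z (fun z => (f z)%:E)^\- z =
    (avg (fun z => Num.max (- f z) 0) (zeros q))%:E)%E.
  rewrite -ge0_integral_root_counting//.
  - by apply: eq_integral => z _; rewrite funenegE -EFin_max.
  - by apply: measurable_maxr; [exact: measurableT_comp | exact: measurable_cst].
  - by move=> z; rewrite le_max lexx orbT.
rewrite -EFinB /avg -mulrBr -sumrB; congr (_ * _)%:E; apply: eq_bigr => z _.
by have [h|h] := lerP (f z) 0; have [h'|h'] := lerP (- f z) 0; lra.
Qed.

Context (c : weight_case R).

Let inu : leb.-integrable [set: R] (EFin \o nu_full c).
Proof. by apply: integrable_of_fin_num; [exact: measurable_nu_full | rewrite nu_mass]. Qed.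

Lemma bounded_nu_integrable (f : R -> R) (A : R) : measurable_fun [set: R] f ->
  (forall t, Delta_c c t -> `|f t| <= A) ->
  leb.-integrable [set: R] (EFin \o (fun t => f t * nu_full c t)).
Proof.
move=> mf fA.
have mfn : measurable_fun [set: R] (EFin \o (fun t => f t * nu_full c t)).
  by apply/measurable_EFinP; apply: measurable_funM => //; exact: measurable_nu_full.
have ib : leb.-integrable [set: R] (fun t => A%:E * (EFin \o nu_full c) t)%E.
  exact: integrableZl.
apply: le_integrable ib => // t _ /=; rewrite lee_fin [leLHS]normrM [leRHS]normrM.
have [Dx|Dx] := pselect (Delta_c c t); last first.
  by rewrite /nu_full indicE memNset// mulr0 normr0 !mulr0.
by rewrite ler_wpM2r// (le_trans (fA _ Dx))// ler_norm.
Qed.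

Lemma integral_nu (f : R[i] -> R) : continuous f -> (exists A, forall z, `|f z| <= A) ->
  (\int[nu c]_z (f z)%:E = \int[leb]_t (f t%:C%C * nu_full c t)%:E)%E.
Proof.
move=> cf [A fA]; have mf := continuous_measurable_borelC cf.
have mf' : measurable_fun [set: measurableTypeR R] (fun t : R => f t%:C%C).
  by apply: (measurableT_comp mf); exact: measurable_real_complex.
have nuE B : measurable B -> nu_line c B = (\int[leb]_(x in B) (nu_full c x)%:E)%E by [].
have mn := measurable_nu_full c; have n0 := nu_full_ge0 c.
have H := @integral_density _ _ _ leb (nu_line c) (nu_full c) mn n0 nuE _ mf'.
have i1 : (nu_line c).-integrable [set: R] (EFin \o (fun t : R => f t%:C%C)).
  apply: (@integrable_density _ _ _ leb (nu_line c) (nu_full c) mn n0 nuE _ mf').2.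
  exact: (bounded_nu_integrable mf' (fun t _ => fA _)).
have mfE : measurable_fun [set: borelC R] (EFin \o f) by exact/measurable_EFinP.
rewrite -H; exact: (@integral_pushforward _ _ _ _ R
  (real_complex R : measurableTypeR R -> borelC R) (@measurable_real_complex R)
  (nu_line c) setT (EFin \o f) mfE i1 measurableT).
Qed.

(** Integration over Delta_c alone suits functions whose continuity is known on the interval
    only. *)
Definition nu_mean (g : R -> R) : R := \int[leb]_(t in Delta_c c) (g t * nu_full c t).

(** The limit measure has mass 1, so a uniform error e on Delta_c stays e after integration. *)
Lemma nu_mean_near (N : {scalar {poly R}}) :
  (forall p, (\int[leb]_x (p.[x] * nu_full c x)%:E = (N p)%:E)%E) ->
  forall (g : R -> R) (p : {poly R}) e, 0 < e -> {within `[nu_lo c, 1], continuous g} ->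
    (forall t, nu_lo c <= t <= 1 -> `|g t - p.[t]| <= e) ->
    `|nu_mean g - \sum_(k < size p) p`_k * N 'X^k| <= e.
Proof.
move=> HN g p e e0 cg gp.
have mD : measurable (Delta_c c : set R) by rewrite Delta_cE; exact: measurable_itv.
have ip : leb.-integrable (Delta_c c) (EFin \o (fun t => p.[t] * nu_full c t)).
  by apply: integrableS (nu_poly_integrable c p).
have NE : \sum_(k < size p) p`_k * N 'X^k = \int[leb]_(t in Delta_c c) (p.[t] * nu_full c t).
  transitivity (N p).
    by rewrite -[in RHS](coefK p) poly_def linear_sum; apply: eq_bigr => i _; rewrite linearZ.
  rewrite -[LHS]/(fine (N p)%:E) -HN; congr fine.
  rewrite [RHS]integral_mkcond; apply: eq_integral => x _; rewrite patchE.
  by case: ifPn => // H; rewrite /nu_full indicE (negbTE H) !mulr0.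
have gm : measurable_fun (Delta_c c) g.
  by rewrite Delta_cE; apply: subspace_continuous_measurable_fun => //; exact: measurable_itv.
pose h t := (g t - p.[t]) * nu_full c t.
have inD : leb.-integrable (Delta_c c) (EFin \o nu_full c) by apply: integrableS inu.
have ie : leb.-integrable (Delta_c c) (EFin \o (fun t => e * nu_full c t)).
  have : leb.-integrable (Delta_c c) (fun t => e%:E * (EFin \o nu_full c) t)%E.
    exact: integrableZl.
  by [].
have he t : Delta_c c t -> `|h t| <= e * nu_full c t.
  rewrite Delta_cE /= in_itv /= => /gp H.
  by rewrite /h normrM (ger0_norm (nu_full_ge0 c t)) ler_wpM2r// nu_full_ge0.
have ih : leb.-integrable (Delta_c c) (EFin \o h).
  apply: le_integrable ie => //.
    apply/measurable_EFinP; apply: measurable_funM; last exact: measurable_funTS (measurable_nu_full c).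
    by apply: measurable_funB => //; apply: measurable_funTS; exact: measurable_horner.
  move=> t Dt; rewrite lee_fin; apply: le_trans (he _ Dt) (ler_norm _).
have -> : nu_mean g = \int[leb]_(t in Delta_c c) (p.[t] * nu_full c t + h t).
  by apply: eq_Rintegral => t _; rewrite /h -mulrDl addrC subrK.
rewrite NE RintegralD// addrAC subrr add0r.
apply: (@le_trans _ _ (\int[leb]_(t in Delta_c c) `|h t|)).
  exact: le_normr_Rintegral.
apply: (@le_trans _ _ (\int[leb]_(t in Delta_c c) (e * nu_full c t))).
  apply: le_Rintegral => //.
  exact: (integrable_norm ih).
rewrite RintegralZl// -[leRHS]mulr1 ler_wpM2l//; first exact: ltW.
rewrite -[leRHS]/(fine 1%E) -(nu_mass c) le_eqVlt; apply/orP; left; apply/eqP; congr fine.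
rewrite [LHS]integral_mkcond; apply: eq_integral => x _; rewrite patchE.
by case: ifPn => // H; rewrite /nu_full indicE (negbTE H) mulr0.
Qed.

Lemma integral_nu_mean (f : R[i] -> R) : continuous f -> (exists A, forall z, `|f z| <= A) ->
  (\int[nu c]_z (f z)%:E = (nu_mean (fun t => f t%:C%C))%:E)%E.
Proof.
move=> cf fb; rewrite integral_nu// /nu_mean /Rintegral.
have mf := continuous_measurable_borelC cf.
have mf' : measurable_fun [set: measurableTypeR R] (fun t : R => f t%:C%C).
  by apply: (measurableT_comp mf); exact: measurable_real_complex.
have [A fA] := fb; have i1 := bounded_nu_integrable mf' (fun t _ => fA _).
transitivity (fine (\int[leb]_t (f t%:C%C * nu_full c t)%:E)%E)%:E.
  by rewrite fineK//; apply: integrable_fin_num i1.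
congr (fine _)%:E; rewrite [RHS]integral_mkcond; apply: eq_integral => x _; rewrite patchE.
by case: ifPn => // H; rewrite /nu_full indicE (negbTE H) !mulr0.
Qed.

End CountingIntegral.

(** * Limit distribution and accumulation points *)

Section ZeroDistribution.
Context {R : realType}.
Local Notation leb := (@lebesgue_measure R).
Import ComplexField.Normc.

Context (c : weight_case R).

(** Sufficient for weak convergence and for the accumulation points; stated for a general sequence
    so that the polynomials and their derivatives are treated alike. *)
Definition zeros_distributed (q : nat -> {poly R[i]}) :=
  [/\ exists n0, forall n, (n0 <= n)%N -> q n != 0,
      forall d : R, 0 < d -> exists n0, forall n, (n0 <= n)%N -> forall z, z \in zeros (q n) ->
        exists2 t, nu_lo c <= t <= 1 & normc (z - t%:C%C) < d &
      exists N : {scalar {poly R}},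
        (forall p, (\int[leb]_x (p.[x] * nu_full c x)%:E = (N p)%:E)%E) /\
        forall k, normc (cavg (fun z => z ^+ k) (zeros (q n)) - (N 'X^k)%:C%C)
          @[n --> \oo] --> (0 : R)].

Lemma zeros_distributed_avg q f : zeros_distributed q -> continuous f ->
  (exists A, forall z, `|f z| <= A) ->
  avg f (zeros (q n)) @[n --> \oo] --> nu_mean c (fun t => f t%:C%C).
Proof.
move=> [_ near_itv [N [HN mom]]] cf [A fA].
exact: (near_real_avg_cvg (nu_lo_lt1 c) near_itv mom (nu_mean_near HN) cf fA).
Qed.

Lemma zeros_distributed_cvg q : zeros_distributed q ->
  weak_star_cvg (fun n => root_counting_measure (q n)) (nu c).
Proof.
move=> qd f cf fb; rewrite integral_nu_mean//.
have H : (avg f (zeros (q n)))%:E @[n --> \oo] --> (nu_mean c (fun t => f t%:C%C))%:E.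
  by apply: cvg_EFin; [exact: nearW | exact: zeros_distributed_avg].
apply: cvg_trans H; apply: near_eq_cvg.
have [[n0 q0] _ _] := qd; exists n0 => // n /= n0n.
by rewrite integral_root_counting//; exact: q0.
Qed.

Lemma nu_density_gt0 (t : R) : nu_lo c < t < 1 -> 0 < nu_density c t.
Proof.
move=> /andP[lt t1]; rewrite /nu_density mulr_gt0 ?divr_gt0 ?pi_gt0//.
case: c lt => [al|] /= lt; rewrite sqrtr_gt0; last by nra.
by rewrite divr_gt0// subr_gt0.
Qed.

Lemma nu_mean_gt0 (f : R[i] -> R) (t : R) : continuous f -> (forall z, 0 <= f z) ->
  (exists A, forall z, `|f z| <= A) -> nu_lo c < t < 1 -> 0 < f t%:C%C ->
  0 < nu_mean c (fun t => f t%:C%C).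
Proof.
move=> cf f0 fb t01 ft; rewrite -lte_fin -integral_nu_mean// integral_nu//.
have mf := continuous_measurable_borelC cf.
have mf' : measurable_fun [set: measurableTypeR R] (fun t : R => f t%:C%C).
  by apply: (measurableT_comp mf); exact: measurable_real_complex.
have tE : \forall y \near t, nu_density c y = nu_full c y.
  have : \forall y \near t, y \in `]nu_lo c, 1[ by apply: near_in_itvoo; rewrite in_itv.
  apply: filterS => y; rewrite in_itv /= => /andP[? ?].
  by rewrite /nu_full indicE mem_set ?mulr1// Delta_cE /= in_itv /= !ltW.
have t1E := nbhs_singleton tE.
apply: (@integral_gt0_point _ _ _ t) => //.
- exact: filterT.
- by apply: measurable_funM => //; exact: measurable_nu_full.
- by move=> y _; rewrite mulr_ge0// nu_full_ge0.
- apply: cvgM.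
    apply/cvgrPdist_lt => e e0; have [d d0 Hd] := continuous_normcP (cf t%:C%C) e0.
    apply/nbhs_ballP; exists d => //= t'; rewrite /ball /= => tt'.
    by rewrite distrC; apply: Hd; rewrite -rmorphB normc_real distrC.
  by rewrite -t1E; apply: cvg_trans (near_eq_cvg tE) _; exact: nu_density_continuous.
- by rewrite mulr_gt0// -t1E nu_density_gt0.
Qed.

(* Otherwise a bump function at t would have nu-mean 0. *)
Lemma zeros_distributed_dense q (t d : R) : zeros_distributed q -> nu_lo c <= t <= 1 ->
  0 < d -> forall n0, exists2 n, (n0 <= n)%N & exists2 x, normc (x - t%:C%C) < d & root (q n) x.
Proof.
move=> qd t01 d0 n0; apply: contrapT => H.
pose f z := Num.max 0 (1 - normc (z - t%:C%C) / d).
have f0 z : 0 <= f z by rewrite le_max lexx.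
have f1 z : f z <= 1.
  by rewrite ge_max ler01 gerBl divr_ge0// ?normc_ge0// ltW.
have fb : exists A, forall z, `|f z| <= A by exists 1 => z; rewrite ger0_norm.
have fd z : d <= normc (z - t%:C%C) -> f z = 0.
  by move=> dz; apply/max_idPl; rewrite subr_le0 ler_pdivlMr// mul1r.
have cf : continuous f.
  move=> z; apply/(@cvgrPdist_lt _ R^o _ (nbhs z) (nbhs_filter z)) => e e0; apply/nbhs_normcP.
  exists (e * d); first by rewrite mulr_gt0.
  move=> y yz; have lip (a b : R) : `|Num.max 0 a - Num.max 0 b| <= `|a - b|.
    have := ler_norm (a - b); have := ler_norm (b - a); rewrite (distrC b a) => ? ?.
    by have [?|?] := lerP 0 a; have [?|?] := lerP 0 b; rewrite ler_norml; apply/andP; split; lra.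
  apply: le_lt_trans (lip _ _) _.
  rewrite (_ : _ - _ = (normc (y - t%:C%C) - normc (z - t%:C%C)) / d); last first.
    by field; rewrite gt_eqF.
  rewrite normrM (gtr0_norm (x := d^-1)) ?invr_gt0// ltr_pdivrMr//.
  apply: le_lt_trans yz.
  have E1 := normcD (y - z) (z - t%:C%C); have E2 := normcD (z - y) (y - t%:C%C).
  rewrite !addrA !subrK in E1 E2; rewrite (normc_distC z y) in E2.
  by rewrite ler_norml; apply/andP; split; lra.
have [s s01 st] : exists2 s, nu_lo c < s < 1 & `|s - t| < d.
  have := nu_lo_lt1 c; have /andP[lt t1] := t01 => l1.
  have [tm|tm] := leP t ((nu_lo c + 1) / 2).
    exists (Num.min (t + d / 2) ((t + 1) / 2)).
      by rewrite lt_min gt_min; apply/andP; split; [apply/andP; split; lra | apply/orP; right; lra].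
    rewrite ltr_norml; have [?|?] := leP (t + d / 2) ((t + 1) / 2); apply/andP; split; lra.
  exists (Num.max (t - d / 2) ((t + nu_lo c) / 2)).
    by rewrite lt_max gt_max; apply/andP; split; [apply/orP; right; lra | apply/andP; split; lra].
  rewrite ltr_norml; have [?|?] := leP (t - d / 2) ((t + nu_lo c) / 2); apply/andP; split; lra.
have fs : 0 < f s%:C%C.
  by rewrite lt_max -rmorphB normc_real subr_gt0 ltr_pdivrMr// mul1r st orbT.
have := nu_mean_gt0 cf f0 fb s01 fs.
suff -> : nu_mean c (fun t => f t%:C%C) = 0 by rewrite ltxx.
have L := zeros_distributed_avg qd cf fb.
apply: (cvg_unique (@Rhausdorff R) L).
apply/cvgrPdist_le => e e0.
have [[n1 q0] _ _] := qd; exists (maxn n0 n1) => // n /=; rewrite geq_max => /andP[n0n n1n].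
rewrite /avg big_seq big1 ?mulr0 ?subrr ?normr0 1?ltW// => z; rewrite mem_zeros ?q0// => qz.
apply: fd; rewrite leNgt; apply/negP => zt; apply: H.
by exists n => //; exists z.
Qed.

(** One inclusion is the approach of the zeros to the closed interval; the other is
    [zeros_distributed_dense] beyond the maximum of a supposedly finite set of indices. *)
Lemma zeros_distributed_acc n0 q : zeros_distributed q ->
  zero_accumulation_points n0 q = [set (t%:C)%C | t in Delta_c c].
Proof.
move=> qd; rewrite Delta_cE; apply/seteqP; split => z /=; last first.
  move=> [t]; rewrite in_itv /= => t01 <- U /nbhs_normcP[d d0 dU] /finite_seqP[s sE].
  have [n] := zeros_distributed_dense qd t01 d0 (maxn n0 (\max_(i <- s) i).+1).
  rewrite geq_max => /andP[n0n sn] [x xt qx].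
  have : n \in s.
    by have : [set` s] n by rewrite -sE; split=> //; exists x => //; exact: dU.
  move=> ns; have := @leq_bigmax_seq _ s predT (fun i => i) n ns isT.
  by rewrite leqNgt sn.
move=> zacc; have [[n1 q0] near_itv _] := qd.
have close d : 0 < d -> exists2 t, nu_lo c <= t <= 1 & normc (z - t%:C%C) < d.
  move=> d0; have d20 : 0 < d / 2 by rewrite divr_gt0.
  have [n2 Hn2] := near_itv _ d20.
  have nU : nbhs z [set y | normc (y - z) < d / 2] by apply/nbhs_normcP; exists (d / 2).
  have := infinite_setD (zacc _ nU) (finite_II (maxn n1 n2)).
  move=> /infinite_setN0[n [[_ [x /= xz qx]] /negP]]; rewrite -leqNgt geq_max => /andP[n1n n2n].
  have [|t t01 xt] := Hn2 _ n2n x; first by rewrite mem_zeros// q0.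
  exists t => //; have := normcD (z - x) (x - t%:C%C).
  by rewrite addrA subrK (normc_distC z x) => ?; lra.
(* Every real point is at distance at least |Im z| from z. *)
have im0 : complex.Im z = 0.
  apply/eqP; apply: contraT => im0; have [|t _] := close `|complex.Im z|.
    by rewrite normr_gt0.
  rewrite ltNge -(@ler_pXn2r _ 2)// ?nnegrE ?normc_ge0// normc_sqr real_normK ?num_real//.
  by case: (z) => x y /=; rewrite subr0 lerDr sqr_ge0.
have zE : (complex.Re z)%:C%C = z by rewrite [RHS]complexE im0 mulr0 addr0.
exists (complex.Re z) => //; rewrite in_itv /=.
have cl (d : R) : 0 < d -> nu_lo c - d < complex.Re z < 1 + d.
  move=> /close[t /andP[lt t1]]; rewrite -zE -rmorphB normc_real ltr_norml => /andP[? ?].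
  by apply/andP; split; lra.
by apply/andP; split; apply/ler_addgt0Pl => d /cl/andP[? ?]; lra.
Qed.

End ZeroDistribution.

Section Qfrak.
Context {R : realType} (c : weight_case R) (hc : admissible c) (m : nat).
Context (mu : {finite_measure set (measurableTypeR R) -> \bar R}) (hmu : class_P c m mu).
Context (P L : nat -> {poly R}) (hP : monic_OPS mu P) (hL : monic_OPS (w c) L).

Let Qfrak_Qscaled (E : {scalar {poly R}}) n :
  (forall n j, coef_b c P L n j = conn E L P n j) -> (m < n)%N ->
  Qfrak c P L m n = Qscaled E L P m (scale c) n.
Proof.
move=> bE mn; rewrite /Qfrak /Qscaled /Qhat /Qpert; congr map_poly; congr (_ *: (_ \Po _)).
apply: eq_bigr => k _; rewrite bE /lam; congr (_ * _ *: _).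
by rewrite invrN mulrNN.
Qed.

Lemma Qfrak_distributed : zeros_distributed c (Qfrak c P L m) /\
  zeros_distributed c (fun n => (Qfrak c P L m n)^`()).
Proof.
have [E [M [rho [[posED posMD opsL opsP] [srho EM rho_ge0 HE bE]]]]] :=
  class_P_functionals hmu hP hL.
have posE := posdef_of_pos posED; have posM := posdef_of_pos posMD.
have [N [HN N1 Nconv]] := nu_functional c.
have N0 : N 'X^0 = 1 by rewrite expr0.
have lo0 : nu_lo c <= 0 by case: (c) => //= _; lra.
(* The inputs of the general asymptotics, supplied separately for the two weights. *)
have [c_large [zeros_near [norm_growth mom_cvg]]] :
    (forall A : R, exists n0, forall n, (n0 <= n)%N -> A <= scale c n) /\
    (forall (eps : R) r, 0 < eps -> exists n0, forall n, (n0 <= n)%N ->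
       forall K y, (K <= n + r)%N -> root (L K) y || root (P K) y ->
       nu_lo c - eps <= y / scale c n <= 1 + eps) /\
    (exists kap : R, [/\ 0 < kap, kap <= 1 & exists n0, forall n, (n0 <= n)%N ->
       forall j, (n - m <= j < n + m)%N ->
       kap * scale c n ^+ 2 * E (L j * L j) <= E (L j.+1 * L j.+1)]) /\
    (forall s : nat -> seq R, (forall n, L n = \prod_(y <- s n) ('X - y%:P)) ->
       forall k, psum (s n) k / (n%:R * scale c n ^+ k) @[n --> \oo] --> N 'X^k).
  case: c hc posED posMD rho_ge0 HE Nconv => [al|] /= hal posED posMD rho_ge0 HE Nconv.
    have pE := laguerre_pearson hal HE.
    have DP (x : R) : (`[0, +oo[%classic : set R) x <-> 0 <= x by rewrite /= in_itv /= andbT.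
    split; first exact: laguerre_c_large.
    split; first exact: (laguerre_zeros_near posE opsL posM opsP posED posMD srho EM rho_ge0 pE DP).
    split; first exact: (laguerre_norm_growth posE opsL m pE).
    move=> s Ls k.
    exact: (@laguerre_mom_cvg _ _ _ posE opsL _ pE (fun k => N 'X^k) N0 Nconv s Ls k).
  have pE := hermite_pearson HE.
  split; first exact: hermite_c_large.
  split.
    by apply: (hermite_zeros_near posE opsL posM opsP posED posMD srho EM rho_ge0 pE).
  split; first exact: (hermite_norm_growth posE opsL m pE).
  move=> s Ls k; have [N1' Nconv'] := Nconv.
  exact: (@hermite_mom_cvg _ _ _ posE opsL pE (fun k => N 'X^k) N0 N1' Nconv' s Ls k).
have [n1 Hn1] := c_large 1.
have c0 n : (maxn n1 m.+1 <= n)%N -> (m < n)%N /\ 0 < scale c n.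
  by rewrite geq_max => /andP[/Hn1 H1 mn]; split=> //; apply: lt_le_trans H1.
have QE n : (maxn n1 m.+1 <= n)%N -> Qfrak c P L m n = Qscaled E L P m (scale c) n.
  by move=> /c0[mn _]; exact: Qfrak_Qscaled.
split; split.
- exists (maxn n1 m.+1) => n nn; have [mn cn] := c0 n nn.
  by rewrite QE//; exact: (Qscaled_neq0 posE opsL opsP mn cn).
- move=> d d0; have [n2 Hn2] := zeros_Qscaled_near posE opsL posM opsP srho EM lo0 ler01
    c_large zeros_near norm_growth d0.
  exists (maxn n2 (maxn n1 m.+1)) => n; rewrite geq_max => /andP[nn2 nn] z.
  by rewrite QE//; exact: Hn2.
- exists N; split=> // k.
  have H := zeros_Qscaled_moment posE opsL posM opsP srho EM lo0 ler01
    c_large zeros_near norm_growth mom_cvg k.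
  apply: cvg_trans H; apply: near_eq_cvg; exists (maxn n1 m.+1) => // n /= nn.
  by rewrite QE.
- exists (maxn n1 m.+1) => n nn; have [mn cn] := c0 n nn.
  by rewrite QE//; exact: (deriv_Qscaled_neq0 posE opsL opsP mn cn).
- move=> d d0; have [n2 Hn2] := zeros_deriv_Qscaled_near posE opsL posM opsP srho EM lo0 ler01
    c_large zeros_near norm_growth d0.
  exists (maxn n2 (maxn n1 m.+1)) => n; rewrite geq_max => /andP[nn2 nn] z.
  by rewrite QE//; exact: Hn2.
- exists N; split=> // k.
  have H := zeros_deriv_Qscaled_moment posE opsL posM opsP srho EM lo0 ler01
    c_large zeros_near norm_growth mom_cvg k.
  apply: cvg_trans H; apply: near_eq_cvg; exists (maxn n1 m.+1) => // n /= nn.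
  by rewrite QE.
Qed.

End Qfrak.

Theorem theorem1 (R : realType) (c : weight_case R) (hc : admissible c)
    (m : nat) (mu : {finite_measure set (measurableTypeR R) -> \bar R})
    (hmu : class_P c m mu) (P L : nat -> {poly R})
    (hP : monic_OPS mu P) (hL : monic_OPS (w c) L) :
  (weak_star_cvg (fun n => root_counting_measure (Qfrak c P L m n)) (nu c) /\
   weak_star_cvg (fun n => root_counting_measure (Qfrak c P L m n)^`()) (nu c)) /\
  zero_accumulation_points m.+1 (Qfrak c P L m) =
    [set (t%:C)%C | t in Delta_c c].
Proof.
have [Qd Qd'] := Qfrak_distributed hc hmu hP hL; split.
  by split; [exact: zeros_distributed_cvg Qd | exact: (zeros_distributed_cvg Qd')].
exact: zeros_distributed_acc.
Qed.
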